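(* For every complex number $z$ with $|z|<1$, the function $$P(z) = -\prod_{n=1}^{\infty} \bigl(\Phi_n(z)\bigr)^{-1/n},$$ where $\Phi_n$ is the $n$-th cyclotomic polynomial, satisfies $P(z)=1$; that is, $P(z)\equiv 1$ identically on the open unit disk. Explicitly, the limit $P(z)=\lim_{N\to\infty}\bigl(-\prod_{n=1}^{N}(\Phi_n(z))^{-1/n}\bigr)$ exists and equals $1$ for every $z$ with $|z|<1$.
   Context: The $n$-th cyclotomic polynomial is $\Phi_n(z)=\prod_{1\le k\le n,\ \gcd(k,n)=1}\bigl(z-e^{2\pi i k/n}\bigr)$; in particular $\Phi_1(z)=z-1$. Put $\hat\Phi_n(z)=\prod_{1\le k\le n,\ \gcd(k,n)=1}\bigl(1-z e^{2\pi i k/n}\bigr)$, so that $\hat\Phi_1(z)=1-z=-\Phi_1(z)$ and $\hat\Phi_n=\Phi_n$ for $n\ge 2$. On $|z|<1$ one has $\hat\Phi_n(z)\ne 0$ and $\hat\Phi_n(0)=1$; $\operatorname{Log}\hat\Phi_n$ denotes the unique holomorphic branch of the logarithm of $\hat\Phi_n$ on $|z|<1$ with $\operatorname{Log}\hat\Phi_n(0)=0$. For $n\ge 2$ the power is interpreted as $(\Phi_n(z))^{-1/n}=\exp\bigl(-\tfrac1n\operatorname{Log}\hat\Phi_n(z)\bigr)$, while for $n=1$ the factor is simply $(\Phi_1(z))^{-1}=1/(z-1)$. The infinite product is the limit of the partial products over $n\le N$ as $N\to\infty$. Equivalently, $P(z)=\lim_{N\to\infty}P_N(z)$ with $P_N(z)=\exp\bigl(-\sum_{n\le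 N}\tfrac1n\operatorname{Log}\hat\Phi_n(z)\bigr)$, the leading minus sign having been absorbed by the $n=1$ factor. *)

(* Defs.v *)
From HB Require Import structures.
From mathcomp Require Import all_boot all_order all_algebra all_field.
From mathcomp Require Import complex.
From mathcomp Require Import all_classical all_reals all_analysis.
From mathcomp Require Import ring zify.

Set Implicit Arguments.
Unset Strict Implicit.
Unset Printing Implicit Defensive.

Import Order.TTheory GRing.Theory Num.Theory.
Import numFieldNormedType.Exports.

Local Open Scope ring_scope.
Local Open Scope complex_scope.

Definition cexp (R : realType) (z : R[i]) : R[i] :=
  (expR (complex.Re z))%:C * (cos (complex.Im z) +i* sin (complex.Im z)).

Definition unity_root (R : realType) (n k : nat) : R[i] :=
  cexp (2 * (pi : R)%:C * 'i * k%:R / n%:R).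

(* The library's [cyclotomic w n] is the product of the ['X - (w ^+ k)%:P]
   over [k < n] coprime to [n]. The index range 1 <= k <= n gives the same
   product: the two ranges differ only by the exponents 0 and n, coprime to n
   only when n = 1, and [unity_root R n 1 ^+ n = 1]. *)
Definition Phi (R : realType) (n : nat) : {poly R[i]} :=
  cyclotomic (unity_root R n 1) n.

Definition PhiHat (R : realType) (n : nat) (z : R[i]) : R[i] :=
  \prod_(1 <= k < n.+1 | coprime k n) (1 - z * unity_root R n k).

(* The type [R[i]^o] carries the topology of the complex modulus, and
   [derivable _ z 1] over the field [R[i]] is complex differentiability
   at [z]. *)
Definition is_log_branch (R : realType) (f g : R[i] -> R[i]) : Prop :=
  [/\ forall z, `|z| < 1 -> derivable (g : R[i]^o -> R[i]^o) z 1,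
      forall z, `|z| < 1 -> cexp (g z) = f z
    & g 0 = 0].

(* On the unit disk, a branch is unique when it exists; [xget] selects one,
   and its default value 0 is returned only when there is none. *)
Definition Log (R : realType) (f : R[i] -> R[i]) : R[i] -> R[i] :=
  xget (fun=> 0) [set g | is_log_branch f g]%classic.

(* (Phi_n(z))^(-1/n) *)
Definition Phi_root_inv (R : realType) (n : nat) (z : R[i]) : R[i] :=
  if n == 1%N then (Phi R 1).[z]^-1
  else cexp (- (1 / n%:R) * Log (PhiHat n) z).

Section PhiHatE.
Variable R : realType.

Lemma cexpD (x y : R[i]) : cexp (x + y) = cexp x * cexp y.
Proof.
case: x y => [a b] [c d]; rewrite /cexp /= expRD cosD sinD.
by apply/eqP; rewrite eq_complex /=; apply/andP; split; apply/eqP; ring.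
Qed.

Lemma unity_root0 n : unity_root R n 0 = 1.
Proof.
rewrite /unity_root mulr0 mul0r /cexp /= expR0 cos0 sin0 mul1r.
by apply/eqP; rewrite eq_complex /= !eqxx.
Qed.

Lemma unity_rootD n j k :
  unity_root R n (j + k) = unity_root R n j * unity_root R n k.
Proof. by rewrite /unity_root -cexpD natrD mulrDr mulrDl. Qed.

Lemma unity_rootX n k : unity_root R n 1 ^+ k = unity_root R n k.
Proof.
elim: k => [|k IH]; first by rewrite unity_root0.
by rewrite exprS IH -unity_rootD.
Qed.

Lemma cexp_im (t : R) : cexp (t%:C * 'i) = cos t +i* sin t.
Proof.
rewrite /cexp.
have -> : t%:C * 'i = 0 +i* t.
  by apply/eqP; rewrite eq_complex /= !(mulr0, mul0r, mulr1, subr0, addr0) !eqxx.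
by rewrite /= expR0 mul1r.
Qed.

Lemma unity_rootn n : (0 < n)%N -> unity_root R n n = 1.
Proof.
move=> n0; rewrite /unity_root mulfK ?pnatr_eq0 -?lt0n //.
have -> : 2 * (pi : R)%:C = (pi *+ 2 : R)%:C 
  by rewrite -(mulr_natl pi) rmorphM /= rmorph_nat.
by rewrite cexp_im cos2pi sin2pi complexr0.
Qed.

Lemma unity_root2 : unity_root R 2 1 = -1.
Proof.
have -> : unity_root R 2 1 = cexp ((pi : R)%:C * 'i).
  by congr cexp; field.
by rewrite cexp_im cospi sinpi complexr0 rmorphN1.
Qed.

Lemma coprime_subl n k : (k <= n)%N -> coprime (n - k) n = coprime k n.
Proof.
move=> kn; rewrite /coprime -{2}(subnK kn) gcdnDl.
by rewrite -{2}(subnKC kn) gcdnDl gcdnC.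
Qed.

Lemma prod_coprimeE n (F : nat -> R[i]) : (1 < n)%N ->
  \prod_(1 <= k < n.+1 | coprime k n) F k =
  \prod_(1 <= k < n | coprime k n) F k.
Proof.
move=> n1; rewrite big_mkcond big_nat_recr ?(ltnW n1) //= -big_mkcond.
by rewrite /coprime gcdnn gtn_eqF // mulr1.
Qed.

Lemma prod_coprime_rev n (P : pred nat) (F : nat -> R[i]) :
  \prod_(1 <= k < n | coprime k n && P k) F k =
  \prod_(1 <= k < n | coprime k n && P (n - k)%N) F (n - k)%N.
Proof.
rewrite big_nat_rev /= big_seq_cond [RHS]big_seq_cond.
apply: eq_big => k; rewrite mem_index_iota add1n subSS; last by [].
case: (boolP (0 < k < n)%N) => //= /andP[_ kn]; rewrite coprime_subl //; exact: ltnW.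
Qed.

Lemma horner_Phi n z : (1 < n)%N ->
  (Phi R n).[z] = \prod_(1 <= k < n | coprime k n) (z - unity_root R n k).
Proof.
move=> n1; rewrite /Phi /cyclotomic horner_prod.
rewrite -(big_mkord (fun k => coprime k n)
  (fun k => ('X - (unity_root R n 1 ^+ k)%:P).[z])).
rewrite big_mkcond big_ltn ?(ltnW n1) //= -big_mkcond.
rewrite /coprime gcd0n gtn_eqF // mul1r.
by apply: eq_bigr => k _; rewrite hornerXsubC unity_rootX.
Qed.

Lemma PhiHat1 z : PhiHat 1 z = - (Phi R 1).[z].
Proof.
rewrite /PhiHat /Phi /cyclotomic big_mkcond big_nat1 /= big_mkcond.
by rewrite big_ord1 /= unity_rootn // mulr1 hornerXsubC opprB.
Qed.

Lemma prod_opp_unity_root n : (1 < n)%N ->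
  \prod_(1 <= k < n | coprime k n) (- unity_root R n k) = 1.
Proof.
rewrite leq_eqVlt => /predU1P[<-|n2].
  by rewrite big_mkcond big_nat1 /= unity_root2 opprK.
rewrite (bigID (fun k => k.*2 < n)%N) /=.
rewrite (prod_coprime_rev n (fun k => ~~ (k.*2 < n)%N)).
rewrite [X in _ * X](_ : _ = \prod_(1 <= k < n | coprime k n && (k.*2 < n)%N)
    (- unity_root R n (n - k))).
  rewrite -big_split /= big_seq_cond big1 // => k; rewrite mem_index_iota.
  case/andP => /andP[_ kn] _; rewrite mulrNN -unity_rootD subnKC ?(ltnW kn) //.
  by rewrite unity_rootn // (leq_trans _ n2).
rewrite big_seq_cond [RHS]big_seq_cond; apply: eq_bigl => k.
rewrite mem_index_iota; case: (boolP (0 < k < n)%N) => //= /andP[k0 kn].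
case: (boolP (coprime k n)) => //= kcn.
have : k.*2 != n.
  apply/eqP => kE; move: kcn; rewrite /coprime -kE -mul2n gcdnMl => /eqP k1.
  by rewrite -kE k1 in n2.
lia.
Qed.

Lemma PhiHatE n z : (1 < n)%N -> PhiHat n z = (Phi R n).[z].
Proof.
move=> n1; rewrite /PhiHat prod_coprimeE // horner_Phi //.
have rev F : \prod_(1 <= k < n | coprime k n) F k =
    \prod_(1 <= k < n | coprime k n) F (n - k)%N :> R[i].
  by have := prod_coprime_rev n predT F; rewrite !big_mkcondr.
rewrite rev -[RHS]mul1r -[X in _ = X * _](prod_opp_unity_root n1).
rewrite [X in _ = X * _]rev -big_split /=.
rewrite big_seq_cond [RHS]big_seq_cond.
apply: eq_bigr => k; rewrite mem_index_iota => /andP[/andP[_ kn] _].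
have e : unity_root R n (n - k) * unity_root R n k = 1.
  by rewrite -unity_rootD subnK ?(ltnW kn) // unity_rootn // ltnW.
by rewrite -[X in X - _ = _]e; ring.
Qed.

End PhiHatE.

(* Main.v *)
(* Write [A N] for the sum of [mu n / n] over [n <= N] ([mobius_sum]) and
   [L w] for the principal logarithm of [1 - w]. Since the product of the
   [PhiHat d z] over [d | n] is [1 - z^n] and logarithm branches on the disk are
   unique, [L (z^n)] is the sum of [Log PhiHat_d z] over [d | n], so that by
   Moebius inversion the exponent of the [N]-th partial product is, up to sign,
   the sum over [d <= N] of [A (N / d) L (z^d) / d]. As [|A| <= 1] and
   [L (z^d) = O (|z|^d)], it tends to 0 as soon as [A N] does, which is an
   equivalent of the prime number theorem.

   To prove [A N -> 0], sum [A n n^(-1-s)] by parts: this Dirichlet series is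
   [1 / (s zeta (1 + s))] plus a series converging for [Re s >= 0]. The function
   [s zeta (1 + s)] is Lipschitz on bounded parts of [Re s >= 0] and does not
   vanish on [Re s = 0], by the Euler product and the inequality
   [3 + 4 cos t + cos (2 t) >= 0]. The Riemann-Lebesgue lemma then makes the
   Fejer-weighted averages of [A n] around [ln n = x] tend to 0 as [x] grows, and
   since [|A m - A n| <= |ln m - ln n|] the values [A n] themselves tend to 0. *)

Require Import Defs.
From mathcomp Require Import all_boot all_order all_algebra all_field.
From mathcomp Require Import complex.
From mathcomp Require Import all_classical all_reals all_analysis.
From mathcomp Require Import ring lra zify.
Import Order.TTheory GRing.Theory Num.Theory.
Import numFieldNormedType.Exports.
Import ComplexField.Normc.

Set Implicit Arguments.
Unset Strict Implicit.
Unset Printing Implicit Defensive.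

Local Open Scope classical_set_scope.
Local Open Scope ring_scope.
Local Open Scope complex_scope.

(** * The Moebius function *)

(** No contour integral and no analytic continuation occurs: everything rests on Lipschitz bounds,
    uniform up to the line [Re s = 0], for finite Dirichlet polynomials. The factor [s] in front of
    [zeta (1 + s)] removes the pole, so that the same bounds hold at [s = 0]. The obstacle is that
    the series of [A n n^(-1-s)] is not known to converge on that line. The limit [Re s -> 0] is
    therefore never taken: for a window centred at [ln n = x] the abscissa is [e = 1 / x], where the
    damping [n^(-e)] is about [exp (-1)], and the bounds depend neither on [e] nor on the truncation
    point once the latter is large. The triangular weight [1 - u / L] serves twice: only the segment
    [0 <= u <= L] matters, where compactness keeps [rzeta] away from 0, and its cosine transform,
    the Fejer kernel, is nonnegative with tails [O (1 / y^2)], so that terms far from the window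
    cost little although only [|A n| <= 1] is known there. *)

Definition mobius (n : nat) : int :=
  if all (fun p => logn p n == 1%N) (primes n)
  then (-1) ^+ size (primes n) else 0.

Lemma mobius1 : mobius 1 = 1.
Proof. by []. Qed.

Lemma normr_mobius n : `|mobius n| <= 1.
Proof. by rewrite /mobius; case: ifP => _ //; rewrite normrX normrN1 expr1n. Qed.

Lemma mobius_mul_prime p d : prime p -> (0 < d)%N -> ~~ (p %| d)%N ->
  mobius (p * d) = - mobius d.
Proof.
move=> p_pr d0 pd; have p0 := prime_gt0 p_pr.
have pnd : p \notin primes d by rewrite mem_primes p_pr d0.
have perm : perm_eq (primes (p * d)) (p :: primes d).
  apply: uniq_perm; rewrite /= ?primes_uniq ?pnd // => q.
  by rewrite primesM // primes_prime // !inE.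
rewrite /mobius (perm_all _ perm) (perm_size perm) /=.
rewrite lognM // logn_prime // eqxx logn_coprime; last by rewrite prime_coprime.
rewrite addn0 eqxx /=.
rewrite (_ : all _ _ = all (fun q => logn q d == 1%N) (primes d)).
  by case: ifP => _; rewrite ?oppr0 // exprS mulN1r.
apply: eq_in_all => q qd; rewrite lognM // logn_prime //.
by case: (q =P p) => // qp; rewrite -qp qd in pnd.
Qed.

Lemma mobius_sqr_prime p d : prime p -> (0 < d)%N -> (p ^ 2 %| d)%N ->
  mobius d = 0.
Proof.
move=> p_pr d0 pd; rewrite /mobius ifF //; apply/negbTE/allPn; exists p.
  by rewrite mem_primes p_pr d0 (dvdn_trans _ pd) // dvdn_mulr.
by move: pd; rewrite pfactor_dvdn // neq_ltn orbC => ->.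
Qed.

(** With [p] the least prime factor of [n], the divisors divisible by [p^2] contribute 0, and
    [d -> p d] maps those not divisible by [p] onto those divisible by [p] exactly once, reversing
    the sign. *)
Lemma sum_mobius n : (0 < n)%N ->
  \sum_(d <- divisors n) mobius d = (n == 1)%N%:R.
Proof.
move=> n0; case: (n =P 1)%N => [->|n1]; first by rewrite unlock /= mobius1.
have n_gt1 : (1 < n)%N by lia.
have p_pr := pdiv_prime n_gt1; have pn := pdiv_dvd n.
set p := pdiv n in p_pr pn; have p0 := prime_gt0 p_pr.
rewrite (bigID (fun d => p %| d)%N) /= (bigID (fun d => p ^ 2 %| d)%N) /=.
have div0 d : d \in divisors n -> (0 < d)%N.
  by rewrite -dvdn_divisors // => /dvdn_gt0; apply.
rewrite big1_seq => [|d /andP[/andP[_ pd] dn]]; last first.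
  exact: (mobius_sqr_prime p_pr (div0 _ dn)).

rewrite add0r.
rewrite -big_filter -[X in _ + X]big_filter.
have perm : perm_eq [seq d <- divisors n | (p %| d)%N && ~~ (p ^ 2 %| d)%N]
     [seq (p * d)%N | d <- [seq d <- divisors n | ~~ (p %| d)%N]].
  apply: uniq_perm; first exact/filter_uniq/divisors_uniq.
    rewrite map_inj_uniq; first exact/filter_uniq/divisors_uniq.
    by move=> a b /eqP; rewrite eqn_pmul2l // => /eqP.
  move=> d; rewrite mem_filter -dvdn_divisors //; apply/idP/mapP.
    case/andP => /andP[/dvdnP[e ->]].
    rewrite (mulnC e) dvdn_pmul2l // => pe en; exists e => //.
    by rewrite mem_filter pe -dvdn_divisors // (dvdn_trans _ en) ?dvdn_mull.
  case=> e; rewrite mem_filter -dvdn_divisors // => /andP[pe en] ->.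
  rewrite dvdn_mulr // dvdn_pmul2l // pe /=.
  by rewrite Gauss_dvd ?pn // prime_coprime.
rewrite (perm_big _ perm) big_map /= !big_filter -big_split /=.
rewrite big1_seq // => d /andP[pd dn].
by rewrite mobius_mul_prime ?addNr // div0.
Qed.

(** Both sides run over the pairs [(d, m)] with [d m <= N], grouped by the product [k = d m] on the
    left and by [d] on the right. *)
Lemma sum_divisors_exchange (V : nmodType) (f : nat -> nat -> V) N :
  \sum_(1 <= k < N.+1) \sum_(d <- divisors k) f d (k %/ d)%N =
  \sum_(1 <= d < N.+1) \sum_(1 <= m < (N %/ d).+1) f d m.
Proof.
have key k : (1 <= k < N.+1)%N -> \sum_(d <- divisors k) f d (k %/ d)%N =
    \sum_(1 <= d < N.+1 | (d %| k)%N) f d (k %/ d)%N.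
  case/andP => k0 kN; rewrite -[RHS]big_filter; apply: perm_big.
  apply: uniq_perm; rewrite ?divisors_uniq ?filter_uniq ?iota_uniq // => d.
  rewrite mem_filter mem_index_iota -dvdn_divisors //.
  case dk: (d %| k)%N => //=.
  by rewrite (dvdn_gt0 k0 dk) /= (leq_ltn_trans (dvdn_leq k0 dk)).
rewrite (eq_big_nat _ _ key) (exchange_big_dep_nat xpredT) //=.
apply: eq_big_nat => d /andP[d0 dN].
rewrite -big_filter (perm_big [seq (d * m)%N | m <- index_iota 1 (N %/ d).+1]).
  by rewrite big_map; apply: eq_bigr => m _; rewrite mulKn.
apply: uniq_perm; first exact/filter_uniq/iota_uniq.
  rewrite map_inj_uniq; first exact: iota_uniq.
  by move=> a b /eqP; rewrite eqn_pmul2l // => /eqP.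
move=> k; rewrite mem_filter mem_index_iota; apply/idP/mapP.
  case/andP=> /dvdnP[m ->] /andP[k0 kN]; exists m; last by rewrite mulnC.
  rewrite mem_index_iota; move: k0; rewrite muln_gt0 => /andP[-> _] /=.
  by rewrite ltnS leq_divRL.
case=> m; rewrite mem_index_iota => /andP[m0]; rewrite ltnS leq_divRL // => mN ->.
by rewrite dvdn_mulr //= muln_gt0 d0 m0 ltnS mulnC.
Qed.

(** Grouped by [k = d m], the coefficient of [f k] is the sum of [mobius] over the divisors of [k].
    Applied to the constant 1, to [n^(-1-s)] and to [1 / n]. *)
Lemma sum_mobius_convolution (R : pzRingType) (f : nat -> R) N : (0 < N)%N ->
  \sum_(1 <= d < N.+1) \sum_(1 <= m < (N %/ d).+1) (mobius d)%:~R * f (d * m)%N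
  = f 1%N.
Proof.
move=> N0; rewrite -(sum_divisors_exchange (fun d m => (mobius d)%:~R * f (d * m)%N)).
rewrite big_ltn // (_ : divisors 1 = [:: 1%N]) // big_seq1 mul1r divn1 muln1.
rewrite big_nat big1 ?addr0 // => k /andP[k1 _].
have k0 : (0 < k)%N by apply: leq_trans k1.
under eq_big_seq => d do [rewrite -dvdn_divisors // => dk; rewrite (mulnC d) (divnK dk)].
rewrite -mulr_suml -(rmorph_sum (intmul 1)) /=.
by rewrite sum_mobius // (gtn_eqF k1) mul0r.
Qed.

(** * Partial sums of [mu n / n] *)

Section MertensSum.
Variable R : realType.

Definition mobius_sum (N : nat) : R :=
  \sum_(1 <= n < N.+1) (mobius n)%:~R / n%:R.

Lemma normr_mobiusR n : `|(mobius n)%:~R : R| <= 1.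
Proof. by rewrite -intr_norm -(mulr1z (1:R)) ler_int normr_mobius. Qed.

(* [sum_(n <= N) mu n * floor (N / n) = 1], and for each [n <= N] other than
   [1] replacing the floor by [N / n] costs at most 1. *)
Lemma normr_mobius_sum N : `|mobius_sum N| <= 1.
Proof.
case: N => [|N]; first by rewrite /mobius_sum big_geq // normr0.
set M := N.+1; have M0 : (0 : R) < M%:R by rewrite ltr0n.
have floorE : \sum_(1 <= n < M.+1) (mobius n)%:~R * (M %/ n)%:R = 1 :> R.
  rewrite -[RHS](@sum_mobius_convolution R (fun=> 1) M) //.
  apply: eq_bigr => n _.
  by rewrite sumr_const_nat subSS subn0 mulr1 mulr_natr.
have : M%:R * mobius_sum M = 1 + \sum_(1 <= n < M.+1)
    (mobius n)%:~R * (M%:R / n%:R - (M %/ n)%:R).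
  rewrite -[X in X + _]floorE -big_split /= mulr_sumr; apply: eq_bigr => n _.
  by rewrite -mulrDr addrC subrK mulrCA.
rewrite big_ltn // divn1 (_ : 1%:R = 1 :> R) // divr1 subrr mulr0 add0r => E.
have : `|M%:R * mobius_sum M| <= 1 + N%:R.
  rewrite E; apply: le_trans (ler_normD _ _) _; rewrite normr1 lerD2l.
  apply: le_trans (ler_norm_sum _ _ _) _.
  rewrite [leRHS](_ : _ = \sum_(2 <= n < M.+1) 1); last first.
    by rewrite sumr_const_nat /M !subSS subn0.
  apply: ler_sum_nat => n /andP[n1 _]; have n0 : (0 < n)%N by apply: leq_trans n1.
  rewrite normrM -[leRHS]mulr1; apply: ler_pM => //; first exact: normr_mobiusR.
  have n0R : (0 : R) < n%:R by rewrite ltr0n.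
  rewrite {1}(divn_eq M n) natrD natrM mulrDl mulfK ?gt_eqF //.
  rewrite addrAC subrr add0r ger0_norm ?divr_ge0 // ler_pdivrMr // mul1r ler_nat.
  exact/ltnW/ltn_pmod.
rewrite normrM (ger0_norm (ltW M0)) addrC natr1 => h.
by rewrite -(@ler_pM2l _ M%:R) // mulr1.
Qed.

End MertensSum.

(** * The complex exponential *)

Section RealBounds.
Variable R : realType.
Implicit Types x y : R.

Lemma mean_value_le (f df : R -> R) a b C : a <= b ->
  (forall x, is_derive x 1 f (df x)) ->
  (forall x, a <= x <= b -> `|df x| <= C) -> `|f b - f a| <= C * (b - a).
Proof.
move=> ab fdf dfC.
have [|c cab ->] := @MVT_segment R f df a b ab (fun x _ => fdf x).
  apply: continuous_subspaceT => x; apply: differentiable_continuous.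
  by apply/derivable1_diffP; have := fdf x.
rewrite normrM (ger0_norm (_ : 0 <= b - a)) ?subr_ge0 //.
by apply: ler_wpM2r; rewrite ?subr_ge0 // dfC.
Qed.

Lemma normr_sin_le x : `|sin x| <= `|x|.
Proof.
wlog x0 : x / 0 <= x => [h|].
  have [/h//|/ltW x0] := leP 0 x.
  by rewrite -normrN -sinN -(normrN x); apply: h; rewrite oppr_ge0.
have := @mean_value_le sin cos 0 x 1 x0 _ (fun t _ => cos_max t).
by rewrite sin0 !subr0 mul1r (ger0_norm x0); apply => t; apply: is_derive_sin.
Qed.

Lemma cos_double_half x : cos x = 1 - 2 * sin (x / 2) ^+ 2.
Proof.
rewrite {1}(_ : x = (x / 2) *+ 2); last by rewrite mulr2n -splitr.
by rewrite cos_mulr2n cos2sin2; ring.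
Qed.

Lemma cos_sub1_le x : `|cos x - 1| <= x ^+ 2 / 2.
Proof.
rewrite cos_double_half addrAC subrr add0r normrN normrM ger0_norm // normrX.
have := normr_sin_le (x / 2); have := normr_ge0 (sin (x / 2)).
rewrite (normrM x) (ger0_norm (_ : 0 <= 2^-1)) ?invr_ge0 // -(real_normK (num_real x)).
set a := `|sin _|; set b := `|x|; nra.
Qed.

Lemma cos_sub1_le_norm x : `|cos x - 1| <= `|x|.
Proof.
rewrite cos_double_half addrAC subrr add0r normrN normrM ger0_norm // normrX.
have := normr_sin_le (x / 2); have := normr_ge0 (sin (x / 2)).
have := sin_max (x / 2).
rewrite (normrM x) (ger0_norm (_ : 0 <= 2^-1)) ?invr_ge0 //.
set a := `|sin _|; set b := `|x|; nra.
Qed.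

Lemma sin_sub_le x : `|sin x - x| <= x ^+ 2.
Proof.
wlog x0 : x / 0 <= x => [h|].
  have [/h//|/ltW x0] := leP 0 x.
  have := h (- x); rewrite sinN -opprD normrN sqrrN; apply.
  by rewrite oppr_ge0.
have := @mean_value_le (fun t => sin t - t) (fun t => cos t - 1) 0 x x x0.
rewrite sin0 !subr0; apply => t /andP[t0 tx].
by rewrite (le_trans (cos_sub1_le_norm t)) // ger0_norm.
Qed.

Lemma expR_sub1_le x : x <= 0 -> `|expR x - 1| <= `|x|.
Proof.
move=> x0; rewrite !ler0_norm //; last by rewrite subr_le0 expR_le1.
have := expR_ge1Dx x; lra.
Qed.

Lemma expR_sub1_lin_le x : x <= 0 -> `|expR x - 1 - x| <= x ^+ 2.
Proof.
move=> x0; rewrite ger0_norm; last by have := expR_ge1Dx x; lra.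
have := expR_ge1Dx (- x); have := expRxMexpNx_1 x; have := expR_gt0 x.
set a := expR x; set b := expR (- x) => a0 ab b1.
(* This gives [a <= 1 + x + x^2], because [(1 + x + x^2) (1 - x) = 1 - x^3 >= 1] for [x <= 0]. *)
have : a * (1 - x) <= 1 by nra.
nra.
Qed.

End RealBounds.

(** * Norm and exponential estimates in the complex plane *)

Section ComplexBounds.
Variable R : realType.
Implicit Types z w : R[i].

Lemma normcE_Re z : `|z| = (normc z)%:C.
Proof. by case: z. Qed.

Lemma normc_ge0 z : 0 <= normc z.
Proof. by case: z => a b; apply: sqrtr_ge0. Qed.

Lemma normcB z w : normc (z - w) = normc (w - z).
Proof. by rewrite -normcN opprB. Qed.

Lemma le_normcB z w : normc (z - w) <= normc z + normc w.
Proof. by rewrite -(normcN w) le_normcD. Qed.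

Lemma lerB_normc z w : normc z - normc w <= normc (z - w).
Proof. by have := le_normcD (z - w) w; rewrite subrK; lra. Qed.

Lemma le_normc_dist u z w : normc (z - w) <= normc (z - u) + normc (u - w).
Proof. by have := le_normcD (z - u) (u - w); rewrite addrA subrK. Qed.

Lemma normc_real (r : R) : normc r%:C = `|r|.
Proof. by rewrite /normc /= expr0n addr0 sqrtr_sqr. Qed.

Lemma normc_real_ge0 (r : R) : 0 <= r -> normc r%:C = r.
Proof. by move=> r0; rewrite normc_real ger0_norm. Qed.

Lemma normcX z n : normc (z ^+ n) = normc z ^+ n.
Proof. by elim: n => [|n IH]; rewrite ?normc1 // !exprS normcM IH. Qed.

Lemma normc_Re z : `|complex.Re z| <= normc z.
Proof.
case: z => a b /=; rewrite -sqrtr_sqr ler_wsqrtr // lerDl sqr_ge0 //.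
Qed.

Lemma normc_Im z : `|complex.Im z| <= normc z.
Proof.
case: z => a b /=; rewrite -sqrtr_sqr ler_wsqrtr // lerDr sqr_ge0 //.
Qed.

Lemma normc_sqr z : normc z ^+ 2 = complex.Re z ^+ 2 + complex.Im z ^+ 2.
Proof. by case: z => a b /=; rewrite sqr_sqrtr // addr_ge0 ?sqr_ge0. Qed.

Lemma normc_le_ReIm z : normc z <= `|complex.Re z| + `|complex.Im z|.
Proof.
rewrite -ler_sqr ?nnegrE ?normc_ge0 ?addr_ge0 // normc_sqr.
rewrite -(real_normK (num_real (complex.Re z))) -(real_normK (num_real (complex.Im z))).
have := normr_ge0 (complex.Re z); have := normr_ge0 (complex.Im z).
set a := `|complex.Re z|; set b := `|_|; nra.
Qed.

Lemma normc_eq0 z : (normc z == 0) = (z == 0).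
Proof. by apply/eqP/eqP => [/eq0_normc|->]; rewrite ?normc0. Qed.

Lemma normc_gt0 z : (0 < normc z) = (z != 0).
Proof. by rewrite lt0r normc_ge0 normc_eq0 andbT. Qed.

Lemma normc_sum (I : Type) (r : seq I) (P : pred I) (F : I -> R[i]) :
  normc (\sum_(i <- r | P i) F i) <= \sum_(i <- r | P i) normc (F i).
Proof.
elim/big_rec2: _ => [|i y x _ h]; first by rewrite normc0.
by rewrite (le_trans (le_normcD _ _)) // lerD2l.
Qed.

Lemma normc_prod (I : Type) (r : seq I) (P : pred I) (F : I -> R[i]) :
  normc (\prod_(i <- r | P i) F i) = \prod_(i <- r | P i) normc (F i).
Proof. by elim/big_rec2: _ => [|i y x _ <-]; rewrite ?normc1 ?normcM. Qed.

Lemma normc_nat n : normc (n%:R : R[i]) = n%:R.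
Proof. by rewrite -(rmorph_nat (real_complex R)) normc_real_ge0. Qed.

Lemma normc_cexp z : normc (cexp z) = expR (complex.Re z).
Proof.
rewrite /cexp normcM normc_real_ge0 ?expR_ge0 //=.
by rewrite cos2Dsin2 sqrtr1 mulr1.
Qed.

Lemma cexp_neq0 z : cexp z != 0.
Proof. by rewrite -normc_gt0 normc_cexp expR_gt0. Qed.

Lemma cexp0 : cexp (0 : R[i]) = 1.
Proof. by rewrite /cexp /= expR0 cos0 sin0 mul1r. Qed.

Lemma cexpN z : cexp (- z) = (cexp z)^-1.
Proof.
by apply: (mulIf (cexp_neq0 z)); rewrite -cexpD addNr cexp0 mulVf ?cexp_neq0.
Qed.

Lemma cexpB z w : cexp (z - w) = cexp z / cexp w.
Proof. by rewrite cexpD cexpN. Qed.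

Lemma cexp_sum (I : Type) (r : seq I) (P : pred I) (F : I -> R[i]) :
  cexp (\sum_(i <- r | P i) F i) = \prod_(i <- r | P i) cexp (F i).
Proof. by elim/big_rec2: _ => [|i y x _ <-]; rewrite ?cexp0 ?cexpD. Qed.

Lemma cReB z w : complex.Re (z - w) = complex.Re z - complex.Re w.
Proof. by case: z; case: w. Qed.

Lemma cImB z w : complex.Im (z - w) = complex.Im z - complex.Im w.
Proof. by case: z; case: w. Qed.

Lemma cReM z w : complex.Re (z * w) =
  complex.Re z * complex.Re w - complex.Im z * complex.Im w.
Proof. by case: z; case: w. Qed.

Lemma cImM z w : complex.Im (z * w) =
  complex.Re z * complex.Im w + complex.Im z * complex.Re w.
Proof. by case: z; case: w. Qed.

Lemma Re_cexp z : complex.Re (cexp z) = expR (complex.Re z) * cos (complex.Im z).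
Proof. by rewrite /cexp cReM /= mul0r subr0. Qed.

Lemma Im_cexp z : complex.Im (cexp z) = expR (complex.Re z) * sin (complex.Im z).
Proof. by rewrite /cexp cImM /= mul0r addr0. Qed.

(** On [Re z <= 0] the factor [exp (Re z)] is at most 1, so the bound needs no smallness of [z]. The
    exponents [- s h] with [Re s >= 0] and [h >= 0] all lie there. *)
Lemma cexp_sub1_le z : complex.Re z <= 0 -> normc (cexp z - 1) <= 3 * normc z.
Proof.
move=> z0; apply: le_trans (normc_le_ReIm _) _.
rewrite !cReB !cImB Re_cexp Im_cexp subr0.
have := normc_Re z; have := normc_Im z.
set a := complex.Re z in z0 *; set b := complex.Im z => hb ha.
have e1 : expR a <= 1 by rewrite expR_le1.
have e0 := expR_ge0 a.
have -> : expR a * cos b - 1 = (expR a - 1) + expR a * (cos b - 1) by ring.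
have := ler_normD (expR a - 1) (expR a * (cos b - 1)).
rewrite !normrM (ger0_norm e0).
have := expR_sub1_le z0; have := cos_sub1_le_norm b; have := normr_sin_le b.
have := normr_ge0 (cos b - 1); have := normr_ge0 (sin b).
set X := `|_ + _|; set s := `|sin b|; set c := `|cos b - 1|.
move: (expR a) e1 e0 => t *; nra.
Qed.

Lemma cexp_sub1_lin_le z : complex.Re z <= 0 ->
  normc (cexp z - 1 - z) <= 2 * normc z ^+ 2.
Proof.
move=> z0; apply: le_trans (normc_le_ReIm _) _.
rewrite normc_sqr !cReB !cImB Re_cexp Im_cexp subr0.
set a := complex.Re z in z0 *; set b := complex.Im z.
have e1 : expR a <= 1 by rewrite expR_le1.
have e0 := expR_ge0 a.
have -> : expR a * cos b - 1 - a = (expR a - 1 - a) + expR a * (cos b - 1) by ring.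
have -> : expR a * sin b - b = (expR a - 1) * sin b + (sin b - b) by ring.
have := ler_normD (expR a - 1 - a) (expR a * (cos b - 1)).
have := ler_normD ((expR a - 1) * sin b) (sin b - b).
rewrite !normrM (ger0_norm e0).
have h1 := expR_sub1_le z0; have h2 := cos_sub1_le b; have h3 := normr_sin_le b.
have h4 := sin_sub_le b; have h5 := expR_sub1_lin_le z0.
have h6 : `|expR a - 1| * `|sin b| <= `|a| * `|b| by apply: ler_pM.
have h7 : expR a * `|cos b - 1| <= b ^+ 2 / 2.
  by apply: le_trans h2; apply: ler_piMl.
have h8 : `|a| * `|b| <= (a ^+ 2 + b ^+ 2) / 2.
  rewrite -(real_normK (num_real a)) -(real_normK (num_real b)).
  have := sqr_ge0 (`|a| - `|b|); nra.
have := sqr_ge0 a; have := sqr_ge0 b.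
lra.
Qed.

End ComplexBounds.

(** * The powers [n^(-s)] *)

Section NatPowers.
Variable R : realType.
Implicit Types (s : R[i]) (n : nat) (e : R).

Definition rpow n e : R := expR (- e * ln n%:R).

Definition cpow n s : R[i] := cexp (- s * (ln (n%:R : R))%:C).

(** The integral of [1 / x] over [[n, n+1]]; it lies between [1 / (n+1)] and [1 / n], and passing
    from [n^(-s)] to [(n+1)^(-s)] multiplies by [exp (- s lnstep n)]. *)
Definition lnstep n : R := ln n.+1%:R - ln n%:R.

Lemma ln_nat_ge0 n : 0 <= ln (n%:R : R).
Proof.
case: n => [|n]; first by rewrite ln0.
by rewrite ln_ge0 // ler1n.
Qed.

Lemma lnstep_le n : (0 < n)%N -> lnstep n <= n%:R^-1.
Proof.
move=> n0; have n0R : (0 : R) < n%:R by rewrite ltr0n.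
rewrite /lnstep -ln_div ?posrE ?ltr0n // -natr1 mulrDl divff ?gt_eqF // mul1r.
by apply: le_ln1Dx; rewrite (lt_trans _ (_ : 0 < n%:R^-1)) ?invr_gt0 // oppr_lt0.
Qed.

Lemma lnstep_ge n : (0 < n)%N -> n.+1%:R^-1 <= lnstep n.
Proof.
move=> n0; have n0R : (0 : R) < n%:R by rewrite ltr0n.
have n1R : (0 : R) < n.+1%:R by rewrite ltr0n.
have e : 1 - n.+1%:R^-1 = n%:R / n.+1%:R :> R.
  by move: (lt0r_neq0 n1R); rewrite -natr1 => h; field.
rewrite -lerN2 /lnstep opprB -ln_div ?posrE // -e.
apply: le_ln1Dx; rewrite ltrN2 invf_lt1 // ltr1n //.
Qed.

Lemma lnstep_ge0 n : (0 < n)%N -> 0 <= lnstep n.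
Proof. by move=> n0; apply: le_trans (lnstep_ge n0); rewrite invr_ge0. Qed.

Lemma inv_nat_sub n : (0 < n)%N ->
  n%:R^-1 - n.+1%:R^-1 = (n%:R * n.+1%:R)^-1 :> R.
Proof.
move=> n0; have n0R : (n%:R : R) != 0 by rewrite pnatr_eq0 -lt0n.
have n1R : (n.+1%:R : R) != 0 by rewrite pnatr_eq0.
by rewrite invfM; move: n0R n1R; rewrite -natr1 => n0R n1R; field; rewrite n0R n1R.
Qed.

Lemma inv_sub_lnstep n : (0 < n)%N -> `|n%:R^-1 - lnstep n| <= n%:R^-1 ^+ 2.
Proof.
move=> n0; have n0R : (0 : R) < n%:R by rewrite ltr0n.
rewrite ger0_norm ?subr_ge0 ?lnstep_le //.
apply: le_trans (_ : n%:R^-1 - n.+1%:R^-1 <= _).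
  by rewrite lerD2l lerN2 lnstep_ge.
rewrite inv_nat_sub // invfM expr2 ler_wpM2l ?invr_ge0 //.
by rewrite lef_pV2 ?posrE ?ltr0n // ler_nat.
Qed.

Lemma lnstep_sqr_le n : (0 < n)%N -> lnstep n ^+ 2 <= n%:R^-1 ^+ 2.
Proof.
by move=> n0; rewrite ler_sqr ?nnegrE ?lnstep_ge0 ?lnstep_le // invr_ge0.
Qed.

Lemma rpow_ge0 n e : 0 <= rpow n e. Proof. exact: expR_ge0. Qed.

Lemma rpow_le1 n e : 0 <= e -> rpow n e <= 1.
Proof.
by move=> e0; rewrite expR_le1 mulNr oppr_le0 mulr_ge0 // ln_nat_ge0.
Qed.

Lemma cpow1 s : cpow 1 s = 1.
Proof. by rewrite /cpow ln1 mulr0 cexp0. Qed.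

Lemma rpow1 e : rpow 1 e = 1.
Proof. by rewrite /rpow ln1 mulr0 expR0. Qed.

Lemma cpowM n m s : (0 < n)%N -> (0 < m)%N ->
  cpow (n * m) s = cpow n s * cpow m s.
Proof.
move=> n0 m0; rewrite /cpow -cexpD -mulrDr -rmorphD /= natrM lnM //.
  by rewrite posrE ltr0n.
by rewrite posrE ltr0n.
Qed.

Lemma rpowM n m e : (0 < n)%N -> (0 < m)%N ->
  rpow (n * m) e = rpow n e * rpow m e.
Proof.
move=> n0 m0; rewrite /rpow -expRD -mulrDr natrM lnM //.
  by rewrite posrE ltr0n.
by rewrite posrE ltr0n.
Qed.

Lemma normc_cpow n s : normc (cpow n s) = rpow n (complex.Re s).
Proof. by rewrite normc_cexp cReM /= mulr0 subr0; case: s. Qed.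

Lemma normc_cpow_le1 n s : 0 <= complex.Re s -> normc (cpow n s) <= 1.
Proof. by move=> s0; rewrite normc_cpow rpow_le1. Qed.

Lemma cpowS n s : cpow n.+1 s = cpow n s * cexp (- s * (lnstep n)%:C).
Proof. by rewrite /cpow -cexpD -mulrDr -rmorphD /= /lnstep addrC subrK. Qed.

Lemma ler_rpow m n e : 0 <= e -> (0 < m)%N -> (m <= n)%N -> rpow n e <= rpow m e.
Proof.
move=> e0 m0 mn; rewrite ler_expR !mulNr lerN2 ler_wpM2l //.
by rewrite ler_ln ?posrE ?ltr0n ?ler_nat // (leq_trans m0).
Qed.

Lemma cpow_lip n s t : 0 <= complex.Re s -> 0 <= complex.Re t ->
  normc (cpow n s - cpow n t) <= 3 * normc (s - t) * ln n%:R.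
Proof.
(* Factoring out the power of larger modulus leaves [exp (- (s - t) ln n)], whose exponent then has
   a nonpositive real part. *)
wlog st : s t / complex.Re t <= complex.Re s => [h|] s0 t0.
  have [/h ->//|/ltW ts] := leP (complex.Re t) (complex.Re s).
  by rewrite normcB (normcB s); apply: h.
have -> : cpow n s - cpow n t =
    cpow n t * (cexp (- (s - t) * (ln (n%:R : R))%:C) - 1).
  by rewrite mulrBr mulr1 /cpow -cexpD -mulrDl opprB addrA addNr add0r.
rewrite normcM; apply: le_trans (_ : 1 * (3 * (normc (s - t) * ln n%:R)) <= _);
  last by rewrite mul1r mulrA.
apply: ler_pM; rewrite ?normc_ge0 ?normc_cpow_le1 //.
have -> : normc (s - t) * ln n%:R = normc (- (s - t) * (ln (n%:R : R))%:C).
  by rewrite normcM normcN normc_real_ge0 // ln_nat_ge0.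
apply: cexp_sub1_le; rewrite cReM /= mulr0 subr0.
have -> : complex.Re (- (s - t)) = - (complex.Re s - complex.Re t).
  by case: (s) => ? ?; case: (t).
by rewrite mulNr oppr_le0 mulr_ge0 ?ln_nat_ge0 // subr_ge0.
Qed.

Lemma sum_inv_sqr m n : (0 < m)%N -> (m <= n)%N ->
  \sum_(m <= k < n) k%:R^-1 ^+ 2 <= 2 / m%:R - 2 / n%:R :> R.
Proof.
move=> m0; elim: n => [|n IH]; first by rewrite leqn0 => /eqP m0'; rewrite m0' in m0.
rewrite leq_eqVlt => /predU1P[->|]; first by rewrite big_geq // subrr.
rewrite ltnS => mn; rewrite big_nat_recr //=.
have n0 : (0 < n)%N by apply: leq_trans mn.
suff : n%:R^-1 ^+ 2 <= 2 / n%:R - 2 / n.+1%:R :> R.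
  by move=> h; rewrite (le_trans (lerD (IH mn) h)) // addrA subrK.
rewrite -mulrBr inv_nat_sub // invfM expr2 mulrCA ler_pM2l ?invr_gt0 ?ltr0n //.
rewrite -[leLHS]mul1r ler_pdivrMr ?ltr0n // mulrAC ler_pdivlMr ?ltr0n //.
by rewrite mul1r -natrM ler_nat; lia.
Qed.

Lemma sum_inv_sqr_le2 n : \sum_(1 <= k < n.+1) k%:R^-1 ^+ 2 <= 2 :> R.
Proof.
apply: le_trans (sum_inv_sqr (ltn0Sn 0) (ltn0Sn n)) _.
by rewrite divr1 lerBlDr lerDl divr_ge0.
Qed.

(** Dominates the variation in [s] of the terms of [s zeta (1 + s)]: [zstep] varies by [O (n^(-2))],
    and the variation of the factor [n^(-s)] costs [ln n]. *)
Definition log_majorant n : R := (1 + ln n%:R) * n%:R^-1 ^+ 2.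

Lemma sum_log_majorant n : \sum_(1 <= k < n.+1) log_majorant k <= 3.
Proof.
(* An antiderivative of [(1 + ln x) / x^2] is [- (2 + ln x) / x]; putting 3 for 2 gives the slack
   for comparing the sum with the integral, and makes both sides 0 at [n = 0]. *)
suff : \sum_(1 <= k < n.+1) log_majorant k <= 3 - (3 + ln n.+1%:R) / n.+1%:R.
  move/le_trans; apply; rewrite lerBlDr lerDl.
  by rewrite divr_ge0 // addr_ge0 // ln_nat_ge0.
elim: n => [|n IH]; first by rewrite big_geq // ln1 addr0 divr1 subrr.
rewrite big_nat_recr //=; move: IH.
set m := n.+1; have m0 : (0 < m)%N by []; clearbody m => IH.
suff : log_majorant m <= (3 + ln m%:R) / m%:R - (3 + ln m.+1%:R) / m.+1%:R.
  by move=> h; rewrite (le_trans (lerD IH h)) // addrA subrK.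
have m0R : (0 : R) < m%:R by rewrite ltr0n.
have -> : ln m.+1%:R = ln m%:R + lnstep m by rewrite /lnstep addrC subrK.
have h1 := lnstep_le m0; have h2 := ln_nat_ge0 m.
have h3 : 1 + ln m%:R <= m%:R :> R.
  rewrite -lerBrDl; apply: le_trans (_ : ln (1 + (m%:R - 1)) <= _).
    by rewrite addrC subrK.
  by apply: le_ln1Dx; rewrite ltrBrDl subrr.
rewrite /log_majorant -(natr1 m).
move: (m%:R : R) (lnstep m) (ln m%:R) m0R h1 h2 h3 => x h L x0 h1 L0 Lx.
have hx : h * x <= 1 by rewrite -ler_pdivlMr // mul1r.
have -> : (3 + L) / x - (3 + (L + h)) / (x + 1) = (3 + L - h * x) / (x * (x + 1)).
  by field; rewrite !gt_eqF //; lra.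
apply: le_trans (_ : (2 + L) / (x * (x + 1)) <= _); last first.
  by rewrite ler_wpM2r ?invr_ge0 ?mulr_ge0 //; lra.
rewrite ler_pdivlMr ?mulr_gt0 //; last lra.
have -> : (1 + L) * x^-1 ^+ 2 * (x * (x + 1)) = (1 + L) * (x + 1) / x.
  by field; rewrite gt_eqF.
rewrite ler_pdivrMr //; nra.
Qed.

Lemma log_majorant_ge n : n%:R^-1 ^+ 2 <= log_majorant n.
Proof.
by rewrite /log_majorant ler_peMl ?sqr_ge0 // lerDl ln_nat_ge0.
Qed.

Lemma log_majorant_ge_ln n : ln n%:R * n%:R^-1 ^+ 2 <= log_majorant n.
Proof. by rewrite /log_majorant ler_wpM2r ?sqr_ge0 // lerDr. Qed.

(** Comparison of [x^(-1-e)] with its integral in a form that telescopes; it is [1 + y <= exp y] at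
    [y = e lnstep n], together with [lnstep n >= 1 / (n+1)]. *)
Lemma rpow_div_le n e : 0 < e -> (0 < n)%N ->
  rpow n.+1 e / n.+1%:R <= (rpow n e - rpow n.+1 e) / e.
Proof.
move=> e0 n0; rewrite ler_pdivlMr //.
have -> : rpow n e = rpow n.+1 e * expR (e * lnstep n).
  by rewrite /rpow -expRD /lnstep; congr expR; ring.
rewrite -{3}(mulr1 (rpow _ _)) -mulrBr -mulrA ler_wpM2l ?rpow_ge0 //.
have h := expR_ge1Dx (e * lnstep n); rewrite lerBrDl; apply: le_trans h.
by rewrite lerD2l mulrC ler_pM2l // lnstep_ge.
Qed.

Lemma sum_rpow_div_tail m n e : 0 < e -> (0 < m)%N -> (m <= n)%N ->
  \sum_(m.+1 <= k < n.+1) rpow k e / k%:R <= rpow m e / e.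
Proof.
move=> e0 m0 mn.
suff : \sum_(m.+1 <= k < n.+1) rpow k e / k%:R <= (rpow m e - rpow n e) / e.
  by move/le_trans; apply; rewrite ler_pM2r ?invr_gt0 // gerBl rpow_ge0.
elim: n mn => [|n IH]; first by rewrite leqn0 => /eqP m0'; rewrite m0' in m0.
rewrite leq_eqVlt => /predU1P[->|]; first by rewrite big_geq // subrr mul0r.
rewrite ltnS => mn; rewrite big_nat_recr //=.
have n0 : (0 < n)%N by apply: leq_trans mn.
apply: le_trans (lerD (IH mn) (rpow_div_le e0 n0)) _.
by rewrite -mulrDl addrA subrK.
Qed.

Lemma sum_rpow_div n e : 0 < e ->
  \sum_(1 <= k < n.+1) rpow k e / k%:R <= 1 + e^-1.
Proof.
move=> e0; case: n => [|n].
  by rewrite big_geq // addr_ge0 // invr_ge0 ltW.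
rewrite big_ltn // rpow1 divr1 lerD2l.
by apply: le_trans (sum_rpow_div_tail e0 (ltn0Sn 0) (ltn0Sn n)) _; rewrite rpow1 mul1r.
Qed.

Lemma rpow_small e d : 0 < e -> 0 < d ->
  exists2 N0, (0 < N0)%N & forall N, (N0 <= N)%N -> rpow N e <= d.
Proof.
move=> e0 d0; pose B := expR (- ln d / e).
exists (Num.bound B).+1 => // N hN; have N0 : (0 < N)%N by apply: leq_trans hN.
rewrite /rpow -(@lnK _ d) // ler_expR mulNr lerNl mulrC -ler_pdivrMr //.
rewrite -(expRK (- ln d / e)) ler_ln ?posrE ?expR_gt0 ?ltr0n //.
apply/ltW/(lt_le_trans (archi_boundP (expR_ge0 _))).
by rewrite ler_nat ltnW.
Qed.

Lemma le_add_inv_nat (a b c : R) :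
  (forall N, a <= b + c / N.+1%:R) -> a <= b.
Proof.
move=> h; rewrite leNgt; apply/negP => ba.
have c0 : 0 <= `|c| / (a - b) by rewrite divr_ge0 // subr_ge0 ltW.
have hN := archi_boundP c0; set N := Num.bound _ in hN.
have := h N; apply/negP; rewrite -ltNge -ltrBrDl.
rewrite ltr_pdivrMr ?ltr0n //; apply: le_lt_trans (ler_norm c) _.
rewrite mulrC -ltr_pdivrMr ?subr_gt0 //; apply: lt_trans hN _.
by rewrite ltr_nat.
Qed.

(** Every lower end [v n - C / (n+1)] lies below every upper end [v m + C / (m+1)], so the supremum
    of the lower ends lies in all these intervals and the rate is kept. *)
Lemma real_cauchy_inv_nat (v : nat -> R) C :
  (forall n m, (n <= m)%N -> `|v m - v n| <= C / n.+1%:R) ->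
  exists l, forall n, `|v n - l| <= C / n.+1%:R.
Proof.
move=> h.
have lem n m : v n - C / n.+1%:R <= v m + C / m.+1%:R.
  have C0 k : 0 <= C / k.+1%:R by have := h k k (leqnn k); rewrite subrr normr0.
  have := C0 n; have := C0 m; case: (leqP n m) => [/h|/ltnW/h];
  rewrite ler_norml; move: (C / _) (C / _) => a b; lra.
pose A := [set v n - C / n.+1%:R | n in setT].
have supA : has_sup A.
  split; first by exists (v 0%N - C / 1%:R); exists 0%N.
  by exists (v 0%N + C / 1%:R) => _ [n _ <-].
exists (sup A) => n; rewrite ler_norml; apply/andP; split.
  by rewrite lerBrDl -lerBrDr opprK; apply: ge_sup (supA.1) _ => _ [m _ <-].
rewrite lerBlDr -lerBlDl; apply: ub_le_sup; [exact: supA.2 | by exists n].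
Qed.

Lemma complex_cauchy_inv_nat (v : nat -> R[i]) C :
  (forall n m, (n <= m)%N -> normc (v m - v n) <= C / n.+1%:R) ->
  exists l, forall n, normc (v n - l) <= (2 * C) / n.+1%:R.
Proof.
move=> h.
have [a ha] : exists l, forall n, `|complex.Re (v n) - l| <= C / n.+1%:R.
  apply: real_cauchy_inv_nat => n m nm; rewrite -cReB.
  exact: le_trans (normc_Re _) (h _ _ nm).
have [b hb] : exists l, forall n, `|complex.Im (v n) - l| <= C / n.+1%:R.
  apply: real_cauchy_inv_nat => n m nm; rewrite -cImB.
  exact: le_trans (normc_Im _) (h _ _ nm).
exists (a +i* b) => n; apply: le_trans (normc_le_ReIm _) _.
rewrite cReB cImB /= (_ : 2 * C = C + C); last by ring.
by rewrite mulrDl lerD.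
Qed.

End NatPowers.

(** * The function [s zeta (1 + s)] on [Re s >= 0] *)

Section RegularizedZeta.
Variable R : realType.
Implicit Types (s t : R[i]) (n N : nat).

(* [s n^(-1-s) - (n^(-s) - (n+1)^(-s))], which is [s] times the difference
   between [n^(-1-s)] and the integral of [x^(-1-s)] over [[n, n+1]]. *)
Definition zterm n s : R[i] := s * (cpow n s / n%:R) - cpow n s + cpow n.+1 s.

(** [zterm n s] without its factor [n^(-s)]. With [h = lnstep n] it equals [s (1/n - h)] plus the
    remainder [exp (- s h) - 1 + s h], both [O (n^(-2))]. *)
Definition zstep n s : R[i] := s / n%:R - 1 + cexp (- s * (lnstep R n)%:C).

Lemma ztermE n s : zterm n s = cpow n s * zstep n s.
Proof. by rewrite /zterm /zstep cpowS; ring. Qed.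

Lemma natC n : (n%:R : R[i]) = (n%:R : R)%:C.
Proof. by rewrite rmorph_nat. Qed.

Lemma invC (x : R) : (x%:C)^-1 = (x^-1)%:C.
Proof. by rewrite fmorphV. Qed.

Lemma Re_step s (h : R) : complex.Re (- s * h%:C) = - (complex.Re s * h).
Proof. by case: s => a b; rewrite cReM /= mulr0 subr0 mulNr. Qed.

Lemma cexp_step_sub1 s (h : R) : 0 <= complex.Re s -> 0 <= h ->
  normc (cexp (- s * h%:C) - 1) <= 3 * normc s * h.
Proof.
move=> s0 h0.
have -> : 3 * normc s * h = 3 * normc (- s * h%:C).
  by rewrite normcM normcN normc_real_ge0 //; ring.
by apply: cexp_sub1_le; rewrite Re_step oppr_le0 mulr_ge0.
Qed.

Lemma cexp_step_lin s (h : R) : 0 <= complex.Re s -> 0 <= h ->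
  normc (cexp (- s * h%:C) - 1 + s * h%:C) <= 2 * normc s ^+ 2 * h ^+ 2.
Proof.
move=> s0 h0.
have -> : 2 * normc s ^+ 2 * h ^+ 2 = 2 * normc (- s * h%:C) ^+ 2.
  by rewrite normcM normcN normc_real_ge0 //; ring.
have -> : cexp (- s * h%:C) - 1 + s * h%:C = cexp (- s * h%:C) - 1 - (- s * h%:C).
  by rewrite mulNr opprK.
by apply: cexp_sub1_lin_le; rewrite Re_step oppr_le0 mulr_ge0.
Qed.

Lemma normc_cexp_step_le1 s (h : R) : 0 <= complex.Re s -> 0 <= h ->
  normc (cexp (- s * h%:C)) <= 1.
Proof. by move=> s0 h0; rewrite normc_cexp Re_step expR_le1 oppr_le0 mulr_ge0. Qed.

Section Bounded.
Variable B : R.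
Hypothesis B0 : 0 <= B.

Lemma zstep_lip n s t : (0 < n)%N -> 0 <= complex.Re s -> 0 <= complex.Re t ->
  normc s <= B -> normc t <= B ->
  normc (zstep n s - zstep n t) <= (1 + 7 * B) * normc (s - t) * n%:R^-1 ^+ 2.
Proof.
move=> n0.
wlog st : s t / complex.Re t <= complex.Re s => [h|] s0 t0 sB tB.
  have [/h ->//|/ltW ts] := leP (complex.Re t) (complex.Re s).
  by rewrite normcB (normcB s); apply: h.
have [h hE] : exists h, h = lnstep R n by exists (lnstep R n).
set d := s - t; have h0 : 0 <= h by rewrite hE lnstep_ge0.
have d0 : 0 <= complex.Re d by rewrite cReB subr_ge0.
have dB : normc d <= 2 * B by apply: le_trans (le_normcB _ _) _; lra.
(* Each summand carries [|d|] and a factor of order [n^(-2)]. They contribute [1], [3 B] and [4 B]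
   to the constant [1 + 7 B], the last through [|d| <= 2 B]. *)
have -> : zstep n s - zstep n t = d * (n%:R^-1 - h)%:C
     - d * h%:C * (cexp (- t * h%:C) - 1)
     + cexp (- t * h%:C) * (cexp (- d * h%:C) - 1 + d * h%:C).
  rewrite /zstep -hE natC invC.
  have -> : cexp (- s * h%:C) = cexp (- t * h%:C) * cexp (- d * h%:C).
    by rewrite -cexpD /d; congr cexp; ring.
  by rewrite rmorphB /= /d; ring.
apply: le_trans (le_normcD _ _) _; apply: le_trans (lerD (le_normcB _ _) (lexx _)) _.
rewrite (normcM d) (normcM (d * _)) (normcM d) (normcM (cexp _)).
rewrite !normc_real (ger0_norm h0).
have h1 := inv_sub_lnstep R n0; have h2 := lnstep_sqr_le R n0.
have h3 := cexp_step_sub1 t0 h0; have h4 := cexp_step_lin d0 h0.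
have h5 := normc_cexp_step_le1 t0 h0.
rewrite -hE in h1 h2.
have nd := normc_ge0 d; have nt := normc_ge0 t.
have a1 : normc d * `|n%:R^-1 - h| <= normc d * n%:R^-1 ^+ 2.
  by rewrite ler_wpM2l.
have a2 : normc d * h * normc (cexp (- t * h%:C) - 1) <= 3 * B * normc d * n%:R^-1 ^+ 2.
  apply: le_trans (_ : normc d * h * (3 * normc t * h) <= _).
    by rewrite ler_wpM2l // mulr_ge0.
  have -> : normc d * h * (3 * normc t * h) = (3 * normc t * normc d) * h ^+ 2 by ring.
  apply: ler_pM => //; [by rewrite !mulr_ge0|exact: sqr_ge0|].
  by rewrite ler_wpM2r // ler_wpM2l.
have a3 : normc (cexp (- t * h%:C)) * normc (cexp (- d * h%:C) - 1 + d * h%:C)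
   <= 4 * B * normc d * n%:R^-1 ^+ 2.
  apply: le_trans (_ : 1 * (2 * normc d ^+ 2 * h ^+ 2) <= _).
    by apply: ler_pM; rewrite ?normc_ge0.
  rewrite mul1r; apply: ler_pM => //; [by rewrite !mulr_ge0 ?sqr_ge0|exact: sqr_ge0|].
  nra.
move: (n%:R^-1 ^+ 2) a1 a2 a3 => N2 a1 a2 a3.
apply: le_trans (lerD (lerD a1 a2) a3) _.
lra.
Qed.

Lemma zstep0 n : zstep n 0 = 0.
Proof. by rewrite /zstep mul0r oppr0 mul0r cexp0 sub0r addNr. Qed.

Lemma zstep_le n s : (0 < n)%N -> 0 <= complex.Re s -> normc s <= B ->
  normc (zstep n s) <= (1 + 7 * B) * normc s * n%:R^-1 ^+ 2.
Proof.
move=> n0 s0 sB; have := @zstep_lip n s 0 n0 s0 (lexx 0) sB.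
by rewrite zstep0 !subr0 normc0; apply.
Qed.

Lemma zterm_le n s : (0 < n)%N -> 0 <= complex.Re s -> normc s <= B ->
  normc (zterm n s) <= (1 + 7 * B) * normc s * n%:R^-1 ^+ 2.
Proof.
move=> n0 s0 sB; rewrite ztermE (normcM (cpow n s)).
apply: le_trans (zstep_le n0 s0 sB); apply: ler_piMl; first exact: normc_ge0.
exact: normc_cpow_le1.
Qed.

Lemma zterm_lip n s t : (0 < n)%N -> 0 <= complex.Re s -> 0 <= complex.Re t ->
  normc s <= B -> normc t <= B ->
  normc (zterm n s - zterm n t) <=
  ((1 + 7 * B) * (1 + 3 * B)) * normc (s - t) * log_majorant R n.
Proof.
move=> n0 s0 t0 sB tB; rewrite !ztermE.
have -> : cpow n s * zstep n s - cpow n t * zstep n t =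
  cpow n s * (zstep n s - zstep n t) + (cpow n s - cpow n t) * zstep n t by ring.
apply: le_trans (le_normcD _ _) _.
rewrite (normcM (cpow n s)) (normcM (_ - _)).
have B7 : 0 <= 1 + 7 * B by rewrite addr_ge0 // mulr_ge0.
have h1 := zstep_lip n0 s0 t0 sB tB; have h2 := cpow_lip n s0 t0.
have h3 := zstep_le n0 t0 tB; have h4 := normc_cpow_le1 n s0.
have h5 := log_majorant_ge R n; have h6 := log_majorant_ge_ln R n.
pose d : R := normc (s - t); rewrite -/d in h1 h2 *.
have d0 : 0 <= d by apply: normc_ge0.
have a1 : normc (cpow n s) * normc (zstep n s - zstep n t) <=
    (1 + 7 * B) * d * log_majorant R n.
  apply: le_trans (_ : 1 * ((1 + 7 * B) * d * n%:R^-1 ^+ 2) <= _).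
    by apply: ler_pM; rewrite ?normc_ge0.
  by rewrite mul1r ler_wpM2l // mulr_ge0.
have a2 : normc (cpow n s - cpow n t) * normc (zstep n t) <=
    ((1 + 7 * B) * (3 * B)) * d * log_majorant R n.
  apply: le_trans (_ : (3 * d * ln n%:R) * ((1 + 7 * B) * normc t * n%:R^-1 ^+ 2) <= _).
    by apply: ler_pM; rewrite ?normc_ge0.
  have -> : (3 * d * ln n%:R) * ((1 + 7 * B) * normc t * n%:R^-1 ^+ 2) =
    ((1 + 7 * B) * (3 * normc t) * d) * (ln n%:R * n%:R^-1 ^+ 2) by ring.
  apply: ler_pM => //.
  - by rewrite !mulr_ge0 ?normc_ge0.
  - by rewrite mulr_ge0 ?sqr_ge0 ?ln_nat_ge0.
  - by rewrite ler_wpM2r // ler_wpM2l // ler_wpM2l.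
lra.
Qed.

(* [zterm n s / s] is Lipschitz even near [s = 0], because with
   [E s = 1 - exp (- s h)] and [d = t - s] one has
   [t E s - s E t = d (E s - s h exp (- s h)) - s exp (- s h) (1 - exp (- d h) - d h)],
   which is [O (|d| |s| |t| h^2)]. *)
Lemma zquot_lip n s t : (0 < n)%N -> 0 < complex.Re s ->
  complex.Re s = complex.Re t -> normc s <= B -> normc t <= B ->
  normc (zterm n s / s - zterm n t / t) <=
  (10 + 21 * B) * normc (s - t) * log_majorant R n.
Proof.
move=> n0 s0 st sB tB.
have [h hE] : exists h, h = lnstep R n by exists (lnstep R n).
have nz (u : R[i]) : 0 < complex.Re u -> u != 0.
  by apply: contraTneq => ->; rewrite ltxx.
have t0 : 0 < complex.Re t by rewrite -st.
have sn := nz _ s0; have tn := nz _ t0.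
pose E (u : R[i]) : R[i] := 1 - cexp (- u * h%:C).
have h0 : 0 <= h by rewrite hE lnstep_ge0.
(* The order [|u| <= |v|] gives [|u|^2 <= |u| |v|] and [|d| <= 2 |v|], so that the numerator
   contains the factor [|u| |v|] of the denominator. Equal real parts give [Re d = 0], as the
   exponential bounds for [exp (- d h)] require a nonnegative [Re d]. *)
have key (u v : R[i]) : 0 < complex.Re u -> complex.Re u = complex.Re v ->
    normc u <= normc v ->
    normc (E u / u - E v / v) <= 9 * normc (u - v) * n%:R^-1 ^+ 2.
  move=> u0 uv luv; have un := nz _ u0; have v0 : 0 < complex.Re v by rewrite -uv.
  have vn := nz _ v0.
  set d := v - u.
  have d0 : 0 <= complex.Re d by rewrite cReB uv subrr.
  have -> : E u / u - E v / v = (d * (- (cexp (- u * h%:C) - 1 + u * h%:C)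
     - u * h%:C * (cexp (- u * h%:C) - 1))
     + u * cexp (- u * h%:C) * (cexp (- d * h%:C) - 1 + d * h%:C)) / (u * v).
    rewrite /E (_ : cexp (- v * h%:C) = cexp (- u * h%:C) * cexp (- d * h%:C)).
      by rewrite /d; field; rewrite un vn.
    by rewrite -cexpD /d; congr cexp; ring.
  have dE : normc (u - v) = normc d by rewrite normcB.
  rewrite dE (normcM _ (_^-1)) normcV (normcM u v) ler_pdivrMr ?mulr_gt0 ?normc_gt0 //.
  apply: le_trans (le_normcD _ _) _.
  rewrite (normcM d) (normcM (u * _)) (normcM u).
  have h2 := lnstep_sqr_le R n0; rewrite -hE in h2.
  have h3 := cexp_step_sub1 (ltW u0) h0; have h4 := cexp_step_lin d0 h0.
  have h4u := cexp_step_lin (ltW u0) h0.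
  have h5 := normc_cexp_step_le1 (ltW u0) h0.
  have nd := normc_ge0 d; have nu := normc_ge0 u.
  have dv : normc d <= 2 * normc v by apply: le_trans (le_normcB _ _) _; lra.
  set N2 := n%:R^-1 ^+ 2 in h2 *.
  have b1 : normc (- (cexp (- u * h%:C) - 1 + u * h%:C) -
      u * h%:C * (cexp (- u * h%:C) - 1)) <= 5 * normc u ^+ 2 * N2.
    apply: le_trans (le_normcB _ _) _.
    rewrite normcN (normcM (u * _)) (normcM u) normc_real_ge0 //.
    have : normc u * h * normc (cexp (- u * h%:C) - 1) <= normc u * h * (3 * normc u * h).
      by rewrite ler_wpM2l // mulr_ge0.
    have : normc u ^+ 2 * h ^+ 2 <= normc u ^+ 2 * N2 by rewrite ler_wpM2l ?sqr_ge0.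
    move: (normc (_ - 1 + _)) h4u => y; lra.
  have b2 : normc (cexp (- u * h%:C)) * normc (cexp (- d * h%:C) - 1 + d * h%:C)
      <= 2 * normc d ^+ 2 * N2.
    apply: le_trans (_ : 1 * (2 * normc d ^+ 2 * h ^+ 2) <= _).
      by apply: ler_pM; rewrite ?normc_ge0.
    by rewrite mul1r ler_wpM2l // mulr_ge0 ?sqr_ge0.
  have N20 : 0 <= N2 by apply: sqr_ge0.
  have b3 : normc d * normc (- (cexp (- u * h%:C) - 1 + u * h%:C) -
      u * h%:C * (cexp (- u * h%:C) - 1)) <= normc d * (5 * normc u ^+ 2 * N2).
    by rewrite ler_wpM2l.
  have b4 : normc u * (normc (cexp (- u * h%:C)) *
     normc (cexp (- d * h%:C) - 1 + d * h%:C)) <= normc u * (2 * normc d ^+ 2 * N2).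
    by rewrite ler_wpM2l.
  have b5 : normc d * (5 * normc u ^+ 2 * N2) <= 5 * normc d * N2 * (normc u * normc v).
    have : normc d * N2 * (normc u * normc u) <= normc d * N2 * (normc u * normc v).
      by rewrite ler_wpM2l ?mulr_ge0 // ler_wpM2l.
    lra.
  have b6 : normc u * (2 * normc d ^+ 2 * N2) <= 4 * normc d * N2 * (normc u * normc v).
    have : normc d * N2 * (normc u * normc d) <= normc d * N2 * (normc u * (2 * normc v)).
      by rewrite ler_wpM2l ?mulr_ge0 // ler_wpM2l.
    lra.
  rewrite -(mulrA (normc u)).
  apply: le_trans (lerD b3 b4) _; apply: le_trans (lerD b5 b6) _; lra.
have {}key : normc (E s / s - E t / t) <= 9 * normc (s - t) * n%:R^-1 ^+ 2.
  have [st'|/ltW ts] := leP (normc s) (normc t); first exact: key.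
  by rewrite (normcB (E s / s)) (normcB s); apply: key.
have quotE (u : R[i]) : u != 0 -> zterm n u / u = cpow n u * (n%:R^-1 - E u / u).
  by move=> un; rewrite ztermE /zstep /E -hE; field; rewrite un pnatr_eq0 -lt0n n0.
have bt : normc (n%:R^-1 - E t / t) <= (1 + 7 * B) * n%:R^-1 ^+ 2.
  have -> : n%:R^-1 - E t / t = zstep n t / t.
    by rewrite /zstep /E -hE; field; rewrite tn pnatr_eq0 -lt0n n0.
  rewrite (normcM (zstep n t)) normcV ler_pdivrMr ?normc_gt0 //.
  by rewrite mulrAC; apply: zstep_le => //; apply: ltW.
rewrite !quotE //.
have -> : cpow n s * (n%:R^-1 - E s / s) - cpow n t * (n%:R^-1 - E t / t) =
  (cpow n s - cpow n t) * (n%:R^-1 - E t / t) - cpow n s * (E s / s - E t / t) by ring.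
apply: le_trans (le_normcB _ _) _.
rewrite (normcM (_ - _)) (normcM (cpow n s)).
have h2 := cpow_lip n (ltW s0) (ltW t0); have h4 := normc_cpow_le1 n (ltW s0).
have h5 := log_majorant_ge R n; have h6 := log_majorant_ge_ln R n.
pose d : R := normc (s - t); rewrite -/d in key h2 *.
have d0 : 0 <= d by apply: normc_ge0.
have a1 : normc (cpow n s - cpow n t) * normc (n%:R^-1 - E t / t) <=
    (3 + 21 * B) * d * (ln n%:R * n%:R^-1 ^+ 2).
  apply: le_trans (_ : (3 * d * ln n%:R) * ((1 + 7 * B) * n%:R^-1 ^+ 2) <= _).
    by apply: ler_pM; rewrite ?normc_ge0.
  rewrite le_eqVlt; apply/orP; left; apply/eqP; ring.
have a2 : normc (cpow n s) * normc (E s / s - E t / t) <= 9 * d * n%:R^-1 ^+ 2.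
  apply: le_trans (_ : 1 * (9 * d * n%:R^-1 ^+ 2) <= _); last by rewrite mul1r.
  by apply: ler_pM; rewrite ?normc_ge0.
have a3 : 9 * d * n%:R^-1 ^+ 2 + 3 * d * (ln n%:R * n%:R^-1 ^+ 2) <=
     9 * d * log_majorant R n.
  rewrite /log_majorant.
  have : 0 <= d * (ln n%:R * n%:R^-1 ^+ 2).
    by rewrite !mulr_ge0 ?ln_nat_ge0 ?sqr_ge0.
  lra.
have a4 : 21 * B * d * (ln n%:R * n%:R^-1 ^+ 2) <= 21 * B * d * log_majorant R n.
  by rewrite ler_wpM2l // !mulr_ge0.
have a5 : 0 <= d * log_majorant R n.
  by rewrite mulr_ge0 // (le_trans _ h5) ?sqr_ge0.
lra.
Qed.

End Bounded.

Definition zpart N s : R[i] := 1 + \sum_(1 <= n < N.+1) zterm n s.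

(** The 4 is the bound [2 / (N+1)] for the tail of the sum of [1 / i^2], doubled by
    [complex_cauchy_inv_nat]. The factor [|s|] makes the radius 0 at [s = 0], which is how [rzeta 0]
    is computed. *)
Definition zradius s : R := 4 * ((1 + 7 * normc s) * normc s).

(* [s * zeta (1 + s)], continued to the line [Re s = 0]. *)
Definition rzeta s : R[i] :=
  xget 0 [set l | forall N, normc (zpart N s - l) <= zradius s / N.+1%:R].

Lemma zpart_rzeta N s : 0 <= complex.Re s ->
  normc (zpart N s - rzeta s) <= zradius s / N.+1%:R.
Proof.
move=> s0; move: N.
suff [l hl] : exists l, forall N, normc (zpart N s - l) <= zradius s / N.+1%:R.
  by rewrite /rzeta; case: xgetP => [y _ //|/(_ l)/(_ hl)].
have [|l hl] := @complex_cauchy_inv_nat R (zpart^~ s) (2 * ((1 + 7 * normc s) * normc s)).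
  move=> n m nm; rewrite /zpart (@big_cat_nat _ _ _ n.+1 1 m.+1) //=.
  set a := \sum_(1 <= i < n.+1) _; set b := \sum_(_ <= i < _) _.
  have -> : 1 + (a + b) - (1 + a) = b by ring.
  apply: le_trans (normc_sum _ _ _) _.
  apply: le_trans (_ : \sum_(n.+1 <= i < m.+1) (1 + 7 * normc s) * normc s * i%:R^-1 ^+ 2 <= _).
    apply: ler_sum_nat => i /andP[ni _].
    by apply: zterm_le => //; [exact: normc_ge0|exact: leq_trans ni].
  rewrite -mulr_sumr (mulrC 2) -(mulrA _ 2); apply: ler_wpM2l.
    by rewrite mulr_ge0 ?normc_ge0 // addr_ge0 // mulr_ge0 ?normc_ge0.
  apply: le_trans (sum_inv_sqr _ _ _) _ => //.
  by rewrite lerBlDr lerDl divr_ge0.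
exists l => N; move: (hl N); rewrite (_ : 2 * (2 * _) = zradius s) //.
by rewrite /zradius; ring.
Qed.

(** The bound holds for every [zpart N] with the same constant, since [log_majorant] sums to at most
    3; [le_add_inv_nat] then lets [N] grow. *)
Lemma rzeta_lip B s t : 0 <= B -> 0 <= complex.Re s -> 0 <= complex.Re t ->
  normc s <= B -> normc t <= B ->
  normc (rzeta s - rzeta t) <= (3 * ((1 + 7 * B) * (1 + 3 * B))) * normc (s - t).
Proof.
move=> B0 s0 t0 sB tB; set K := (1 + 7 * B) * (1 + 3 * B).
apply: (@le_add_inv_nat R _ _ (zradius s + zradius t)) => N.
have hs := zpart_rzeta N s0; have ht := zpart_rzeta N t0.
have hz : normc (zpart N s - zpart N t) <= 3 * K * normc (s - t).
  rewrite /zpart (_ : forall a b : R[i], 1 + a - (1 + b) = a - b); last by move=> *; ring.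
  rewrite -sumrB; apply: le_trans (normc_sum _ _ _) _.
  apply: le_trans (_ : \sum_(1 <= n < N.+1) K * normc (s - t) * log_majorant R n <= _).
    by apply: ler_sum_nat => n /andP[n0 _]; apply: zterm_lip.
  rewrite -mulr_sumr mulrC -mulrA ler_wpM2r ?sum_log_majorant //.
  by rewrite mulr_ge0 ?normc_ge0 // mulr_ge0 // addr_ge0 // mulr_ge0.
apply: le_trans (le_normc_dist (zpart N s) _ _) _.
apply: le_trans (lerD (lexx _) (le_normc_dist (zpart N t) _ _)) _.
rewrite (normcB (rzeta s)); apply: le_trans (lerD hs (lerD hz ht)) _.
by rewrite addrCA -mulrDl.
Qed.

Lemma rzeta0 : rzeta 0 = 1.
Proof.
have h := zpart_rzeta 0 (lexx (0 : R) : 0 <= complex.Re (0 : R[i])).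
move: h; rewrite /zradius normc0 !(mulr0, mul0r) /zpart big_geq // addr0.
move=> h; apply/eqP; rewrite eq_sym -subr_eq0 -normc_eq0 eq_le h normc_ge0 //.
Qed.

Definition zetasum N s : R[i] := \sum_(1 <= n < N.+1) cpow n s / n%:R.

(** The differences [n^(-s) - (n+1)^(-s)] inside [zterm] telescope to [1 - (N+1)^(-s)]. *)
Lemma zetasumE N s : s * zetasum N s = zpart N s - cpow N.+1 s.
Proof.
rewrite /zpart; elim: N => [|N IH].
  by rewrite /zetasum !big_geq // mulr0 addr0 cpow1 subrr.
rewrite /zetasum big_nat_recr //= mulrDr -/(zetasum N s) IH [in RHS]big_nat_recr //=.
by rewrite {3}/zterm; ring.
Qed.

Lemma zetasum_rzeta N s : 0 <= complex.Re s ->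
  normc (s * zetasum N s - rzeta s) <=
  zradius s / N.+1%:R + rpow N.+1 (complex.Re s).
Proof.
move=> s0; rewrite zetasumE addrAC; apply: le_trans (le_normcB _ _) _.
by rewrite normc_cpow lerD2r zpart_rzeta.
Qed.

End RegularizedZeta.

(** * Non-vanishing on the line [Re s = 0] *)

Section EulerProduct.
Variable R : realType.
Implicit Types (n m N M p : nat).

Definition rough N n := all (ltn N) (primes n).

Lemma rough_lt_prime N n : (1 < n)%N -> rough N n -> (N < n)%N.
Proof.
move=> n1 /allP h; apply: leq_trans (h (pdiv n) _) _.
  by rewrite mem_primes pdiv_prime // pdiv_dvd (ltnW n1).
exact/pdiv_leq/ltnW.
Qed.

Lemma roughS_nonprime N n : ~~ prime N.+1 -> rough N.+1 n = rough N n.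
Proof.
move=> Np; apply: eq_in_all => q; rewrite mem_primes => /andP[q_pr _].
rewrite /= [RHS]leq_eqVlt; case: eqP => // qN.
by rewrite qN q_pr in Np.
Qed.

Lemma roughS_prime N n : (0 < n)%N -> prime N.+1 ->
  rough N.+1 n = rough N n && ~~ (N.+1 %| n)%N.
Proof.
move=> n0 p_pr; apply/allP/andP => [h|[/allP h pn] q qn].
  split; first by apply/allP => q /h; apply: ltnW.
  by apply/negP => pn; have := h N.+1; rewrite mem_primes p_pr n0 pn /= ltnn => /(_ isT).
rewrite /= ltn_neqAle [(_ <= _)%N]h // andbT; apply/eqP => qE.
by move: qn pn; rewrite mem_primes -qE => /and3P[_ _ ->].
Qed.

Lemma rough_mul_prime N m : (0 < m)%N -> prime N.+1 ->
  rough N (N.+1 * m) = rough N m.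
Proof.
move=> m0 p_pr; apply/allP/allP => h q qm.
  by apply: h; rewrite primesM // qm orbT.
move: qm; rewrite primesM // primes_prime // inE => /orP[/eqP->|/h//].
exact: ltnSn.
Qed.

Variable s : R[i].
Hypothesis s_gt0 : 0 < complex.Re s.

Definition dterm n : R[i] := cpow n s / n%:R.

Lemma dterm1 : dterm 1 = 1.
Proof. by rewrite /dterm cpow1 divr1. Qed.

Lemma dtermM n m : (0 < n)%N -> (0 < m)%N -> dterm (n * m) = dterm n * dterm m.
Proof. by move=> n0 m0; rewrite /dterm cpowM // natrM invfM mulrACA. Qed.

Lemma normc_dterm n : normc (dterm n) = rpow n (complex.Re s) / n%:R.
Proof. by rewrite (normcM (cpow n s)) normcV normc_cpow normc_nat. Qed.

Lemma normc_dterm_le n : normc (dterm n) <= n%:R^-1.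
Proof.
by rewrite normc_dterm -[leRHS]mul1r ler_wpM2r ?invr_ge0 // rpow_le1 // ltW.
Qed.

Lemma normc_dterm_le1 n : normc (dterm n) <= 1.
Proof.
apply: le_trans (normc_dterm_le n) _; case: n => [|n]; first by rewrite invr0.
by rewrite invf_le1 ?ltr0n // ler1n.
Qed.

Definition rough_sum N M : R[i] := \sum_(1 <= n < M.+1 | rough N n) dterm n.

(** One step of the sieve of Eratosthenes: with [p = N+1], the multiples of [p] to be removed are
    [p m] with [m] free of primes up to [N]. The identity is exact for finite sums at the price of
    the second cutoff [M / p]. *)
Lemma rough_sumS_prime N M : prime N.+1 ->
  rough_sum N.+1 M = rough_sum N M - dterm N.+1 * rough_sum N (M %/ N.+1).
Proof.
move=> p_pr; apply/eqP; rewrite eq_sym subr_eq; apply/eqP.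
rewrite /rough_sum (bigID (fun n => N.+1 %| n)%N) /= addrC; congr (_ + _).
  rewrite big_nat_cond [RHS]big_nat_cond; apply: eq_bigl => n.
  case: (boolP (1 <= n < M.+1)%N) => //= /andP[n0 _].
  by rewrite roughS_prime.
rewrite -big_filter (perm_big [seq (N.+1 * m)%N |
  m <- [seq m <- index_iota 1 (M %/ N.+1).+1 | rough N m]]).
  rewrite big_map big_filter mulr_sumr big_nat_cond [RHS]big_nat_cond.
  by apply: eq_bigr => m /andP[/andP[m0 _] _]; rewrite dtermM.
apply: uniq_perm; first exact/filter_uniq/iota_uniq.
  rewrite map_inj_uniq; first exact/filter_uniq/iota_uniq.
  by move=> a b /eqP; rewrite eqn_pmul2l // => /eqP.
move=> n; rewrite mem_filter mem_index_iota; apply/idP/mapP.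
  case/andP => /andP[rn /dvdnP[m nE]] /andP[n0 nM]; exists m; last by rewrite mulnC.
  have m0 : (0 < m)%N by move: n0; rewrite nE muln_gt0 => /andP[].
  rewrite mem_filter mem_index_iota m0 ltnS leq_divRL // -nE -ltnS nM !andbT.
  by rewrite -(rough_mul_prime m0 p_pr) mulnC -nE.
case=> m; rewrite mem_filter mem_index_iota => /andP[rm /andP[m0]].
rewrite ltnS leq_divRL // => mM ->.
by rewrite rough_mul_prime // rm dvdn_mulr //= muln_gt0 m0 /= ltnS mulnC mM.
Qed.

Lemma rough_sumS_nonprime N M : ~~ prime N.+1 -> rough_sum N.+1 M = rough_sum N M.
Proof. by move=> Np; apply: eq_bigl => n; rewrite roughS_nonprime. Qed.

Lemma rough_sum0 M : rough_sum 0 M = zetasum M s.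
Proof.
apply: eq_bigl => n; apply/allP => q; rewrite mem_primes => /andP[q_pr _].
exact: prime_gt0.
Qed.

Definition euler_prod N : R[i] := \prod_(1 <= p < N.+1 | prime p) (1 - dterm p).

Let s_neq0 : s != 0.
Proof. by apply: contraTneq s_gt0 => ->; rewrite ltxx. Qed.

Lemma inv_nat_small (C d : R) : 0 < d ->
  exists N0, forall N, (N0 <= N)%N -> C / N.+1%:R <= d.
Proof.
move=> d0; exists (Num.bound (`|C| / d)) => N hN.
rewrite ler_pdivrMr ?ltr0n // -ler_pdivrMl //.
apply: le_trans (_ : `|C| / d <= _); first by rewrite mulrC ler_pM2r ?invr_gt0 ?ler_norm.
apply/ltW/(lt_le_trans (archi_boundP _)); first by rewrite divr_ge0 // ltW.
by rewrite ler_nat ltnW.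
Qed.

Lemma zetasum_cvg (d : R) : 0 < d -> exists M0, forall M, (M0 <= M)%N ->
  normc (zetasum M s - rzeta s / s) <= d.
Proof.
move=> d0; pose d' := d * normc s / 2.
have sn : 0 < normc s by rewrite normc_gt0.
have d'0 : 0 < d' by rewrite divr_gt0 // mulr_gt0.
have [M1 h1] := inv_nat_small (zradius s) d'0.
have [M2 _ h2] := rpow_small s_gt0 d'0.
exists (maxn M1 M2) => M; rewrite geq_max => /andP[M1M M2M].
have -> : zetasum M s - rzeta s / s = (s * zetasum M s - rzeta s) / s.
  by field.
rewrite (normcM (_ - _)) normcV ler_pdivrMr //.
apply: le_trans (zetasum_rzeta M (ltW s_gt0)) _.
apply: le_trans (lerD (h1 M M1M) (h2 M.+1 (leqW M2M))) _.
by rewrite /d' -splitr.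
Qed.

(** In the sieve recurrence the sums up to [M] and up to [M / p] have the same limit, so each prime
    multiplies the limit by [1 - p^(-1-s)]. *)
Lemma rough_sum_cvg N (d : R) : 0 < d -> exists M0, forall M, (M0 <= M)%N ->
  normc (rough_sum N M - euler_prod N * (rzeta s / s)) <= d.
Proof.
elim: N d => [|N IH] d d0.
  have [M0 h] := zetasum_cvg d0; exists M0 => M hM.
  by rewrite rough_sum0 /euler_prod big_geq // mul1r h.
have eulerS : euler_prod N.+1 =
    if prime N.+1 then euler_prod N * (1 - dterm N.+1) else euler_prod N.
  by rewrite /euler_prod big_mkcond big_nat_recr //= -big_mkcond; case: ifP; rewrite ?mulr1.
case: (boolP (prime N.+1)) eulerS => p_pr ->; last first.
  have [M0 h] := IH d d0; exists M0 => M hM.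
  by rewrite rough_sumS_nonprime // h.
have [M0 h] := IH (d / 2) (divr_gt0 d0 (ltr0Sn _ 1)).
exists (M0 * N.+1)%N => M hM.
rewrite rough_sumS_prime //; set W := rzeta s / s.
have -> : rough_sum N M - dterm N.+1 * rough_sum N (M %/ N.+1) -
    euler_prod N * (1 - dterm N.+1) * W =
  (rough_sum N M - euler_prod N * W) -
  dterm N.+1 * (rough_sum N (M %/ N.+1) - euler_prod N * W) by ring.
apply: le_trans (le_normcB _ _) _; rewrite (splitr d) lerD //.
  by apply: h; apply: leq_trans hM; rewrite leq_pmulr.
rewrite (normcM (dterm _)); apply: le_trans (h (M %/ N.+1)%N _).
  by apply: ler_piMl; rewrite ?normc_ge0 ?normc_dterm_le1.
by rewrite leq_divRL.
Qed.

(** Apart from [n = 1] an integer without prime factors up to [N] exceeds [N], so only a tail of the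
    sum of [k^(-1-e)] remains. The boolean term accounts for the empty sum at [M = 0]. *)
Lemma rough_sum_near1 N M : (0 < N)%N ->
  normc (rough_sum N M - 1) <= rpow N (complex.Re s) / complex.Re s + (M == 0)%N%:R.
Proof.
move=> N0; case: M => [|M].
  rewrite /rough_sum big_geq // sub0r normcN normc1 lerDr.
  by rewrite divr_ge0 ?expR_ge0 // ltW.
rewrite addr0 /rough_sum big_ltn_cond //= dterm1 addrC addKr.
apply: le_trans (normc_sum _ _ _) _.
have [MN|NM] := leqP M.+1 N.
  rewrite big_nat_cond big_pred0 => [|n].
    by rewrite divr_ge0 ?expR_ge0 // ltW.
  apply/negbTE/negP => /andP[/andP[n2 nM] /(rough_lt_prime n2)] Nn.
  by lia.
rewrite (@big_cat_nat _ _ _ N.+1) //=; last exact: leqW.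
rewrite big_nat_cond big_pred0 ?add0r => [|n]; last first.
  apply/negbTE/negP => /andP[/andP[n2 nN] /(rough_lt_prime n2)] Nn.
  by move: nN; rewrite ltnS leqNgt Nn.
apply: le_trans (sum_rpow_div_tail s_gt0 N0 (ltnW NM)).
rewrite big_mkcond /=; apply: ler_sum => n _; case: ifP => _.
  by rewrite normc_dterm.
by rewrite divr_ge0 // expR_ge0.
Qed.

Lemma euler_prod_near1 N : (0 < N)%N ->
  normc (euler_prod N * (rzeta s / s) - 1) <= rpow N (complex.Re s) / complex.Re s.
Proof.
move=> N0; apply/ler_addgt0Pl => d d0.
have [M0 h] := rough_sum_cvg N d0.
have := rough_sum_near1 M0.+1 N0; rewrite addr0.
have := h _ (leqnSn M0); rewrite normcB.
move=> h1 h2; apply: le_trans (le_normc_dist (rough_sum N M0.+1) _ _) _.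
exact: lerD.
Qed.

Lemma euler_prod_ge : exists N0, forall N, (N0 <= N)%N ->
  1 / 2 <= normc (euler_prod N) * normc (rzeta s / s).
Proof.
have [|N0 N00 h] := @rpow_small R (complex.Re s) (complex.Re s / 2) s_gt0.
  by rewrite divr_gt0.
exists N0 => N hN; rewrite -normcM.
have := euler_prod_near1 (leq_trans N00 hN).
have : rpow N (complex.Re s) / complex.Re s <= 1 / 2.
  by rewrite ler_pdivrMr // mulrC mulrA mulr1 h.
have := lerB_normc 1 (euler_prod N * (rzeta s / s)).
rewrite normc1 normcB; lra.
Qed.

End EulerProduct.

(** * The 3-4-1 inequality and the absence of zeros *)

Section NonVanishing.
Variable R : realType.
Implicit Types (e u : R).

Lemma cpow_polar n e u :
  cpow n (e +i* u) =
  (rpow n e * cos (u * ln n%:R)) +i* (- (rpow n e * sin (u * ln n%:R))) :> R[i].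
Proof.
apply/eqP; rewrite eq_complex; apply/andP; split; apply/eqP.
  by rewrite /cpow /rpow Re_cexp cReM cImM /= !mulr0 subr0 add0r !mulNr cosN.
by rewrite /cpow /rpow Im_cexp cReM cImM /= !mulr0 subr0 add0r !mulNr sinN mulrN.
Qed.

Lemma normc_one_sub_dterm p e u : (0 < p)%N ->
  normc (1 - dterm (e +i* u) p) ^+ 2 =
  1 - 2 * (rpow p e / p%:R) * cos (u * ln p%:R) + (rpow p e / p%:R) ^+ 2.
Proof.
move=> p0; rewrite /dterm natC invC cpow_polar normc_sqr cReB cImB cReM cImM /=.
set r := rpow p e; set c := cos _; set x := _^-1; set y := sin _.
have h : y ^+ 2 = 1 - c ^+ 2 by apply: sin2cos2.
by ring: h.
Qed.

(* [3 + 4 cos t + cos (2 t) = 2 (1 + cos t)^2 >= 0], applied to each Euler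
   factor through [x <= exp (x - 1)]. *)
Lemma euler_factor_341 p e u : (0 < p)%N -> 0 <= e ->
  normc (1 - dterm (e +i* 0) p) ^+ 6 * normc (1 - dterm (e +i* u) p) ^+ 8 *
  normc (1 - dterm (e +i* (2 * u)) p) ^+ 2 <= expR (8 * p%:R^-1 ^+ 2).
Proof.
move=> p0 e0; set A := normc _; set B := normc _; set D := normc _.
have hA : A ^+ 2 <= expR (A ^+ 2 - 1).
  by have := expR_ge1Dx (A ^+ 2 - 1); rewrite addrC subrK.
have hB : B ^+ 2 <= expR (B ^+ 2 - 1).
  by have := expR_ge1Dx (B ^+ 2 - 1); rewrite addrC subrK.
have hD : D ^+ 2 <= expR (D ^+ 2 - 1).
  by have := expR_ge1Dx (D ^+ 2 - 1); rewrite addrC subrK.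
apply: le_trans (_ : expR (A ^+ 2 - 1) ^+ 3 * expR (B ^+ 2 - 1) ^+ 4 *
   expR (D ^+ 2 - 1) <= _).
  rewrite (exprM A 2 3) (exprM B 2 4).
  have A0 : 0 <= A ^+ 2 by apply: sqr_ge0.
  have B0 : 0 <= B ^+ 2 by apply: sqr_ge0.
  apply: ler_pM => //; [by rewrite mulr_ge0 // exprn_ge0|exact: sqr_ge0|].
  apply: ler_pM; [exact: exprn_ge0|exact: exprn_ge0| |].
    by apply: lerXn2r; rewrite ?nnegrE ?expR_ge0.
  by apply: lerXn2r; rewrite ?nnegrE ?expR_ge0.
rewrite -!expRM_natl -!expRD ler_expR /A /B /D !normc_one_sub_dterm //.
rewrite mul0r cos0 (_ : 2 * u * ln p%:R = (u * ln p%:R) *+ 2); last first.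
  by ring.
rewrite cos_mulr2n.
have r1 : rpow p e / p%:R <= p%:R^-1.
  by rewrite -[leRHS]mul1r ler_wpM2r ?invr_ge0 // rpow_le1.
have r0 : 0 <= rpow p e / p%:R by rewrite divr_ge0 // expR_ge0.
(* The exponents 6, 8, 2 double 3, 4, 1 because the squared norms are the explicit quantities. The
   exponent becomes [- 4 r (1 + c)^2 + 8 r^2], where [8 = 3 + 4 + 1]. *)
move: (rpow p e / p%:R) (cos _) r1 r0 => r c r1 r0.
have : 0 <= r * (1 + c) ^+ 2 by rewrite mulr_ge0 // sqr_ge0.
have : r ^+ 2 <= p%:R^-1 ^+ 2 by rewrite lerXn2r // nnegrE (le_trans r0).
move: (p%:R^-1) => x; lra.
Qed.

(** Here [16 = 8 * 2], the sum of [1 / p^2] being at most 2; the bound is uniform in [N], [e] and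
    [u]. *)
Lemma euler_prod_341 N e u : 0 <= e ->
  normc (euler_prod (e +i* 0) N) ^+ 6 * normc (euler_prod (e +i* u) N) ^+ 8 *
  normc (euler_prod (e +i* (2 * u)) N) ^+ 2 <= expR 16.
Proof.
move=> e0; rewrite /euler_prod !normc_prod -!prodrXl -!big_split /=.
apply: le_trans (_ : \prod_(1 <= p < N.+1) expR (8 * p%:R^-1 ^+ 2) <= _).
  rewrite big_mkcond big_nat_cond [leRHS]big_nat_cond; apply: ler_prod => p.
  case/andP => /andP[p0 _] _; case: ifP => _.
    by rewrite !mulr_ge0 ?exprn_ge0 ?normc_ge0 //= euler_factor_341.
  by rewrite ler01 -expR0 ler_expR mulr_ge0 // sqr_ge0.
rewrite -expR_sum ler_expR -mulr_sumr.
apply: le_trans (ler_wpM2l _ (sum_inv_sqr_le2 R N)) _ => //.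
by rewrite -natrM.
Qed.

(** For large [N] the product of [euler_prod] with [rzeta s / s] has norm at least 1/2 at each of
    the three points, and [6 + 8 + 2 = 16] such factors are multiplied. *)
Lemma rzeta_341 e u : 0 < e ->
  (2^-1 ^+ 16 / expR 16) <= normc (rzeta (e +i* 0) / (e +i* 0)) ^+ 6 *
   normc (rzeta (e +i* u) / (e +i* u)) ^+ 8 *
   normc (rzeta (e +i* (2 * u)) / (e +i* (2 * u))) ^+ 2 :> R.
Proof.
move=> e0.
have [N1 h1] := @euler_prod_ge R (e +i* 0) e0.
have [N2 h2] := @euler_prod_ge R (e +i* u) e0.
have [N3 h3] := @euler_prod_ge R (e +i* (2 * u)) e0.
pose N := maxn N1 (maxn N2 N3).
have {}h1 := h1 N (leq_maxl _ _).
have {}h2 : 1 / 2 <= _ := h2 N (leq_trans (leq_maxl _ _) (leq_maxr _ _)).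
have {}h3 : 1 / 2 <= _ := h3 N (leq_trans (leq_maxr _ _) (leq_maxr _ _)).
have hE := euler_prod_341 N u (ltW e0).
move: hE h1 h2 h3.
have := normc_ge0 (euler_prod (e +i* 0) N); have := normc_ge0 (euler_prod (e +i* u) N).
have := normc_ge0 (euler_prod (e +i* (2 * u)) N).
have := normc_ge0 (rzeta (e +i* 0) / (e +i* 0)); have := normc_ge0 (rzeta (e +i* u) / (e +i* u)).
have := normc_ge0 (rzeta (e +i* (2 * u)) / (e +i* (2 * u))).
move: (normc (euler_prod (e +i* 0) N)) (normc (euler_prod (e +i* u) N))
  (normc (euler_prod (e +i* (2 * u)) N)) (normc (rzeta _ / _)) (normc (rzeta _ / _))
  (normc (rzeta _ / _)) => a b c x y z z0 y0 x0 c0 b0 a0 hE h1 h2 h3.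
rewrite mul1r in h1 h2 h3.
rewrite ler_pdivrMr ?expR_gt0 //.
apply: le_trans (_ : (x ^+ 6 * y ^+ 8 * z ^+ 2) * (a ^+ 6 * b ^+ 8 * c ^+ 2) <= _); last first.
  by rewrite ler_wpM2l // !mulr_ge0 ?exprn_ge0.
have -> : (x ^+ 6 * y ^+ 8 * z ^+ 2) * (a ^+ 6 * b ^+ 8 * c ^+ 2) =
  (a * x) ^+ 6 * (b * y) ^+ 8 * (c * z) ^+ 2 by rewrite !exprMn; ring.
rewrite (exprD _ 14 2) (exprD _ 6 8).
have h k t : 2^-1 <= t -> (2^-1 : R) ^+ k <= t ^+ k.
  by move=> ht; rewrite lerXn2r // nnegrE ?invr_ge0 // (le_trans _ ht) ?invr_ge0.
by rewrite !ler_pM ?h ?mulr_ge0 ?exprn_ge0 ?invr_ge0.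
Qed.

Lemma normc_ge_im e u : `|u| <= normc (e +i* u).
Proof. exact: (normc_Im (e +i* u)). Qed.

(** A zero at [i u] would give [rzeta (e + i u) = O (e)] by the Lipschitz bound. In [rzeta_341] the
    resulting [e^8] beats the [e^(-6)] coming from the pole, so a fixed positive constant would be
    [O (e^2)]. *)
Lemma rzeta_line_neq0 u : rzeta (0 +i* u) != 0.
Proof.
have [->|u0] := eqVneq u 0; first by rewrite rzeta0 oner_neq0.
apply/negP => /eqP z0.
pose B := 1 + 2 * `|u|; have B0 : 0 <= B by rewrite addr_ge0 // mulr_ge0.
pose L := 3 * ((1 + 7 * B) * (1 + 3 * B)).
have L0 : 0 <= L by rewrite !mulr_ge0 // addr_ge0 // mulr_ge0.
pose C := 1 + L * B; have C0 : 0 <= C by rewrite addr_ge0 // mulr_ge0.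
have ball e v : 0 <= e -> e <= 1 -> `|v| <= 2 * `|u| -> normc (e +i* v) <= B.
  move=> e0 e1 v2; apply: le_trans (normc_le_ReIm _) _ => /=.
  by rewrite (ger0_norm e0) lerD.
have bnd e v : 0 <= e -> e <= 1 -> `|v| <= 2 * `|u| -> normc (rzeta (e +i* v)) <= C.
  move=> e0 e1 v2.
  have := @rzeta_lip R B (e +i* v) 0 B0 e0 (lexx 0) (ball _ _ e0 e1 v2).
  rewrite normc0 rzeta0 subr0 => /(_ B0) h.
  have := le_normcD (rzeta (e +i* v) - 1) 1; rewrite subrK normc1 => h'.
  apply: le_trans h' _; rewrite /C addrC lerD2l.
  by apply: le_trans h _; rewrite ler_wpM2l // ball.
have u1 : `|u| <= 2 * `|u| by have := normr_ge0 u; lra.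
pose k : R := 2^-1 ^+ 16 / expR 16.
have k0 : 0 < k by rewrite divr_gt0 ?expR_gt0 // exprn_gt0.
have un0 : 0 < `|u| by rewrite normr_gt0.
have main e : 0 < e -> e <= 1 -> k * `|u| ^+ 10 <= (C ^+ 8 * L ^+ 8) * e ^+ 2.
  move=> e0 e1; have h := rzeta_341 u e0.
  have zu : normc (rzeta (e +i* u)) <= L * e.
    have := @rzeta_lip R B (e +i* u) (0 +i* u) B0 (ltW e0) (lexx 0)
      (ball _ _ (ltW e0) e1 u1) (ball _ _ (lexx 0) ler01 u1).
    have -> : (e +i* u) - (0 +i* u) = e%:C.
      by apply/eqP; rewrite eq_complex /= subr0 subrr !eqxx.
    by rewrite z0 subr0 (normc_real_ge0 (ltW e0)).
  have b0 : normc (rzeta (e +i* 0)) <= C.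
    by apply: bnd; [exact: ltW|exact: e1|rewrite normr0 mulr_ge0].
  have b2 : normc (rzeta (e +i* (2 * u))) <= C.
    by apply: bnd; [exact: ltW|exact: e1|rewrite normrM ger0_norm].
  have q0 : normc (rzeta (e +i* 0) / (e +i* 0)) <= C / e.
    by rewrite (normcM (rzeta _)) normcV (normc_real_ge0 (ltW e0)) ler_pM2r ?invr_gt0.
  have q1 : normc (rzeta (e +i* u) / (e +i* u)) <= L * e / `|u|.
    rewrite (normcM (rzeta _)) normcV.
    apply: ler_pM => //; rewrite ?normc_ge0 ?invr_ge0 ?normc_ge0 //.
    by rewrite lef_pV2 ?posrE ?normc_ge_im // (lt_le_trans un0) ?normc_ge_im.
  have q2 : normc (rzeta (e +i* (2 * u)) / (e +i* (2 * u))) <= C / `|u|.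
    rewrite (normcM (rzeta _)) normcV.
    apply: ler_pM => //; rewrite ?normc_ge0 ?invr_ge0 ?normc_ge0 //.
    have hu : `|u| <= normc (e +i* (2 * u)).
      by apply: le_trans (normc_ge_im _ _); rewrite normrM ger0_norm.
    by rewrite lef_pV2 ?posrE // (lt_le_trans un0).
  have {}h : k <= (C / e) ^+ 6 * (L * e / `|u|) ^+ 8 * (C / `|u|) ^+ 2.
    apply: le_trans h _.
    have X i x y : 0 <= x -> x <= y -> x ^+ i <= y ^+ i :> R.
      by move=> x0 xy; rewrite lerXn2r // nnegrE (le_trans x0).
    by rewrite !ler_pM ?X ?mulr_ge0 ?exprn_ge0 ?normc_ge0.
  move: h; have -> : (C / e) ^+ 6 * (L * e / `|u|) ^+ 8 * (C / `|u|) ^+ 2 =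
    (C ^+ 8 * L ^+ 8) * e ^+ 2 / `|u| ^+ 10.
    by field; rewrite !gt_eqF.
  by rewrite ler_pdivlMr // exprn_gt0.
pose A := k * `|u| ^+ 10; have A0 : 0 < A by rewrite mulr_gt0 // exprn_gt0.
pose D := C ^+ 8 * L ^+ 8; have D0 : 0 <= D by rewrite mulr_ge0 // exprn_ge0.
have S0 : 0 < A + D + 1 by lra.
(* Chosen so that [e <= 1] and [D e < A], whence [D e^2 < A]. *)
pose e := A / (A + D + 1).
have e0 : 0 < e by rewrite divr_gt0.
have e1 : e <= 1 by rewrite ler_pdivrMr // mul1r; lra.
have := main e e0 e1; rewrite -/A -/D leNgt => /negP; apply.
apply: le_lt_trans (_ : D * e < _).
  by rewrite ler_wpM2l // expr2 ler_piMl // ltW.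
rewrite mulrA ltr_pdivrMr //; nra.
Qed.

End NonVanishing.

(** * The Tauberian argument *)

Section MobiusSeries.
Variable R : realType.
Implicit Types (n m N : nat) (e u : R) (s t : R[i]).

Definition mobius_poly N s : R[i] :=
  \sum_(1 <= n < N.+1) (mobius n)%:~R * dterm s n.

Lemma intC (k : int) : (k%:~R : R[i]) = (k%:~R : R)%:C.
Proof. by rewrite rmorph_int. Qed.

Lemma normc_mobius n : normc ((mobius n)%:~R : R[i]) <= 1.
Proof. by rewrite intC normc_real normr_mobiusR. Qed.

Lemma normc_mobius_poly N s : 0 < complex.Re s ->
  normc (mobius_poly N s) <= 1 + (complex.Re s)^-1.
Proof.
move=> s0; apply: le_trans (normc_sum _ _ _) _.
apply: le_trans (sum_rpow_div N s0); apply: ler_sum => n _.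
rewrite normcM normc_dterm; apply: ler_piMl (normc_mobius n).
by rewrite divr_ge0 // expR_ge0.
Qed.

(* In the double sum of [mu n (n m)^(-1-s)], the terms with [n m <= N] add up
   to 1, and for the others Rankin's trick gives
   [(n m)^(-e) <= N^(-e/2) (n m)^(-e/2)]. *)
Lemma mobius_poly_zetasum N s : (0 < N)%N -> 0 < complex.Re s ->
  normc (mobius_poly N s * zetasum N s - 1) <=
  rpow N (complex.Re s / 2) * (1 + (complex.Re s / 2)^-1) ^+ 2.
Proof.
move=> N0 s0; set e := complex.Re s; have e2 : 0 < e / 2 by rewrite divr_gt0.
pose T := \sum_(1 <= n < N.+1) \sum_((N %/ n).+1 <= m < N.+1)
  (mobius n)%:~R * dterm s (n * m).
have -> : mobius_poly N s * zetasum N s - 1 = T.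
  rewrite -(dterm1 s) -(@sum_mobius_convolution _ (dterm s) N N0).
  apply/eqP; rewrite subr_eq addrC; apply/eqP.
  rewrite /mobius_poly /T -big_split /= mulr_suml; apply: eq_big_nat => n /andP[n0 nN].
  rewrite -big_cat_nat //=; last by rewrite ltnS leq_div.
  rewrite mulr_sumr; apply: eq_big_nat => m /andP[m0 mN].
  rewrite dtermM //; exact/esym/mulrA.
pose r n := rpow n (e / 2) / n%:R.
have r0 n : 0 <= r n by rewrite divr_ge0 // expR_ge0.
apply: le_trans (normc_sum _ _ _) _.
apply: le_trans (_ : \sum_(1 <= n < N.+1) \sum_(1 <= m < N.+1) rpow N (e / 2) * (r n * r m) <= _).
  apply: ler_sum_nat => n /andP[n0 nN].
  apply: le_trans (normc_sum _ _ _) _.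
  rewrite [leRHS](@big_cat_nat _ _ _ (N %/ n).+1) //=; last by rewrite ltnS leq_div.
  rewrite -[leLHS]add0r; apply: lerD.
    by apply: sumr_ge0 => m _; rewrite !mulr_ge0 // expR_ge0.
  apply: ler_sum_nat => m /andP[mn mN].
  have m0 : (0 < m)%N by apply: leq_trans mn.
  rewrite normcM normc_dterm -/e.
  apply: le_trans (_ : rpow (n * m) e / (n * m)%:R <= _).
    by apply: ler_piMl (normc_mobius n); rewrite divr_ge0 // expR_ge0.
  have -> : rpow (n * m) e = rpow (n * m) (e / 2) * rpow (n * m) (e / 2).
    by rewrite /rpow -expRD -mulrDl -opprD -splitr.
  rewrite -mulrA; apply: ler_pM; rewrite ?expR_ge0 //.
  - by rewrite divr_ge0 // expR_ge0.
  - apply: ler_rpow => //; first exact: ltW.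
    by move: mn; rewrite ltn_divLR // mulnC => /ltnW.
  - by rewrite rpowM // natrM invfM mulrACA.
under eq_bigr => n _ do rewrite -mulr_sumr -mulr_sumr.
rewrite -mulr_sumr -mulr_suml ler_wpM2l ?expR_ge0 // expr2.
have h := sum_rpow_div N e2.
by apply: ler_pM; rewrite ?sumr_ge0.
Qed.

Definition mertens_poly N s : R[i] :=
  \sum_(1 <= n < N.+1) (mobius_sum R n)%:C * dterm s n.

Lemma mobius_sumS N :
  mobius_sum R N.+1 = mobius_sum R N + (mobius N.+1)%:~R / N.+1%:R.
Proof. by rewrite /mobius_sum big_nat_recr. Qed.

(** Abel summation: [s n^(-1-s)] is [zterm n s] plus [n^(-s) - (n+1)^(-s)], and consecutive values
    of [mobius_sum] differ by [mu n / n]. *)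
Lemma mertens_polyE N s : s * mertens_poly N s =
  mobius_poly N s - (mobius_sum R N)%:C * cpow N.+1 s +
  \sum_(1 <= n < N.+1) (mobius_sum R n)%:C * zterm n s.
Proof.
elim: N => [|N IH].
  rewrite /mertens_poly /mobius_poly /mobius_sum !big_geq //.
  by rewrite mulr0 mul0r subr0 addr0.
rewrite /mertens_poly big_nat_recr //= mulrDr -/(mertens_poly N s) IH.
have -> : mobius_poly N.+1 s = mobius_poly N s + (mobius N.+1)%:~R * dterm s N.+1.
  by rewrite /mobius_poly big_nat_recr.
rewrite [X in _ = _ + X]big_nat_recr //=.
set T := \sum_(_ <= _ < _) _.
have -> : zterm N.+1 s = s * dterm s N.+1 - cpow N.+1 s + cpow N.+2 s by [].
rewrite /dterm intC.
have -> : (mobius_sum R N.+1)%:C =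
    (mobius_sum R N)%:C + (((mobius N.+1)%:~R : R)%:C / N.+1%:R) :> R[i].
  by rewrite mobius_sumS natC invC -rmorphM -rmorphD.
ring.
Qed.

(** [mertens_polyE] divided by [s], with [mobius_poly N s / s] replaced by its limit [1 / rzeta s]
    and the boundary term dropped. It can be bounded uniformly in [N] and as [Re s -> 0]. *)
Definition mertens_main N s : R[i] := (rzeta s)^-1 +
  \sum_(1 <= n < N.+1) (mobius_sum R n)%:C * (zterm n s / s).

Lemma mertens_poly_sub_main N s : 0 < complex.Re s -> rzeta s != 0 ->
  normc (mertens_poly N s - mertens_main N s) <=
  (normc (mobius_poly N s * zetasum N s - 1) +
   (1 + (complex.Re s)^-1) / complex.Re s * normc (s * zetasum N s - rzeta s))
   / normc (rzeta s) + rpow N.+1 (complex.Re s) / complex.Re s.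
Proof.
move=> s0 z0; have sn : s != 0 by apply: contraTneq s0 => ->; rewrite ltxx.
set M := mobius_poly N s; set Z := zetasum N s; set H := rzeta s.
have nH : 0 < normc H by rewrite normc_gt0.
have nse : complex.Re s <= normc s.
  by apply: le_trans (normc_Re s); rewrite ler_norm.
have ns : 0 < normc s by apply: lt_le_trans nse.
(* The identity [M / s - 1 / H = ((M Z - 1) - (M / s) (s Z - H)) / H] reduces the error to two
   quantities already known to be small. *)
have -> : mertens_poly N s - mertens_main N s =
    ((M * Z - 1) - M / s * (s * Z - H)) / H
    - (mobius_sum R N)%:C * cpow N.+1 s / s.
  have -> : mertens_poly N s = s * mertens_poly N s / s by field.
  rewrite mertens_polyE /mertens_main -/M -/H.
  have -> : \sum_(1 <= n < N.+1) (mobius_sum R n)%:C * (zterm n s / s) =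
      (\sum_(1 <= n < N.+1) (mobius_sum R n)%:C * zterm n s) / s.
    by rewrite mulr_suml; apply: eq_bigr => n _; rewrite mulrA.
  set T := \sum_(_ <= _ < _) _.
  by field; rewrite sn z0.
apply: le_trans (le_normcB _ _) _; apply: lerD.
  rewrite (normcM (_ - _)) normcV ler_pM2r ?invr_gt0 //.
  apply: le_trans (le_normcB _ _) _; rewrite lerD2l (normcM (M / s)).
  apply: ler_wpM2r; rewrite ?normc_ge0 // (normcM M) normcV.
  by apply: ler_pM; rewrite ?normc_ge0 ?invr_ge0 ?normc_ge0 // ?normc_mobius_poly // lef_pV2.
rewrite (normcM (_ * _)) (normcM _%:C) normcV normc_real normc_cpow.
apply: ler_pM; rewrite ?invr_ge0 ?normc_ge0 ?mulr_ge0 ?expR_ge0 //.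
  by apply: ler_piMl; rewrite ?expR_ge0 ?normr_mobius_sum.
by rewrite lef_pV2.
Qed.

(** The minimum of [|rzeta|] over the compact segment of the line is positive, and the Lipschitz
    bound loses at most half of it in a thin strip. *)
Lemma rzeta_lower_bound (L : R) : 0 < L -> exists e0 m : R, [/\ 0 < e0 <= 1, 0 < m &
  forall e u, 0 <= e <= e0 -> 0 <= u <= L -> m <= normc (rzeta (e +i* u))].
Proof.
move=> L0.
have diffE e u e' u' : (e +i* u) - (e' +i* u') = (e - e') +i* (u - u') :> R[i].
  by apply/eqP; rewrite eq_complex /= !eqxx.
have cont : continuous (fun u : R => normc (rzeta (0 +i* u))).
  move=> u; apply/cvgrPdist_le => d d0.
  pose B := `|u| + 1; have B0 : 0 <= B by rewrite addr_ge0.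
  pose K := 3 * ((1 + 7 * B) * (1 + 3 * B)).
  have K0 : 0 <= K by rewrite !mulr_ge0 // addr_ge0 // mulr_ge0.
  have K1 : 0 < K + 1 by rewrite ltr_wpDl.
  pose r := Num.min 1 (d / (K + 1)).
  have r0 : 0 < r by rewrite lt_min ltr01 divr_gt0.
  apply/nbhs_ballP; exists r => // v; rewrite /ball /= => uv.
  have uv1 : `|u - v| < 1 by apply: lt_le_trans uv _; rewrite ge_min lexx.
  have uvd : `|u - v| < d / (K + 1).
    by apply: lt_le_trans uv _; rewrite ge_min lexx orbT.
  have nimE (w : R) : normc (0 +i* w) = `|w| by rewrite /= expr0n add0r sqrtr_sqr.
  have vB : `|v| <= B.
    by have := ler_normB u (u - v); rewrite opprB addrC subrK /B; lra.
  have h := @rzeta_lip R B (0 +i* u) (0 +i* v) B0 (lexx 0) (lexx 0).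
  rewrite !nimE in h; have {}h := h (_ : `|u| <= B) vB.
  have {}h : normc (rzeta (0 +i* u) - rzeta (0 +i* v)) <= d.
    apply: le_trans (h _) _; first by rewrite /B lerDl.
    rewrite diffE subrr nimE -/K.
    apply: le_trans (_ : (K + 1) * (d / (K + 1)) <= _).
      by apply: ler_pM => //; rewrite ?lerDl // ltW.
    by rewrite mulrC divfK // gt_eqF.
  rewrite ler_norml; apply/andP; split.
    have := lerB_normc (rzeta (0 +i* v)) (rzeta (0 +i* u)); rewrite normcB; lra.
  have := lerB_normc (rzeta (0 +i* u)) (rzeta (0 +i* v)); lra.
have [c _ hc] := EVT_min (ltW L0) (continuous_subspaceT cont).
pose m := normc (rzeta (0 +i* c)).
have m0 : 0 < m by rewrite normc_gt0 rzeta_line_neq0.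
pose B := L + 1; have B0 : 0 <= B by rewrite addr_ge0 // ltW.
pose K := 3 * ((1 + 7 * B) * (1 + 3 * B)).
have K0 : 0 <= K by rewrite !mulr_ge0 // addr_ge0 // mulr_ge0.
have K1 : 0 < K + 1 by rewrite ltr_wpDl.
exists (Num.min 1 (m / 2 / (K + 1))), (m / 2); split.
- by rewrite lt_min ltr01 ge_min lexx !divr_gt0.
- by rewrite divr_gt0.
move=> e u /andP[e0]; rewrite le_min => /andP[e1 em] /andP[u0 uL].
have := hc u; rewrite in_itv /= u0 uL => /(_ isT) h0.
have bB (e' : R) : 0 <= e' -> e' <= 1 -> normc (e' +i* u) <= B.
  move=> e'0 e'1; apply: le_trans (normc_le_ReIm _) _ => /=.
  by rewrite !ger0_norm // addrC lerD.
have := @rzeta_lip R B (e +i* u) (0 +i* u) B0 e0 (lexx 0) (bB _ e0 e1) (bB _ (lexx 0) ler01).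
rewrite diffE subr0 subrr -/K (normc_real_ge0 e0) => h1.
have h2 : K * e <= m / 2.
  apply: le_trans (_ : (K + 1) * (m / 2 / (K + 1)) <= _).
    by apply: ler_pM; rewrite ?lerDl.
  by rewrite mulrC divfK // gt_eqF.
have := lerB_normc (rzeta (0 +i* u)) (rzeta (e +i* u)); rewrite normcB.
by rewrite -/m in h0; lra.
Qed.

(** The order of the quantifiers matters: [C] depends on [L] only, so that [e] can be tied to [x]
    later, whereas the truncation [N0] may depend on [e] and [d]. *)
Lemma mertens_poly_uniform (L : R) : 0 < L -> exists e0 C : R, [/\ 0 < e0 <= 1, 0 <= C &
  forall e d, 0 < e <= e0 -> 0 < d -> exists N0, forall N, (N0 <= N)%N ->
   (forall u, 0 <= u <= L -> normc (mertens_poly N (e +i* u)) <= C + d) /\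
   (forall u v, 0 <= u <= L -> 0 <= v <= L ->
     normc (mertens_poly N (e +i* u) - mertens_poly N (e +i* v)) <= C * `|u - v| + d)].
Proof.
move=> L0; have [e0 [m [/andP[e00 e01] m0 hm]]] := rzeta_lower_bound L0.
pose B := L + 1; have B0 : 0 <= B by rewrite addr_ge0 // ltW.
pose K := 3 * ((1 + 7 * B) * (1 + 3 * B)).
have B7 : 0 <= 1 + 7 * B by rewrite addr_ge0 // mulr_ge0.
have K0 : 0 <= K by rewrite !mulr_ge0 // addr_ge0 // mulr_ge0.
(* Size and Lipschitz constant of [mertens_main] along a vertical segment. The first summands come
   from [1 / rzeta], the others from the [zterm] series, with the sums of [1 / n^2] and
   [log_majorant] bounded by 2 and 3. *)
pose C1 := m^-1 + 2 * (1 + 7 * B); pose C2 := K / m ^+ 2 + 3 * (10 + 21 * B).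
have C10 : 0 <= C1 by apply: addr_ge0; [rewrite invr_ge0 ltW|rewrite mulr_ge0].
have C20 : 0 <= C2.
  apply: addr_ge0; first by rewrite divr_ge0 // exprn_ge0 // ltW.
  by rewrite mulr_ge0 // addr_ge0 // mulr_ge0.
exists e0, (C1 + C2); split; [by rewrite e00|exact: addr_ge0|].
move=> e d /andP[ep ee0] d0.
have bB u : 0 <= u <= L -> normc (e +i* u) <= B.
  case/andP => u0 uL; apply: le_trans (normc_le_ReIm _) _ => /=.
  by rewrite (ger0_norm (ltW ep)) (ger0_norm u0) addrC lerD // (le_trans ee0).
have lb u : 0 <= u <= L -> m <= normc (rzeta (e +i* u)).
  by move=> uL; apply: hm => //; rewrite (ltW ep).
have nz u : 0 <= u <= L -> rzeta (e +i* u) != 0.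
  by move=> uL; rewrite -normc_gt0 (lt_le_trans m0) // lb.
have main_bnd N u : 0 <= u <= L -> normc (mertens_main N (e +i* u)) <= C1.
  move=> uL; apply: le_trans (le_normcD _ _) _; apply: lerD.
    by rewrite normcV lef_pV2 ?posrE ?lb // (lt_le_trans m0) // lb.
  apply: le_trans (normc_sum _ _ _) _.
  apply: le_trans (_ : \sum_(1 <= n < N.+1) (1 + 7 * B) * n%:R^-1 ^+ 2 <= _).
    apply: ler_sum_nat => n /andP[n0 _].
    rewrite normcM normc_real; apply: le_trans (ler_piMl (normc_ge0 _) (normr_mobius_sum _ _)) _.
    rewrite (normcM (zterm _ _)) normcV ler_pdivrMr; last first.
      by apply: lt_le_trans (normc_Re _); rewrite /= gtr0_norm.
    by rewrite mulrAC; apply: zterm_le => //=; [exact: ltW|exact: bB].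
  by rewrite -mulr_sumr mulrC ler_wpM2r // sum_inv_sqr_le2.
have main_lip N u v : 0 <= u <= L -> 0 <= v <= L ->
    normc (mertens_main N (e +i* u) - mertens_main N (e +i* v)) <= C2 * `|u - v|.
  move=> uL vL.
  have nuv : normc ((e +i* u) - (e +i* v)) = `|u - v|.
    by rewrite /= subrr expr0n add0r sqrtr_sqr.
  rewrite /mertens_main (_ : forall a b c f : R[i], a + b - (c + f) = (a - c) + (b - f));
    last by move=> *; ring.
  apply: le_trans (le_normcD _ _) _; rewrite mulrDl; apply: lerD.
    have -> : (rzeta (e +i* u))^-1 - (rzeta (e +i* v))^-1 =
      (rzeta (e +i* v) - rzeta (e +i* u)) / (rzeta (e +i* u) * rzeta (e +i* v)).
      by field; rewrite !nz.
    rewrite (normcM (_ - _)) normcV (normcM (rzeta _) (rzeta _)) [leRHS]mulrAC.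
    apply: ler_pM; [exact: normc_ge0|by rewrite invr_ge0 mulr_ge0 ?normc_ge0| |].
      by rewrite normcB -nuv; apply: rzeta_lip; rewrite //= ?bB // ltW.
    rewrite lef_pV2 ?posrE ?exprn_gt0 //; last by rewrite mulr_gt0 ?normc_gt0 ?nz.
    by rewrite expr2; apply: ler_pM; rewrite ?lb // ltW.
  rewrite -sumrB; apply: le_trans (normc_sum _ _ _) _.
  apply: le_trans (_ : \sum_(1 <= n < N.+1) (10 + 21 * B) * `|u - v| * log_majorant R n <= _).
    apply: ler_sum_nat => n /andP[n0 _].
    rewrite -mulrBr normcM normc_real.
    apply: le_trans (ler_piMl (normc_ge0 _) (normr_mobius_sum _ _)) _.
    by rewrite -nuv; apply: zquot_lip => //=; rewrite ?bB.
  rewrite -mulr_sumr mulrC -mulrA ler_wpM2r ?sum_log_majorant //.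
  by rewrite mulr_ge0 // addr_ge0 // mulr_ge0.
pose Y := (1 + (e / 2)^-1) ^+ 2 / m.
pose W := (1 + e^-1) / e / m.
have Y0 : 0 < Y.
  by rewrite divr_gt0 // exprn_gt0 // ltr_wpDr // ?invr_ge0 ?divr_ge0 // ltW.
have W0 : 0 < W by rewrite !divr_gt0 // ltr_wpDr // ?invr_ge0 // ltW.
(* Four errors of size [d'] make [d / 2] at one point, hence [d] when two points are compared. *)
pose d' := d / 8; have d'0 : 0 < d' by rewrite divr_gt0.
have [N1 N10 h1] := @rpow_small R (e / 2) (d' / Y) (divr_gt0 ep (ltr0Sn _ 1)) (divr_gt0 d'0 Y0).
have [N2 h2] := @inv_nat_small R (4 * ((1 + 7 * B) * B)) (d' / W) (divr_gt0 d'0 W0).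
have [N3 _ h3] := @rpow_small R e (d' / W) ep (divr_gt0 d'0 W0).
have [N4 _ h4] := @rpow_small R e (d' * e) ep (mulr_gt0 d'0 ep).
have err N u : (maxn (maxn N1 N2) (maxn N3 N4) <= N)%N -> 0 <= u <= L ->
    normc (mertens_poly N (e +i* u) - mertens_main N (e +i* u)) <= d / 2.
  rewrite !geq_max => /andP[/andP[n1 n2] /andP[n3 n4]] uL.
  apply: le_trans (mertens_poly_sub_main N (_ : 0 < complex.Re (e +i* u)) (nz u uL)) _ => //=.
  have n0 : (0 < N)%N by apply: leq_trans n1.
  have k1 := @mobius_poly_zetasum N (e +i* u) n0 ep.
  have k2 := @zetasum_rzeta R N (e +i* u) (ltW ep).
  rewrite /= in k1 k2.
  have k3 : zradius (e +i* u) / N.+1%:R <= d' / W.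
    apply: le_trans (h2 N n2); rewrite ler_pM2r ?invr_gt0 // /zradius ler_pM2l //.
    apply: ler_pM; rewrite ?normc_ge0 ?bB ?addr_ge0 ?mulr_ge0 ?normc_ge0 //.
    by rewrite lerD2l ler_pM2l // bB.
  have k4 : rpow N.+1 e / e <= d' by rewrite ler_pdivrMr // h4 // leqW.
  have k5 := h3 N.+1 (leqW n3).
  have k6 := h1 N n1.
  have E0 : 0 <= (1 + e^-1) / e by rewrite divr_ge0 ?addr_ge0 ?invr_ge0 // ltW.
  apply: le_trans (lerD (_ : _ <= d' + 2 * d') k4) _; last by rewrite /d'; lra.
  apply: le_trans (_ : (rpow N (e / 2) * (1 + (e / 2)^-1) ^+ 2 +
       (1 + e^-1) / e * (d' / W + d' / W)) / m <= _).
    apply: ler_pM.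
    - by rewrite addr_ge0 ?normc_ge0 // mulr_ge0 // normc_ge0.
    - by rewrite invr_ge0 normc_ge0.
    - apply: lerD k1 _; apply: ler_wpM2l => //; apply: le_trans k2 _; exact: lerD.
    - by rewrite lef_pV2 ?posrE ?lb // (lt_le_trans m0) // lb.
  rewrite mulrDl; apply: lerD.
    by rewrite -mulrA -/Y -ler_pdivlMr.
  have -> : (1 + e^-1) / e * (d' / W + d' / W) / m = W * (d' / W + d' / W).
    by rewrite /W; ring.
  by rewrite mulrDr mulrC divfK ?gt_eqF //; lra.
exists (maxn (maxn N1 N2) (maxn N3 N4)) => N hN; split.
  move=> u uL.
  have := le_normcD (mertens_poly N (e +i* u) - mertens_main N (e +i* u))
    (mertens_main N (e +i* u)).
  by rewrite subrK; have := err N u hN uL; have := main_bnd N u uL; lra.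
move=> u v uL vL.
apply: le_trans (le_normc_dist (mertens_main N (e +i* u)) _ _) _.
apply: le_trans (lerD (lexx _) (le_normc_dist (mertens_main N (e +i* v)) _ _)) _.
have e1 := err N u hN uL; have e2 := err N v hN vL; rewrite normcB in e2.
have e3 := main_lip N u v uL vL.
have e4 : 0 <= C1 * `|u - v| by rewrite mulr_ge0.
apply: le_trans (lerD e1 (lerD e3 e2)) _; lra.
Qed.

End MobiusSeries.

(** * The Fejer kernel and the Riemann-Lebesgue lemma *)

Section FejerSum.
Variable R : realType.
Implicit Types (n N : nat) (e u v x y L : R).

Lemma is_derive_mulr_const y u : is_derive u 1 (fun v : R => v * y) y.
Proof.
have := @is_deriveM R R^o id (cst y) u 1 1 0 (is_derive_id _ _) (is_derive_cst _ _ _).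
by rewrite /GRing.scale /= mulr0 add0r mulr1.
Qed.

Lemma is_derive_sin_mul y u :
  is_derive u 1 (fun v : R => sin (v * y)) (y * cos (u * y)).
Proof.
have h := is_derive_mulr_const y u.
have := @is_derive1_comp R sin (fun v => v * y) u _ _ (is_derive_sin (u * y)) h.
by rewrite mulrC.
Qed.

Lemma is_derive_cos_mul y u :
  is_derive u 1 (fun v : R => cos (v * y)) (- (y * sin (u * y))).
Proof.
have h := is_derive_mulr_const y u.
have := @is_derive1_comp R cos (fun v => v * y) u _ _ (is_derive_cos (u * y)) h.
by rewrite mulNr (mulrC y).
Qed.

(** An antiderivative in [u] of [(1 - u / L) cos (u y)], found by parts. With it, mean value
    estimates take the place of integrals. *)
Definition fejer_primitive L y u : R :=
  (1 - u * L^-1) * (sin (u * y) * y^-1) + (1 - cos (u * y)) * (L * y ^+ 2)^-1.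

(** For [y] nonzero, the integral of [(1 - u / L) cos (u y)] over [[0, L]]. *)
Definition fejer L y : R := (1 - cos (L * y)) / (L * y ^+ 2).

Lemma is_derive_fejer_primitive L y u : L != 0 -> y != 0 ->
  is_derive u 1 (fejer_primitive L y) ((1 - u / L) * cos (u * y)).
Proof.
move=> L0 y0; have h1 := is_derive_mulr_const L^-1 u.
have h2 := is_derive_sin_mul y u; have h3 := is_derive_cos_mul y u.
rewrite /fejer_primitive; apply: is_derive_eq; rewrite /GRing.scale /=.
by field; rewrite L0 y0.
Qed.

Lemma fejer_primitiveB L y : L != 0 ->
  fejer_primitive L y L - fejer_primitive L y 0 = fejer L y.
Proof.
move=> L0; rewrite /fejer_primitive divff // subrr mul0r add0r !mul0r sin0 cos0.
by rewrite subrr !mul0r mulr0 addr0 subr0.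
Qed.

Lemma is_derive_sum_nat N (f : nat -> R -> R) (df : nat -> R) u :
  (forall n, (0 < n <= N)%N -> is_derive u 1 (f n) (df n)) ->
  is_derive u 1 (fun v => \sum_(1 <= n < N.+1) f n v) (\sum_(1 <= n < N.+1) df n).
Proof.
elim: N => [|N IH] h.
  rewrite big_geq // (_ : (fun v => _) = cst 0); last by apply/funext => v; rewrite big_geq.
  exact: is_derive_cst.
rewrite big_nat_recr //= (_ : (fun v => _) =
  (fun v => \sum_(1 <= n < N.+1) f n v) + f N.+1); last first.
  by apply/funext => v; rewrite big_nat_recr.
apply: is_deriveD; last by apply: h; rewrite leqnn.
by apply: IH => n /andP[n0 nN]; apply: h; rewrite n0 leqW.
Qed.

Definition fejer_weight e n : R := rpow n e / n%:R.

Lemma Re_mertens_poly N e u x :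
  complex.Re ((cos (u * x) +i* sin (u * x)) * mertens_poly N (e +i* u)) =
  \sum_(1 <= n < N.+1) mobius_sum R n * fejer_weight e n * cos (u * (x - ln n%:R)).
Proof.
have Re_sum (F : nat -> R[i]) : complex.Re (\sum_(1 <= n < N.+1) F n) =
    \sum_(1 <= n < N.+1) complex.Re (F n).
  by elim/big_rec2: _ => [//|n y z _ <-]; case: (F n); case: z.
rewrite /mertens_poly mulr_sumr Re_sum; apply: eq_bigr => n _.
rewrite /dterm natC invC cpow_polar /fejer_weight mulrBr cosB.
rewrite !cReM !cImM /=; ring.
Qed.

Lemma expi_shift u x : x != 0 ->
  (cos ((u - pi / x) * x) +i* sin ((u - pi / x) * x)) =
  - (cos (u * x) +i* sin (u * x)) :> R[i].
Proof.
move=> x0; rewrite mulrBl divfK // cosB sinB cospi sinpi.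
by apply/eqP; rewrite eq_complex /=; apply/andP; split; apply/eqP; ring.
Qed.

Lemma normr_Re_expi u (z : R[i]) :
  `|complex.Re ((cos u +i* sin u) * z)| <= normc z.
Proof.
by apply: le_trans (normc_Re _) _; rewrite normcM /= cos2Dsin2 sqrtr1 mul1r.
Qed.

(* Riemann-Lebesgue: the sum is the integral over [[0, L]] of
   [(1 - u / L) Re (exp (i u x) mertens_poly N (e + i u))], i.e. the increment of the
   primitive [P]; since the integrand changes sign under [u -> u - pi / x] up to
   [O (1 / x)], [P u + P (u - pi / x)] has a small derivative. *)
Lemma fejer_sum_small L k : 0 < L -> 0 < k -> exists2 X, 0 < X &
  forall x, X <= x -> (forall n, x != ln n%:R) -> exists N0, forall N, (N0 <= N)%N ->
  `|\sum_(1 <= n < N.+1) mobius_sum R n * fejer_weight x^-1 n * fejer L (x - ln n%:R)| <= k.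
Proof.
move=> L0 k0; have Ln : L != 0 by rewrite gt_eqF.
have [e0 [C [/andP[e00 _] C0 hD]]] := mertens_poly_uniform L0.
pose C' := C + (C + 1) / L; have C'0 : 0 <= C'.
  by rewrite addr_ge0 // divr_ge0 ?addr_ge0 // ltW.
pose K := L * C' + 2 * (C + 1).
have K0 : 0 < K by rewrite ltr_wpDl ?mulr_ge0 ?mulr_gt0 ?ltr_wpDl // ltW.
pose d := Num.min 1 (k / 2 / L).
have d0 : 0 < d by rewrite lt_min ltr01 !divr_gt0.
have d1 : d <= 1 by rewrite ge_min lexx.
have dL : L * d <= k / 2 by rewrite mulrC -ler_pdivlMr // ge_min lexx orbT.
have pi0 := pi_gt0 R.
(* The summands ensure in turn [1 / x <= e0], [pi / x <= L] and [K pi / x <= k / 2]. *)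
exists (e0^-1 + pi / L + K * pi / (k / 2)).
  by rewrite !addr_gt0 ?invr_gt0 // !divr_gt0 // mulr_gt0.
move=> x Xx xln.
have sum3 (a b c : R) : 0 < a -> 0 < b -> 0 < c -> a + b + c <= x ->
    [/\ a <= x, b <= x & c <= x] by move=> *; split; lra.
have [|||X1 X2 X3] := sum3 _ _ _ _ _ _ Xx.
- by rewrite invr_gt0.
- exact: divr_gt0.
- by rewrite !divr_gt0 // mulr_gt0.
have x0 : 0 < x by apply: lt_le_trans X1; rewrite invr_gt0.
have xn : x != 0 by rewrite gt_eqF.
set e := x^-1; have ep : 0 < e by rewrite invr_gt0.
have ee0 : e <= e0 by rewrite -(invrK e0) lef_pV2 ?posrE ?invr_gt0.
have [N0 hN0] := hD e d (introT andP (conj ep ee0)) d0.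
exists N0 => N /hN0[Db Dl] {hN0 hD}.
set t := pi / x; have t0 : 0 < t by rewrite divr_gt0.
have tL : t <= L by rewrite ler_pdivrMr // mulrC -ler_pdivrMr.
have tK : K * t <= k / 2.
  by rewrite mulrA ler_pdivrMr // [leRHS]mulrC -ler_pdivrMr // divr_gt0.
pose P u := \sum_(1 <= n < N.+1)
  (mobius_sum R n * fejer_weight e n) * fejer_primitive L (x - ln n%:R) u.
pose F u : R[i] := (1 - u / L)%:C * mertens_poly N (e +i* u).
pose f u := complex.Re ((cos (u * x) +i* sin (u * x)) * F u).
have dP u : is_derive u 1 P (f u).
  have -> : f u = \sum_(1 <= n < N.+1)
      (mobius_sum R n * fejer_weight e n) * ((1 - u / L) * cos (u * (x - ln n%:R))).
    rewrite /f /F mulrCA; set z := _ * mertens_poly N _.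
    rewrite cReM /= mul0r subr0 /z Re_mertens_poly mulr_sumr.
    by apply: eq_bigr => n _; rewrite mulrCA.
  apply: is_derive_sum_nat => n _; apply: is_deriveZ.
  by apply: is_derive_fejer_primitive; rewrite // subr_eq0.
have w01 u : 0 <= u <= L -> 0 <= 1 - u / L <= 1.
  case/andP => u0 uL; rewrite subr_ge0 ler_pdivrMr // mul1r uL gerBl.
  by rewrite divr_ge0 // ltW.
have Fb u : 0 <= u <= L -> normc (F u) <= C + 1.
  move=> uL; have /andP[w0 w1] := w01 u uL.
  rewrite normcM normc_real_ge0 //; apply: le_trans (ler_piMl (normc_ge0 _) w1) _.
  by apply: le_trans (Db u uL) _; rewrite lerD2l.
have Fl u v : 0 <= u <= L -> 0 <= v <= L -> normc (F u - F v) <= C' * `|u - v| + d.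
  move=> uL vL; have /andP[w0 w1] := w01 u uL.
  have -> : F u - F v = (1 - u / L)%:C * (mertens_poly N (e +i* u) - mertens_poly N (e +i* v))
      - ((u - v) / L)%:C * mertens_poly N (e +i* v).
    have -> : (u - v) / L = (1 - v / L) - (1 - u / L) by rewrite mulrBl; ring.
    by rewrite /F rmorphB mulrBr mulrBl; ring.
  apply: le_trans (le_normcB _ _) _.
  rewrite (normcM (1 - u / L)%:C) (normcM ((u - v) / L)%:C) !normc_real (ger0_norm w0).
  rewrite normrM normfV (gtr0_norm L0).
  apply: le_trans (_ : (C * `|u - v| + d) + `|u - v| / L * (C + 1) <= _).
    apply: lerD; first by apply: le_trans (ler_piMl (normc_ge0 _) w1) (Dl u v uL vL).
    apply: ler_wpM2l; first by rewrite divr_ge0 // ltW.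
    by apply: le_trans (Db v vL) _; rewrite lerD2l.
  by rewrite /C' le_eqVlt; apply/orP; left; apply/eqP; ring.
have fb u : 0 <= u <= L -> `|f u| <= C + 1.
  by move=> uL; apply: le_trans (normr_Re_expi _ _) (Fb u uL).
have inL u : t <= u -> u <= L -> (0 <= u <= L) && (0 <= u - t <= L).
  by move=> tu uL; rewrite (le_trans (ltW t0) tu) uL subr_ge0 tu lerBlDr ler_wpDr // ltW.
have shift u : t <= u -> u <= L -> `|f u + f (u - t)| <= C' * t + d.
  move=> tu uL; have /andP[uL' utL] := inL u tu uL.
  rewrite /f expi_shift // mulNr.
  have -> : complex.Re ((cos (u * x) +i* sin (u * x)) * F u) +
     complex.Re (- ((cos (u * x) +i* sin (u * x)) * F (u - t))) =
     complex.Re ((cos (u * x) +i* sin (u * x)) * (F u - F (u - t))).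
    by rewrite mulrBr cReB; case: (_ * F (u - t)).
  apply: le_trans (normr_Re_expi _ _) _; apply: le_trans (Fl _ _ uL' utL) _.
  by rewrite subKr (gtr0_norm t0).
(* [2 (P L - P 0)] is the sum of the three increments bounded in [h1], [h2] and [h3]; the last two
   concern intervals of length [t] and need only the size of [f]. *)
have h1 : `|P L + P (L - t) - (P t + P (t - t))| <= (C' * t + d) * (L - t).
  have dQ u : is_derive u 1 (fun u => P u + P (u - t)) (f u + f (u - t)).
    apply: is_deriveD.
    have hs : is_derive u 1 (fun u => u - t) 1.
      by apply: is_derive_eq; rewrite subr0.
    by have := @is_derive1_comp R P (fun u => u - t) u _ _ (dP (u - t)) hs; rewrite mulr1.
  apply: (mean_value_le tL dQ) => u /andP[tu uL]; exact: shift.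
have h2 : `|P L - P (L - t)| <= (C + 1) * (L - (L - t)).
  apply: (mean_value_le _ dP); first by rewrite lerBlDr lerDl ltW.
  move=> u /andP[u1 u2]; apply: fb; rewrite u2 andbT.
  by apply: le_trans u1; rewrite subr_ge0.
have h3 : `|P t - P 0| <= (C + 1) * (t - 0).
  apply: (mean_value_le (ltW t0) dP) => u /andP[u1 u2]; apply: fb.
  by rewrite u1 (le_trans u2).
have -> : \sum_(1 <= n < N.+1) mobius_sum R n * fejer_weight e n * fejer L (x - ln n%:R)
    = P L - P 0.
  rewrite /P -sumrB; apply: eq_bigr => n _.
  by rewrite -mulrBr fejer_primitiveB.
rewrite subrr in h1; rewrite subr0 in h3; rewrite subKr in h2.
have h4 : (C' * t + d) * (L - t) <= (C' * t + d) * L.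
  by rewrite ler_wpM2l ?gerBl ?ltW // ltr_wpDl // mulr_ge0 // ltW.
have h5 : K * t = C' * t * L + 2 * ((C + 1) * t) by rewrite /K; ring.
move: h1 h2 h3; rewrite !ler_norml => /andP[a1 a2] /andP[b1 b2] /andP[c1 c2].
apply/andP; split; lra.
Qed.

End FejerSum.

(** * From weighted averages to the values [A n] *)

Section MobiusSumVanishes.
Variable R : realType.
Implicit Types (n m N : nat) (x y L : R).

Lemma ln_nat_floor y : 0 <= y ->
  exists2 n, (0 < n)%N & ln n%:R <= y < ln n.+1%:R.
Proof.
move=> y0; have E0 := expR_gt0 y; have /andP[h1 h2] := truncn_itv (ltW E0).
have n0 : (0 < Num.truncn (expR y))%N.
  rewrite lt0n; apply: contraTneq h2 => ->.
  by rewrite -leNgt -expR0 ler_expR.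
exists (Num.truncn (expR y)) => //.
rewrite -{2 3}(expRK y) ler_ln ?posrE ?ltr0n // h1 /=.
by rewrite ltr_ln ?posrE ?ltr0n.
Qed.

Lemma lt_ln_nat m n : (0 < m)%N -> ln (m%:R : R) < ln n%:R -> (m < n)%N.
Proof.
move=> m0; case: n => [|n]; first by rewrite (ln0 (lexx 0)) ltNge ln_nat_ge0.
by rewrite ltr_ln ?posrE ?ltr0n // ltr_nat.
Qed.

Lemma ler_ln_nat m n : (0 < m)%N -> (m <= n)%N -> ln (m%:R : R) <= ln n%:R.
Proof.
by move=> m0 mn; rewrite ler_ln ?posrE ?ltr0n ?ler_nat // (leq_trans m0).
Qed.

Lemma ln_natS_le n : (0 < n)%N -> ln (n.+1%:R : R) <= ln n%:R + n%:R^-1.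
Proof. by move=> n0; rewrite -lerBlDl lnstep_le. Qed.

Lemma ln_natS_ge n : (0 < n)%N -> ln n%:R + n.+1%:R^-1 <= ln (n.+1%:R : R).
Proof. by move=> n0; rewrite -lerBrDl lnstep_ge. Qed.

Lemma mobius_sum_lip_le m n : (0 < m)%N -> (m <= n)%N ->
  `|mobius_sum R n - mobius_sum R m| <= ln n%:R - ln m%:R.
Proof.
move=> m0; elim: n => [|n IH]; first by rewrite leqn0 => /eqP m0'; rewrite m0' in m0.
rewrite leq_eqVlt => /predU1P[->|]; first by rewrite !subrr normr0.
rewrite ltnS => mn; have n0 : (0 < n)%N by apply: leq_trans mn.
rewrite mobius_sumS addrAC; apply: le_trans (ler_normD _ _) _.
have h1 := IH mn; have h2 := ln_natS_ge n0.
have h3 : `|(mobius n.+1)%:~R / n.+1%:R : R| <= n.+1%:R^-1.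
  by rewrite normrM normfV normr_nat ler_piMl ?invr_ge0 ?normr_mobiusR.
by apply: le_trans (lerD h1 h3) _; rewrite addrAC lerD2r.
Qed.

Lemma mobius_sum_lip m n : (0 < m)%N -> (0 < n)%N ->
  `|mobius_sum R n - mobius_sum R m| <= `|ln n%:R - ln m%:R|.
Proof.
move=> m0 n0; have [mn|/ltnW nm] := leqP m n.
  by apply: le_trans (mobius_sum_lip_le m0 mn) (ler_norm _).
rewrite distrC [leRHS]distrC.
by apply: le_trans (mobius_sum_lip_le n0 nm) (ler_norm _).
Qed.

(** Comparison with the integral of [(x - v)^(-2)] over [v = ln n]. The factor 2 pays for
    [1 / n <= 2 / (n+1) <= 2 lnstep n], since [1 / n] is larger than the step to its right. *)
Lemma sum_below x k : (0 < k)%N -> ln k%:R < x ->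
  \sum_(1 <= n < k) n%:R^-1 / (x - ln n%:R) ^+ 2 <= 2 / (x - ln k%:R) :> R.
Proof.
case: k => // k _; elim: k => [|k IH] kx.
  by rewrite big_geq // divr_ge0 // subr_ge0 ltW.
have k0 : (0 < k.+1)%N by [].
have kx' : ln k.+1%:R < x by apply: le_lt_trans kx; apply: ler_ln_nat.
rewrite big_nat_recr //=; apply: le_trans (lerD (IH kx') (lexx _)) _.
have h1 := ln_natS_ge k0; have h3 : 0 <= k.+1%:R^-1 :> R by rewrite invr_ge0.
have h2 : k.+1%:R^-1 <= 2 * k.+2%:R^-1 :> R.
  rewrite -ler_pdivrMl // mulrC -invfM lef_pV2 ?posrE ?ltr0n ?mulr_gt0 ?ltr0n //.
  by rewrite -natrM ler_nat; lia.
move: (k.+1%:R^-1) (k.+2%:R^-1) (ln k.+1%:R) (ln k.+2%:R) kx kx' h1 h2 h3 => p q a b bx ax ab pq p0.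
have A0 : 0 < x - a by rewrite subr_gt0.
have B0 : 0 < x - b by rewrite subr_gt0.
rewrite -lerBrDl.
have -> : 2 / (x - b) - 2 / (x - a) = 2 * (b - a) / ((x - a) * (x - b)).
  by field; rewrite !gt_eqF.
apply: ler_pM; rewrite ?invr_ge0 ?sqr_ge0 //; try lra.
rewrite lef_pV2 ?posrE ?exprn_gt0 ?mulr_gt0 // expr2 ler_pM2l //.
lra.
Qed.

(** Beyond [x] the integrand decreases and [1 / n] is at most the step to the left of [ln n], so no
    factor is lost. *)
Lemma sum_above x k N : (0 < k)%N -> x < ln k%:R -> (k <= N)%N ->
  \sum_(k.+1 <= n < N.+1) n%:R^-1 / (x - ln n%:R) ^+ 2 <= (ln k%:R - x)^-1 :> R.
Proof.
move=> k0 kx kN.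
suff : \sum_(k.+1 <= n < N.+1) n%:R^-1 / (x - ln n%:R) ^+ 2 <=
    (ln k%:R - x)^-1 - (ln N%:R - x)^-1 :> R.
  move/le_trans; apply; rewrite gerBl invr_ge0 subr_ge0.
  by apply: le_trans (ltW kx) _; apply: ler_ln_nat.
elim: N kN => [|N IH]; first by rewrite leqn0 => /eqP k0'; rewrite k0' in k0.
rewrite leq_eqVlt => /predU1P[->|]; first by rewrite big_geq // subrr.
rewrite ltnS => kN; have N0 : (0 < N)%N by apply: leq_trans kN.
rewrite big_nat_recr //=; apply: le_trans (lerD (IH kN) (lexx _)) _.
have h1 := ln_natS_ge N0.
have h2 : x < ln N%:R by apply: lt_le_trans kx _; apply: ler_ln_nat.
have h3 : 0 < N.+1%:R^-1 :> R by rewrite invr_gt0 ltr0n.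
rewrite -addrA lerD2l.
move: (N.+1%:R^-1) (ln N%:R) (ln N.+1%:R) h1 h2 h3 => p a b ab ax p0.
have A0 : 0 < a - x by rewrite subr_gt0.
have B0 : 0 < b - x by lra.
rewrite -lerBrDl opprK [leRHS]addrC.
have -> : (a - x)^-1 - (b - x)^-1 = (b - a) / ((a - x) * (b - x)).
  by field; rewrite !gt_eqF.
rewrite -(sqrrN (x - b)) opprB.
apply: ler_pM; rewrite ?invr_ge0 ?sqr_ge0 //; try lra.
rewrite lef_pV2 ?posrE ?exprn_gt0 ?mulr_gt0 // expr2 ler_pM2r //; lra.
Qed.

Lemma fejer_ge0 L y : 0 < L -> 0 <= fejer L y.
Proof.
move=> L0; rewrite /fejer divr_ge0 ?subr_ge0 ?cos_le1 // mulr_ge0 ?sqr_ge0 //.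
exact: ltW.
Qed.

Lemma fejer_le L y : 0 < L -> fejer L y <= 2 / L / y ^+ 2.
Proof.
move=> L0; rewrite /fejer -mulrA -invfM; apply: ler_wpM2r.
  by rewrite invr_ge0 mulr_ge0 ?sqr_ge0 // ltW.
by have := cos_geN1 (L * y); lra.
Qed.

(** For [|z| <= 1] one has [|sin (z / 2)| >= |z| / 4], hence [1 - cos z >= z^2 / 8]; take
    [z = L y]. *)
Lemma fejer_ge L y : 0 < L -> y != 0 -> `|L * y| <= 1 -> L / 8 <= fejer L y.
Proof.
move=> L0 y0 Ly; rewrite /fejer cos_double_half opprB addrC subrK.
set z := L * y in Ly *.
have hz : `|z / 2| / 2 <= `|sin (z / 2)|.
  have h := sin_sub_le (z / 2).
  have h' : (z / 2) ^+ 2 <= `|z / 2| / 2.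
    rewrite -(real_normK (num_real (z / 2))) normrM (ger0_norm (_ : 0 <= 2^-1)) ?invr_ge0 //.
    by have := normr_ge0 z; nra.
  have := ler_normB (sin (z / 2)) (sin (z / 2) - z / 2).
  by rewrite opprB addrC subrK; lra.
have hz2 : z ^+ 2 / 8 <= 2 * sin (z / 2) ^+ 2.
  rewrite -(real_normK (num_real (sin _))) -(real_normK (num_real z)).
  move: hz; rewrite normrM (ger0_norm (_ : 0 <= 2^-1)) ?invr_ge0 //.
  by have := normr_ge0 z; nra.
have D0 : 0 < L * y ^+ 2 by rewrite mulr_gt0 // exprn_even_gt0.
rewrite ler_pdivlMr //.
apply: le_trans hz2; rewrite /z le_eqVlt; apply/orP; left; apply/eqP; ring.
Qed.

Lemma sum_inv_ge m n : (0 < m)%N -> (m <= n)%N ->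
  ln n%:R - ln m%:R <= \sum_(m <= k < n) k%:R^-1 :> R.
Proof.
move=> m0; elim: n => [|n IH]; first by rewrite leqn0 => /eqP m0'; rewrite m0' in m0.
rewrite leq_eqVlt => /predU1P[->|]; first by rewrite big_geq // subrr.
rewrite ltnS => mn; rewrite big_nat_recr //=.
have := ln_natS_le (leq_trans m0 mn); have := IH mn.
by move: (n%:R^-1) => r; lra.
Qed.

Definition window_weight L x n : R := fejer_weight x^-1 n * fejer L (x - ln n%:R).

Lemma window_weight_ge0 L x n : 0 < L -> 0 <= window_weight L x n.
Proof.
move=> L0; rewrite /window_weight mulr_ge0 ?fejer_ge0 //.
by rewrite divr_ge0 // expR_ge0.
Qed.

Lemma window_weight_le L x n : 0 < L -> 0 < x ->
  window_weight L x n <= 2 / L * (n%:R^-1 / (x - ln n%:R) ^+ 2).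
Proof.
move=> L0 x0; rewrite [leRHS]mulrCA.
apply: ler_pM; [by rewrite divr_ge0 // expR_ge0|exact: fejer_ge0| |exact: fejer_le].
by rewrite /fejer_weight ler_piMl ?invr_ge0 // rpow_le1 // invr_ge0 ltW.
Qed.

Lemma sum_weight_below L x (d : R) k : 0 < L -> 0 < x -> 0 < d -> (0 < k)%N ->
  ln k%:R <= x - d / 2 ->
  \sum_(1 <= n < k) window_weight L x n <= 2 / L * (4 / d).
Proof.
move=> L0 x0 d0 k0 kx.
apply: le_trans (ler_sum _ (fun n _ => window_weight_le n L0 x0)) _.
rewrite -mulr_sumr ler_pM2l ?divr_gt0 //.
apply: le_trans (sum_below k0 _) _; first lra.
have -> : 4 / d = 2 / (d / 2) by field; rewrite gt_eqF.
by rewrite ler_pM2l // lef_pV2 ?posrE ?subr_gt0 ?divr_gt0 //; lra.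
Qed.

Lemma sum_weight_above L x (d : R) k N : 0 < L -> 0 < x -> 0 < d -> (0 < k)%N ->
  x + d / 2 <= ln k%:R -> (k <= N)%N ->
  \sum_(k.+1 <= n < N.+1) window_weight L x n <= 2 / L * (2 / d).
Proof.
move=> L0 x0 d0 k0 kx kN.
apply: le_trans (ler_sum _ (fun n _ => window_weight_le n L0 x0)) _.
rewrite -mulr_sumr ler_pM2l ?divr_gt0 //.
apply: le_trans (sum_above k0 _ kN) _; first lra.
by rewrite -(invf_div d) lef_pV2 ?posrE ?divr_gt0 ?subr_gt0 //; lra.
Qed.

(** For [x < ln n <= x + 1 / L] the damping is at least [exp (-2)], as [ln n <= 2 x], and the kernel
    at least [L / 8]; the sum of [1 / n] is at least [1 / L - 1 / m >= 1 / (2 L)]. The product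
    depends on neither [L] nor [x]. *)
Lemma sum_weight_near L x m j : 1 <= L -> 1 <= x -> (forall n, x != ln n%:R) ->
  (0 < m)%N -> (m <= j)%N -> 2 * L <= m%:R -> ln m%:R < x -> x < ln m.+1%:R ->
  ln j%:R <= x + L^-1 -> x + L^-1 < ln j.+1%:R ->
  expR (- 2) / 16 <= \sum_(m.+1 <= n < j.+1) window_weight L x n.
Proof.
move=> L1 x1 xln m0 mj mL mx xm jx xj.
have L0 : 0 < L by lra.
have x0 : 0 < x by lra.
have e0 := expR_ge0 (- 2 : R).
apply: le_trans (_ : \sum_(m.+1 <= n < j.+1) (expR (- 2) * (L / 8)) * n%:R^-1 <= _).
  rewrite -mulr_sumr.
  apply: le_trans (_ : expR (- 2) * (L / 8) * (2 * L)^-1 <= _).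
    by rewrite le_eqVlt; apply/orP; left; apply/eqP; field; rewrite gt_eqF.
  apply: ler_wpM2l; first by rewrite mulr_ge0 // divr_ge0 // ltW.
  apply: le_trans (sum_inv_ge _ _) => //.
  have m0R : (0 : R) < m%:R by rewrite ltr0n.
  have h1 := ln_natS_le m0.
  have h2 : m%:R^-1 <= (2 * L)^-1 by rewrite lef_pV2 ?posrE ?mulr_gt0.
  have h3 : L^-1 = (2 * L)^-1 + (2 * L)^-1 by field; rewrite gt_eqF.
  rewrite h3 in xj.
  move: (m%:R^-1) ((2 * L)^-1) h1 h2 xj => p q h1 h2 xj.
  by move: (ln j.+1%:R) (ln m.+1%:R) (ln m%:R) xj h1 mx => A B C *; lra.
apply: ler_sum_nat => n /andP[mn nj].
have n0 : (0 < n)%N by apply: leq_trans mn.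
have l1 := @ler_ln_nat m.+1 n (ltn0Sn _) mn.
have l2 := @ler_ln_nat n j n0 nj.
have Li : L^-1 <= 1 by rewrite invf_le1.
rewrite /window_weight /fejer_weight mulrAC; apply: ler_pM.
- by rewrite mulr_ge0 // invr_ge0.
- by rewrite divr_ge0 // ltW.
- rewrite ler_wpM2r ?invr_ge0 // ler_expR mulNr lerN2 mulrC ler_pdivrMr //.
  by move: (ln n%:R) (ln j%:R) (L^-1) l2 jx Li => A B C *; lra.
apply: fejer_ge => //; first by rewrite subr_eq0.
rewrite normrM (gtr0_norm L0) -ler_pdivlMl // mulr1 ler_norml.
move: (ln n%:R) (ln j%:R) (ln m.+1%:R) (L^-1) l1 l2 jx xm => A B C q *.
by apply/andP; split; lra.
Qed.

(** The outer ranges use only [B >= -1], the middle range uses [B >= b], and the two ranges between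
    them are dropped as nonnegative. *)
Lemma window_sum_ge (B w : nat -> R) (b : R) k1 m1 m2 k2 N :
  (1 <= k1 <= m1)%N -> (m1 <= m2)%N -> (m2 <= k2)%N -> (k2 <= N)%N -> 0 <= b ->
  (forall n, 0 <= w n) -> (forall n, - 1 <= B n) ->
  (forall n, (k1 <= n < k2)%N -> b <= B n) ->
  b * \sum_(m1 <= n < m2) w n - \sum_(1 <= n < k1) w n - \sum_(k2 <= n < N) w n
    <= \sum_(1 <= n < N) B n * w n.
Proof.
move=> /andP[k1p k1m] mm mk kN b0 w0 B1 Bb.
have neg a c : - \sum_(a <= n < c) w n <= \sum_(a <= n < c) B n * w n.
  rewrite -sumrN; apply: ler_sum => n _; rewrite -mulN1r; exact: ler_wpM2r.
have pos a c : (k1 <= a)%N -> (c <= k2)%N ->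
    b * \sum_(a <= n < c) w n <= \sum_(a <= n < c) B n * w n.
  move=> ka ck; rewrite mulr_sumr; apply: ler_sum_nat => n /andP[an nc].
  by apply: ler_wpM2r => //; apply: Bb; rewrite (leq_trans ka an) (leq_trans nc ck).
have ge0 a c : 0 <= b * \sum_(a <= n < c) w n by rewrite mulr_ge0 // sumr_ge0.
rewrite (@big_cat_nat _ _ _ k1 1 N) //=;
  last by rewrite (leq_trans k1m) // (leq_trans mm) // (leq_trans mk).
rewrite (@big_cat_nat _ _ _ m1 k1 N) //=; last by rewrite (leq_trans mm) // (leq_trans mk).
rewrite (@big_cat_nat _ _ _ m2 m1 N) //=; last by rewrite (leq_trans mk).
rewrite (@big_cat_nat _ _ _ k2 m2 N) //=.
have h1 := neg 1%N k1; have h2 := neg k2 N.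
have h3 := le_trans (ge0 k1 m1) (pos k1 m1 (leqnn _) (leq_trans mm mk)).
have h4 := pos m1 m2 k1m mk.
have h5 := le_trans (ge0 m2 k2) (pos m2 k2 (leq_trans k1m mm) (leqnn _)).
lra.
Qed.

(** [k1], [k2] and [j] are the integer parts of [exp (x - d/2)], [exp (x + d/2)] and
    [exp (x + 1/L)]. Rounding moves a logarithm by at most [1 / k1 <= d / 2], by the hypothesis
    [2 / d + d / 2 <= x]; hence the radius [d]. *)
Lemma window_exists L x (d : R) m : 0 < d -> 0 < L -> d <= x -> 2 / d + d / 2 <= x ->
  2 / d <= L -> (0 < m)%N -> ln m%:R < x -> x < ln m.+1%:R ->
  exists k1 k2 j, [/\ (0 < k1 <= m)%N, (m <= j <= k2)%N,
    ln k1%:R <= x - d / 2 /\ x + d / 2 <= ln k2.+1%:R,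
    ln j%:R <= x + L^-1 /\ x + L^-1 < ln j.+1%:R &
    forall n, (k1 <= n < k2.+2)%N -> `|ln n%:R - x| <= d].
Proof.
move=> d0 L0 dx x2d L2 m0 mx xm.
have Li0 : 0 < L^-1 by rewrite invr_gt0.
have Ld : L^-1 <= d / 2.
  by rewrite -(invrK (d / 2)) lef_pV2 ?posrE ?invr_gt0 ?divr_gt0 // invf_div.
have [|k1 k10 /andP[k1x xk1]] := @ln_nat_floor (x - d / 2); first lra.
have [|k2 k20 /andP[k2x xk2]] := @ln_nat_floor (x + d / 2); first lra.
have [|j j0 /andP[jx xj]] := @ln_nat_floor (x + L^-1); first lra.
have k1inv : k1%:R^-1 <= d / 2.
  rewrite -(invrK (d / 2)) lef_pV2 ?posrE ?invr_gt0 ?divr_gt0 ?ltr0n // invf_div.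
  have : x - d / 2 + 1 <= k1.+1%:R.
    apply: le_trans (_ : expR (x - d / 2) <= _).
      by have := expR_ge1Dx (x - d / 2); rewrite addrC.
    by rewrite -(@lnK _ k1.+1%:R) ?posrE ?ltr0n // ler_expR ltW.
  rewrite -(natr1 k1) lerD2r; apply: le_trans.
  by rewrite lerBrDr.
have k12 : (k1 <= k2)%N.
  by rewrite -ltnS; apply: lt_ln_nat => //; apply: le_lt_trans k1x _; lra.
have k2inv : k2%:R^-1 <= d / 2.
  by apply: le_trans k1inv; rewrite lef_pV2 ?posrE ?ltr0n // ler_nat.
exists k1, k2, j; split.
- by rewrite k10 -ltnS; apply: lt_ln_nat => //; apply: le_lt_trans k1x _; lra.
- apply/andP; split; rewrite -ltnS; apply: lt_ln_nat => //; first lra.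
  by apply: le_lt_trans jx _; lra.
- by rewrite k1x ltW.
- by [].
move=> n /andP[kn nk]; have n0 : (0 < n)%N by apply: leq_trans kn.
have l1 := @ler_ln_nat k1 n k10 kn; have l2 := @ler_ln_nat n k2.+1 n0 nk.
have h1 := ln_natS_le k10; have h2 := ln_natS_le k20.
move: (k1%:R^-1) (k2%:R^-1) (ln k1%:R) (ln k2%:R) (ln k1.+1%:R) (ln k2.+1%:R) (ln n%:R)
  k1inv k2inv k2x xk1 l1 l2 h1 h2 => p q a b a' b' c *.
by rewrite ler_norml; apply/andP; split; lra.
Qed.

(* If [|A n0| >= a] with [x ~ ln n0] large, then [A n] keeps its sign and stays
   of size [a / 2] for [|ln n - x| <= a / 4], and the weights of [fejer_sum_small]
   concentrate on such [n] when [L] is large compared to [1 / a^2]. *)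
Lemma mobius_sum_cvg0 (a : R) : 0 < a ->
  exists N0, forall n, (N0 <= n)%N -> `|mobius_sum R n| <= a.
Proof.
move=> a0.
have [d d0 ad] : exists2 d, 0 < d & a = 4 * d.
  by exists (a / 4); [rewrite divr_gt0|rewrite mulrC divfK].
have [c c0 cE] : exists2 c : R, 0 < c & c = expR (- 2) / 16.
  by exists (expR (- 2) / 16); rewrite // divr_gt0 ?expR_gt0.
have ac0 : 0 < a / 2 * c / 2 by rewrite !(divr_gt0, mulr_gt0).
have d20 : 0 < 2 / d by rewrite divr_gt0.
(* The near terms will give at least [(a/2) c], and the last condition on [L] bounds the far ones,
   [12 / (d L)], by [(a/2) c / 2]. This contradicts [fejer_sum_small] taken with
   [k = (a/2) c / 4]. *)
have [L [L0 L1 L2 L3]] : exists L,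
    [/\ 0 < L, 1 <= L, 2 / d <= L & 12 / d / (a / 2 * c / 2) <= L].
  exists (1 + 2 / d + 12 / d / (a / 2 * c / 2)).
  have h2 : 0 < 12 / d / (a / 2 * c / 2) by rewrite divr_gt0 // divr_gt0.
  by move: (2 / d) (12 / d / _) d20 h2 => p q *; split; lra.
have k0 : 0 < a / 2 * c / 4 by rewrite !(divr_gt0, mulr_gt0).
have [X X0 hX] := fejer_sum_small L0 k0.
have [X' [XX' X1 Xd X2d]] : exists X',
    [/\ X <= X', 1 <= X', d <= X' & 2 / d + d / 2 <= X'].
  exists (X + 1 + d + 2 / d).
  by move: (2 / d) d20 => p p0; split; lra.
exists (Num.bound (expR X' + 2 * L + d^-1)).+1 => n0 hn0.
rewrite leNgt; apply/negP => an0.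
have [nX nL nd] : [/\ expR X' <= n0%:R, 2 * L <= n0%:R & d^-1 <= n0%:R].
  have d'0 : 0 < d^-1 by rewrite invr_gt0.
  have E0 := expR_gt0 X'; have P0 : 0 <= expR X' + 2 * L + d^-1.
    by rewrite !addr_ge0 ?mulr_ge0 // ltW.
  have nb : expR X' + 2 * L + d^-1 <= n0%:R.
    by apply/ltW/(lt_le_trans (archi_boundP P0)); rewrite ler_nat ltnW.
  move: (expR X') (d^-1) nb d'0 E0 => p q nb q0 p0.
  by split; apply: le_trans nb; lra.
have n0R : (0 : R) < n0%:R by apply: lt_le_trans nX; apply: expR_gt0.
have n0p : (0 < n0)%N by move: n0R; rewrite ltr0n.
(* Strictly between two consecutive logarithms, so that [x] differs from every [ln n], as
   [fejer_sum_small] demands. *)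
have [x nx xn1] : exists2 x : R, ln n0%:R < x & x < ln n0.+1%:R.
  exists (ln (n0%:R + 2^-1)).
    by rewrite ltr_ln ?posrE ?addr_gt0 // ltrDl invr_gt0.
  by rewrite ltr_ln ?posrE ?addr_gt0 // -(natr1 n0) ltrD2l invf_lt1 // ltr1n.
have xX' : X' <= x.
  by apply: le_trans (ltW nx); rewrite -(expRK X') ler_ln ?posrE ?expR_gt0.
have [xX x1 xd x2d] : [/\ X <= x, 1 <= x, d <= x & 2 / d + d / 2 <= x].
  by split; apply: le_trans xX'.
have x0 : 0 < x by apply: lt_le_trans x1.
have xln n : x != ln n%:R.
  apply/eqP => xE; rewrite xE in nx xn1 x0.
  have n1 : (0 < n)%N by case: n x0 {xE nx xn1} => // ; rewrite ln0 ?ltxx.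
  by have := lt_ln_nat n1 xn1; rewrite ltnS leqNgt (lt_ln_nat n0p nx).
have [N1 hN1] := hX x xX xln.
have [k1 [k2 [j [/andP[k10 k1n] /andP[nj jk2] [k1x xk2] [jx xj] near]]]] :=
  window_exists d0 L0 xd x2d L2 n0p nx xn1.
pose sg : R := Num.sg (mobius_sum R n0).
have sgA : sg * mobius_sum R n0 = `|mobius_sum R n0| by rewrite normrEsg.
have sg1 : `|sg| <= 1 by rewrite /sg normr_sg; case: (_ != 0).
clearbody sg; pose B n := sg * mobius_sum R n.
have B1 n : - 1 <= B n.
  have : `|B n| <= 1 by rewrite normrM mulr_ile1 // normr_mobius_sum.
  by rewrite ler_norml => /andP[].
have Bnear n : (k1 <= n < k2.+2)%N -> a / 2 <= B n.
  move=> kn; have np : (0 < n)%N by apply: leq_trans k10 _; case/andP: kn.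
  have : `|B n - B n0| <= d + d.
    rewrite /B -mulrBr normrM; apply: le_trans (ler_piMl (normr_ge0 _) sg1) _.
    apply: le_trans (mobius_sum_lip n0p np) _.
    rewrite -(subrKA x); apply: le_trans (ler_normD _ _) (lerD (near n kn) _).
    by rewrite distrC near // k1n ltnS leqW // (leq_trans nj jk2).
  rewrite ler_norml => /andP[h _]; rewrite {2}/B sgA in h.
  move: (B n) (`|mobius_sum R n0|) an0 h => p q; rewrite ad; lra.
pose N := maxn N1 k2.+1.
have hN : \sum_(1 <= n < N.+1) B n * window_weight L x n <= a / 2 * c / 4.
  apply: le_trans (hN1 N (leq_maxl _ _)); apply: le_trans (ler_norm _) _.
  rewrite (_ : \sum_(_ <= _ < _) _ = sg * \sum_(1 <= n < N.+1)
    mobius_sum R n * fejer_weight x^-1 n * fejer L (x - ln n%:R)).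
    by rewrite normrM ler_piMl.
  by rewrite mulr_sumr; apply: eq_bigr => n _; rewrite /B /window_weight !mulrA.
have a20 : 0 <= a / 2 by rewrite divr_ge0 // ltW.
have kN : (k2.+2 <= N.+1)%N by rewrite ltnS leq_maxr.
have S0 := @window_sum_ge B (window_weight L x) (a / 2) k1 n0.+1 j.+1 k2.+2 N.+1
  (introT andP (conj k10 (leqW k1n))) nj (leqW jk2) kN a20
  (fun n => window_weight_ge0 x n L0) B1 Bnear.
have S1 := sum_weight_below L0 x0 d0 k10 k1x.
have S2 := @sum_weight_above L x d k2.+1 N L0 x0 d0 (ltn0Sn _) xk2 kN.
have S3 := sum_weight_near L1 x1 xln n0p nj nL nx xn1 jx xj.
rewrite -cE in S3.
have far : 2 / L * (4 / d) + 2 / L * (2 / d) <= a / 2 * c / 2.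
  have -> : 2 / L * (4 / d) + 2 / L * (2 / d) = 12 / d / L.
    by field; rewrite !gt_eqF.
  by rewrite ler_pdivrMr // [leRHS]mulrC -ler_pdivrMr.
have {}S3 := ler_wpM2l a20 S3.
have {S0} S0 := le_trans S0 hN.
move: S0 S1 S2 S3 far ac0; clear.
move: (\sum_(1 <= n < k1) _) (\sum_(n0.+1 <= n < j.+1) _) (\sum_(k2.+2 <= n < N.+1) _)
  (2 / L * (4 / d)) (2 / L * (2 / d)) => s1 s3 s5 p q.
by move: (a / 2 * c) (a / 2 * s3) => u v; lra.
Qed.

End MobiusSumVanishes.

(** * Branches of the logarithm *)

Section ComplexContinuity.
Variable R : realType.
Implicit Types (z w k : R[i]) (g : R[i] -> R[i]).

Lemma complex_gt0P (e : R[i]) : 0 < e -> exists2 r : R, 0 < r & e = r%:C.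
Proof.
case: e => a b; rewrite ltcE /= => /andP[/eqP -> a0]; by exists a.
Qed.

Lemma normC_lt1 z : (`|z| < 1) = (normc z < 1).
Proof. by rewrite normcE_Re -(ltcR (normc z)). Qed.

(** Continuity with real radii, which keeps the estimates in the ordered field [R]; [ccontP] links
    it to the topology of [R[i]^o]. *)
Definition ccont g z := forall e : R, 0 < e -> exists2 d : R, 0 < d &
  forall w, normc (w - z) < d -> normc (g w - g z) <= e.

Lemma ccontP g z :
  {for (z : R[i]^o), continuous (g : R[i]^o -> R[i]^o)} <-> ccont g z.
Proof.
split=> [h e e0|h].
  have e0' : 0 < e%:C :> R[i] by rewrite ltcR.
  have /cvgrPdistC_le/(_ _ e0')/nbhs_ballP[d d0 hd] := h.
  have [r r0 dE] := complex_gt0P d0.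
  exists r => // w wz; have := hd w.
  rewrite /ball /= dE normcE_Re ltcR (normcB z) => /(_ wz).
  by rewrite normcE_Re lecR.
apply/(@cvgrPdist_le _ _ _ (nbhs (z : R[i]^o))) => e /complex_gt0P[r r0 ->].
have [d d0 hd] := h r r0.
apply/nbhs_ballP; exists d%:C; first by rewrite /= ltcR.
move=> w; rewrite /ball /= !normcE_Re ltcR lecR normcB => /hd.
by rewrite normcB.
Qed.

Lemma ccontD g1 g2 z : ccont g1 z -> ccont g2 z -> ccont (fun w => g1 w + g2 w) z.
Proof.
move=> h1 h2 e e0; have e2 : 0 < e / 2 by rewrite divr_gt0.
have [d1 d10 H1] := h1 _ e2; have [d2 d20 H2] := h2 _ e2.
exists (Num.min d1 d2); first by rewrite lt_min d10.
move=> w; rewrite lt_min => /andP[/H1 k1 /H2 k2].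
rewrite (_ : g1 w + g2 w - _ = (g1 w - g1 z) + (g2 w - g2 z)); last by ring.
by apply: le_trans (le_normcD _ _) _; rewrite (splitr e) lerD.
Qed.

Lemma ccont_sum (I : Type) (r : seq I) (P : pred I) (G : I -> R[i] -> R[i]) z :
  (forall i, P i -> ccont (G i) z) -> ccont (fun w => \sum_(i <- r | P i) G i w) z.
Proof.
move=> h; elim: r => [|i r IH].
  by move=> e e0; exists 1 => // w _; rewrite !big_nil subrr normc0 ltW.
move=> e e0; case: (boolP (P i)) => Pi.
  have [d d0 H] := ccontD (h i Pi) IH e0.
  by exists d => // w /H; rewrite !big_cons Pi.
have [d d0 H] := IH e e0.
by exists d => // w /H; rewrite !big_cons (negbTE Pi).
Qed.

Lemma ccont_comp g1 g2 z : ccont g1 z -> ccont g2 (g1 z) -> ccont (g2 \o g1) z.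
Proof.
move=> h1 h2 e e0; have [d2 d20 H2] := h2 e e0.
have d22 : 0 < d2 / 2 by rewrite divr_gt0.
have [d1 d10 H1] := h1 _ d22; exists d1 => // w /H1 k.
by apply: H2; apply: le_lt_trans k _; rewrite ltr_pdivrMr // ltr_pMr // ltr1n.
Qed.

Lemma ccont_exp n z : ccont (fun w => w ^+ n) z.
Proof.
elim: n => [|n IH] e e0.
  by exists 1 => // w _; rewrite !expr0 subrr normc0 ltW.
have N0 : 0 < normc z + 1 by rewrite ltr_wpDl ?normc_ge0.
have Nn0 : 0 < (normc z + 1) ^+ n by rewrite exprn_gt0.
have e2 : 0 < e / 2 by rewrite divr_gt0.
have [d d0 H] := IH _ (divr_gt0 e2 N0).
exists (Num.min d (Num.min 1 (e / 2 / (normc z + 1) ^+ n))).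
  by rewrite !lt_min d0 ltr01 divr_gt0.
move=> w; rewrite !lt_min => /and3P[/H k1 w1 wd].
rewrite !exprS (_ : w * w ^+ n - z * z ^+ n =
  (w - z) * w ^+ n + z * (w ^+ n - z ^+ n)); last by ring.
apply: le_trans (le_normcD _ _) _; rewrite (splitr e); apply: lerD.
  rewrite (normcM (w - z)) normcX.
  apply: le_trans (_ : e / 2 / (normc z + 1) ^+ n * (normc z + 1) ^+ n <= _).
    have wz : normc w <= normc z + 1.
      by have := lerB_normc w z; move: (normc (w - z)) w1 => q; lra.
    apply: ler_pM; rewrite ?exprn_ge0 ?normc_ge0 //; first exact: ltW.
    by apply: lerXn2r; rewrite ?nnegrE ?normc_ge0 // ltW.
  by rewrite divfK // gt_eqF.
rewrite (normcM z); apply: le_trans (_ : (normc z + 1) * (e / 2 / (normc z + 1)) <= _).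
  by apply: ler_pM; rewrite ?normc_ge0 // lerDl.
by rewrite mulrC divfK // gt_eqF.
Qed.

Definition cderiv g z l := forall e : R, 0 < e -> exists2 d : R, 0 < d &
  forall h, h != 0 -> normc h < d -> normc ((g (z + h) - g z) / h - l) <= e.

Lemma cderiv_derivable g z l : cderiv g z l ->
  derivable (g : R[i]^o -> R[i]^o) z 1.
Proof.
move=> hg; apply/cvg_ex; exists l; apply/cvgrPdist_le => e /complex_gt0P[r r0 ->].
have [d d0 hd] := hg r r0.
apply/nbhs_ballP; exists d%:C; first by rewrite /= ltcR.
move=> h; rewrite /ball /= sub0r normrN normcE_Re ltcR => hlt hn.
have hn0 : h != 0 by apply/eqP => h0; rewrite h0 eqxx in hn.
rewrite normcE_Re lecR normcB /GRing.scale /= mulr1 mulrC (addrC h).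
exact: hd.
Qed.

End ComplexContinuity.

(** * The principal logarithm of [1 - w] and uniqueness of branches *)

Section ComplexLogarithm.
Variable R : realType.
Implicit Types (z w k : R[i]).

(** A constant for the second-order remainder of the exponential on the unit disk: [5 = 2 + 3] comes
    from the two bounds on [Re z <= 0], and [exp 1] bounds [|cexp k|]. *)
Definition expK : R := 5 * expR 1.

Lemma expK_ge1 : 1 <= expK.
Proof. by rewrite /expK; have := expR_ge1Dx (1 : R); lra. Qed.

Lemma cexp_sub1_lin_small k : normc k <= 1 ->
  normc (cexp k - 1 - k) <= expK * normc k ^+ 2.
Proof.
move=> k1; have k0 := normc_ge0 k; have K1 := expR_ge1Dx (1 : R).
have [re|re] := leP (complex.Re k) 0.
  apply: le_trans (cexp_sub1_lin_le re) _; rewrite ler_wpM2r ?sqr_ge0 //.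
  by rewrite /expK; lra.
have reN : complex.Re (- k) <= 0 by case: k {k1 k0} re => a b /= /ltW; rewrite oppr_le0.
(* Expressed through [- k], whose real part is nonpositive. *)
have -> : cexp k - 1 - k =
    - (cexp k * ((cexp (- k) - 1 - (- k)) + k * (cexp (- k) - 1))).
  rewrite cexpN; field; exact: cexp_neq0.
rewrite normcN (normcM (cexp k)) normc_cexp /expK mulrAC.
rewrite mulrC; apply: ler_pM; rewrite ?expR_ge0 ?normc_ge0 //; last first.
  by rewrite ler_expR (le_trans _ k1) // (le_trans (ler_norm _)) // normc_Re.
apply: le_trans (le_normcD _ _) _; rewrite (normcM k).
have h1 := cexp_sub1_lin_le reN; have h2 := cexp_sub1_le reN.
rewrite normcN in h1 h2.
by apply: le_trans (lerD h1 (ler_wpM2l k0 h2)) _; lra.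
Qed.

(** Stands in for the period [2 pi i]: uniqueness of branches only needs a disk around 0 free of
    other solutions of [cexp k = 1]. *)
Lemma cexp_eq1_small k : normc k < expK^-1 -> cexp k = 1 -> k = 0.
Proof.
move=> kK k1; have K1 := expK_ge1; have K0 : 0 < expK by lra.
have kle1 : normc k <= 1.
  by apply: le_trans (ltW kK) _; rewrite invf_le1.
have := cexp_sub1_lin_small kle1; rewrite k1 subrr sub0r normcN => h.
apply/eqP; rewrite -normc_eq0; apply/negPn/negP => kn.
have kp : 0 < normc k by rewrite lt0r kn normc_ge0.
move: h; rewrite expr2 mulrA ler_pMl // leNgt => /negP; apply.
by rewrite -ltr_pdivlMl // mulr1.
Qed.

Lemma cexp_sub1_ge k : normc k <= (2 * expK)^-1 -> normc k / 2 <= normc (cexp k - 1).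
Proof.
move=> kK; have K1 := expK_ge1; have K0 : 0 < expK by lra.
have kle1 : normc k <= 1.
  by apply: le_trans kK _; rewrite invf_le1 ?mulr_gt0 //; lra.
have h := cexp_sub1_lin_small kle1; have k0 := normc_ge0 k.
have h2 : expK * normc k ^+ 2 <= normc k / 2.
  have : expK * normc k <= 1 / 2.
    by move: kK; rewrite -(ler_pM2l K0) invfM mulrCA divff ?gt_eqF // mulr1 mul1r.
  by move: (expK) => K; nra.
have := lerB_normc k (- (cexp k - 1 - k)).
by rewrite normcN opprK addrCA subrr addr0; lra.
Qed.

(** On [|w| < 1] the real part of [1 - w] is positive, so the principal argument is the arctangent
    of the quotient. *)
Definition clog1m w : R[i] :=
  ln (normc (1 - w)) +i* atan (complex.Im (1 - w) / complex.Re (1 - w)).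

Lemma Re_1m_gt0 w : normc w < 1 -> 0 < complex.Re (1 - w).
Proof.
move=> w1; rewrite cReB /= subr_gt0; apply: le_lt_trans w1.
by apply: le_trans (normc_Re _); rewrite ler_norm.
Qed.

Lemma sub1_neq0 w : normc w < 1 -> 1 - w != 0.
Proof. by move=> /Re_1m_gt0; apply: contraTneq => ->; rewrite ltxx. Qed.

Lemma cexp_clog1m w : normc w < 1 -> cexp (clog1m w) = 1 - w.
Proof.
move=> w1; have x0 := Re_1m_gt0 w1; have n0 := sub1_neq0 w1.
rewrite /clog1m /cexp /= lnK; last by rewrite posrE normc_gt0.
move: (1 - w) x0 n0 => [x y] /= x0 _.
have q0 : 0 < 1 + (y / x) ^+ 2 by rewrite ltr_pwDl // sqr_ge0.
have nE : Num.sqrt (x ^+ 2 + y ^+ 2) = x * Num.sqrt (1 + (y / x) ^+ 2).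
  rewrite -{2}(gtr0_norm x0) -sqrtr_sqr -sqrtrM ?sqr_ge0 //; congr Num.sqrt.
  by field; rewrite gt_eqF.
have sn0 : Num.sqrt (1 + (y / x) ^+ 2) != 0 by rewrite gt_eqF // sqrtr_gt0.
have sE : sin (atan (y / x)) = y / x * cos (atan (y / x)).
  rewrite -{2}(atanK (y / x)) /tan divfK // cos_atan invr_neq0 //.
rewrite sE cos_atan nE; move: (Num.sqrt _) sn0 => S sn0.
apply/eqP; rewrite eq_complex /=; apply/andP; split; apply/eqP; field.
  by rewrite ?sn0 ?gt_eqF.
by rewrite sn0 gt_eqF.
Qed.

Lemma clog1m0 : clog1m 0 = 0.
Proof. by rewrite /clog1m subr0 normc1 ln1 /= mul0r atan0. Qed.

Lemma clog1m_cont w : normc w < 1 -> ccont clog1m w.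
Proof.
move=> w1; have x0 := Re_1m_gt0 w1; have n0 := sub1_neq0 w1.
have lipcont (f : R[i] -> R) : (forall u v, `|f u - f v| <= normc (u - v)) ->
    {for (w : R[i]^o), continuous (f : R[i]^o -> R)}.
  move=> h; apply/(@cvgrPdist_le _ _ _ (nbhs (w : R[i]^o))) => e e0.
  apply/nbhs_ballP; exists e%:C.
    by rewrite /= ltcR.
  move=> v; rewrite /ball /= normcE_Re ltcR => /ltW; exact: le_trans (h _ _).
have cN : {for (w : R[i]^o), continuous ((fun u => normc (1 - u)) : R[i]^o -> R)}.
  apply: lipcont => u v; rewrite normcB.
  have -> : v - u = (1 - u) - (1 - v) by ring.
  have h1 := lerB_normc (1 - u) (1 - v); have h2 := lerB_normc (1 - v) (1 - u).
  by rewrite normcB in h2; rewrite ler_norml; apply/andP; split; lra.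
have cR : {for (w : R[i]^o), continuous ((fun u => complex.Re (1 - u)) : R[i]^o -> R)}.
  apply: lipcont => u v; rewrite -cReB normcB.
  have -> : v - u = (1 - u) - (1 - v) by ring.
  exact: normc_Re.
have cI : {for (w : R[i]^o), continuous ((fun u => complex.Im (1 - u)) : R[i]^o -> R)}.
  apply: lipcont => u v; rewrite -cImB normcB.
  have -> : v - u = (1 - u) - (1 - v) by ring.
  exact: normc_Im.
have cA : {for (w : R[i]^o), continuous ((fun u => ln (normc (1 - u))) : R[i]^o -> R)}.
  apply: (@continuous_comp _ _ _ ((fun u => normc (1 - u)) : R[i]^o -> R) (@ln R)) => //.
  by apply: continuous_ln; rewrite normc_gt0.
have cB : {for (w : R[i]^o), continuous
    ((fun u => atan (complex.Im (1 - u) / complex.Re (1 - u))) : R[i]^o -> R)}.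
  apply: (@continuous_comp _ _ _
    ((fun u => complex.Im (1 - u) / complex.Re (1 - u)) : R[i]^o -> R) (@atan R)).
    have x1 : complex.Re (1 - w) != 0 by rewrite gt_eqF.
    exact: (cvgM cI (cvgV x1 cR)).
  exact: continuous_atan.
move=> e e0; have e2 : 0 < e / 2 by rewrite divr_gt0.
have /cvgrPdistC_le/(_ _ e2)/nbhs_ballP[d1 d10 H1] := cA.
have /cvgrPdistC_le/(_ _ e2)/nbhs_ballP[d2 d20 H2] := cB.
have [r1 r10 d1E] := complex_gt0P d10; have [r2 r20 d2E] := complex_gt0P d20.
exists (Num.min r1 r2); first by rewrite lt_min r10.
move=> v; rewrite lt_min normcB => /andP[v1 v2].
apply: le_trans (normc_le_ReIm _) _; rewrite cReB cImB /clog1m /= (splitr e).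
apply: lerD.
  by apply: H1; rewrite /ball /= d1E normcE_Re ltcR.
by apply: H2; rewrite /ball /= d2E normcE_Re ltcR.
Qed.

(** Derivative of an inverse function: the increment [k] of the logarithm is small by continuity,
    [h = - v (exp k - 1)], and [k / h + 1 / v = (exp k - 1 - k) / (v (exp k - 1))] is [O (|k|)]. *)
Lemma clog1m_deriv z : normc z < 1 -> cderiv clog1m z (- (1 - z)^-1).
Proof.
move=> z1 e e0; have n0 := sub1_neq0 z1; set v := 1 - z in n0 *.
have nv : 0 < normc v by rewrite normc_gt0.
have K1 := expK_ge1; have K0 : 0 < expK by lra.
pose eta := Num.min (2 * expK)^-1 (e * normc v / (2 * expK)).
have eta0 : 0 < eta.
  by rewrite lt_min invr_gt0 mulr_gt0 //= divr_gt0 ?mulr_gt0.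
have [d d0 hd] := clog1m_cont z1 eta0.
exists (Num.min d (1 - normc z)); first by rewrite lt_min d0 subr_gt0.
move=> h h0; rewrite lt_min => /andP[hd1 hd2].
have zh1 : normc (z + h) < 1.
  by apply: le_lt_trans (le_normcD _ _) _; rewrite -ltrBrDl.
set k := clog1m (z + h) - clog1m z.
have kE : cexp k = 1 - h / v.
  rewrite cexpB !cexp_clog1m // -/v; rewrite /v; field; exact: n0.
have keta : normc k <= eta by apply: hd; rewrite addrC addKr.
have k1 : normc k <= (2 * expK)^-1 by apply: le_trans keta _; rewrite ge_min lexx.
have k2 : normc k <= e * normc v / (2 * expK).
  by apply: le_trans keta _; rewrite ge_min lexx orbT.
have kle1 : normc k <= 1.
  by apply: le_trans k1 _; rewrite invf_le1 ?mulr_gt0 //; lra.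
have hE : h = - (v * (cexp k - 1)) by rewrite kE; field.
have ek0 : cexp k - 1 != 0.
  by apply: contraNneq h0 => ek; rewrite hE ek mulr0 oppr0.
have -> : k / h - - v^-1 = (cexp k - 1 - k) / (v * (cexp k - 1)).
  by rewrite {1}hE; field; rewrite n0 ek0.
rewrite (normcM (_ - k)) normcV (normcM v) ler_pdivrMr; last first.
  by rewrite mulr_gt0 // normc_gt0.
apply: le_trans (cexp_sub1_lin_small kle1) _.
have h1 := cexp_sub1_ge k1.
have k0 := normc_ge0 k.
apply: le_trans (_ : e * (normc v * (normc k / 2)) <= _); last first.
  by rewrite ler_pM2l // ler_pM2l.
move: k2; rewrite ler_pdivlMr ?mulr_gt0 //.
move: (normc k) k0 (normc v) => q q0 u; move: (expK) => K; nra.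
Qed.

Lemma clog1m_small : exists2 d : R, 0 < d &
  forall w, normc w < d -> normc (clog1m w) <= 2 * normc w.
Proof.
have K1 := expK_ge1; have K0 : 0 < expK by lra.
have e0 : 0 < (2 * expK)^-1 by rewrite invr_gt0 mulr_gt0.
have z1 : normc (0 : R[i]) < 1 by rewrite normc0.
have [d d0 hd] := clog1m_cont z1 e0.
exists (Num.min d 1); first by rewrite lt_min d0 ltr01.
move=> w; rewrite lt_min => /andP[wd w1].
have := hd w; rewrite subr0 clog1m0 subr0 => /(_ wd) /cexp_sub1_ge.
by rewrite cexp_clog1m // addrAC subrr add0r normcN; lra.
Qed.

(** Along the segment from 0 to [z] the distance between the branches starts at 0 and takes no value
    strictly between 0 and [1 / expK]; the intermediate value theorem keeps it at 0. *)
Lemma log_branch_unique (g1 g2 : R[i] -> R[i]) z :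
  (forall w, normc w < 1 -> ccont g1 w) -> (forall w, normc w < 1 -> ccont g2 w) ->
  (forall w, normc w < 1 -> cexp (g1 w) = cexp (g2 w)) -> g1 0 = g2 0 ->
  normc z < 1 -> g1 z = g2 z.
Proof.
move=> c1 c2 ge g0 z1; have K1 := expK_ge1; have K0 : 0 < expK by lra.
pose f (t : R) := normc (g1 (t%:C * z) - g2 (t%:C * z)).
have tz t : 0 <= t <= 1 -> normc (t%:C * z) < 1.
  case/andP => t0 t1; rewrite normcM normc_real_ge0 //.
  by apply: le_lt_trans z1; rewrite ler_piMl ?normc_ge0.
have fcont : {within `[0, 1], continuous f}.
  apply: continuous_in_subspaceT => t; rewrite inE /= in_itv /= => /tz tz1.
  apply/cvgrPdist_le => e e0; have e2 : 0 < e / 2 by rewrite divr_gt0.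
  have [d1 d10 H1] := c1 _ tz1 _ e2; have [d2 d20 H2] := c2 _ tz1 _ e2.
  have N0 : 0 < normc z + 1 by rewrite ltr_wpDl ?normc_ge0.
  apply/nbhs_ballP; exists (Num.min d1 d2 / (normc z + 1)).
    by rewrite /= divr_gt0 // lt_min d10.
  move=> s; rewrite /ball /= distrC => st.
  have : normc (s%:C * z - t%:C * z) < Num.min d1 d2.
    rewrite -mulrBl -rmorphB normcM normc_real.
    apply: le_lt_trans (_ : `|s - t| * (normc z + 1) < _).
      by rewrite ler_wpM2l // lerDl.
    by rewrite -ltr_pdivlMr.
  rewrite lt_min => /andP[/H1 k1 /H2 k2].
  rewrite /f; move: (s%:C * z) (t%:C * z) k1 k2 => a b k1 k2.
  apply: le_trans (_ : normc ((g1 b - g2 b) - (g1 a - g2 a)) <= _).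
    have h1 := lerB_normc (g1 b - g2 b) (g1 a - g2 a).
    have h2 := lerB_normc (g1 a - g2 a) (g1 b - g2 b).
    rewrite (normcB (g1 a - g2 a)) in h2.
    by rewrite ler_norml; apply/andP; split; lra.
  have -> : g1 b - g2 b - (g1 a - g2 a) = (g2 a - g2 b) - (g1 a - g1 b) by ring.
  by apply: le_trans (le_normcB _ _) _; rewrite (splitr e) lerD.
have gap t : 0 <= t <= 1 -> f t < expK^-1 -> f t = 0.
  move=> /tz tz1 /cexp_eq1_small h; rewrite /f h ?normc0 //.
  by rewrite cexpB ge // divff // cexp_neq0.
have f0 : f 0 = 0 by rewrite /f mul0r g0 subrr normc0.
have f1 : f 1 = 0.
  apply/eqP/negPn/negP => f1n.
  have Ki0 : 0 < expK^-1 by rewrite invr_gt0.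
  have f1K : expK^-1 <= f 1.
    by rewrite leNgt; apply: contra f1n => /gap -> //; rewrite ler01 lexx.
  have [|t] := @IVT R f 0 1 (expK^-1 / 2) ler01 fcont.
    rewrite f0 ge_min le_max; apply/andP; split; apply/orP; [left|right].
      by rewrite divr_ge0 // ltW.
    apply: le_trans f1K; rewrite ler_pdivrMr //. by rewrite ler_pMr // ler1n.
  rewrite in_itv /= => t01 ft; move: (gap t t01); rewrite ft.
  by move: (expK^-1) Ki0 => q q0 h; have := h _; lra.
by apply/eqP; rewrite -subr_eq0 -normc_eq0; move: f1; rewrite /f mul1r => ->.
Qed.

End ComplexLogarithm.

(** * Logarithms of cyclotomic polynomials *)

Section CyclotomicLog.
Variable R : realType.
Implicit Types (z w : R[i]) (n d k N : nat).

Lemma unity_root_polar n k : unity_root R n k =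
  cos (2 * pi * k%:R / n%:R) +i* sin (2 * pi * k%:R / n%:R).
Proof.
rewrite -cexp_im; congr cexp.
rewrite !rmorphM fmorphV !rmorph_nat /=; ring.
Qed.

Lemma normc_unity_root n k : normc (unity_root R n k) = 1.
Proof. by rewrite unity_root_polar /= cos2Dsin2 sqrtr1. Qed.

Lemma unity_root_neq1 n k : (0 < k < n)%N -> unity_root R n k != 1.
Proof.
case/andP => k0 kn; rewrite unity_root_polar eq_complex /= negb_and; apply/orP; left.
have nR : (0 : R) < n%:R by rewrite ltr0n (leq_ltn_trans _ kn).
rewrite cos_double_half; set t := _ / 2.
have tE : t = pi * (k%:R / n%:R) by rewrite /t; field; rewrite gt_eqF.
have t0 : 0 < t by rewrite tE mulr_gt0 ?pi_gt0 // divr_gt0 // ltr0n.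
have tpi : t < pi.
  by rewrite tE gtr_pMr ?pi_gt0 // ltr_pdivrMr // mul1r ltr_nat.
have s0 : 0 < sin t by apply: sin_gt0_pi; rewrite t0.
by rewrite lt_eqF // gtrBl mulr_gt0 // exprn_gt0.
Qed.

Lemma unity_root_prim n : (0 < n)%N -> n.-primitive_root (unity_root R n 1).
Proof.
move=> n0; rewrite /primitive_root_of_unity n0 /=; apply/forallP => i; apply/eqP.
rewrite unity_rootE unity_rootX; case: (i.+1 =P n) => [->|/eqP ni].
  by rewrite unity_rootn // eqxx.
by apply/negbTE/unity_root_neq1; rewrite /= ltn_neqAle ni; exact: ltn_ord.
Qed.

Lemma unity_root_div n d : (0 < n)%N -> (d %| n)%N ->
  unity_root R n 1 ^+ (n %/ d) = unity_root R d 1.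
Proof.
move=> n0 dn; have d0 := dvdn_gt0 n0 dn.
have q0 : (0 < n %/ d)%N by rewrite divn_gt0 // dvdn_leq.
rewrite unity_rootX /unity_root; congr cexp.
rewrite -{2}(divnK dn) natrM.
have dR : (d%:R : R[i]) != 0 by rewrite pnatr_eq0 -lt0n.
have qR : ((n %/ d)%:R : R[i]) != 0 by rewrite pnatr_eq0 -lt0n.
by field; rewrite dR qR.
Qed.

(** The factorization of [z^n - 1] into cyclotomic polynomials, with the sign absorbed by the factor
    [d = 1]. *)
Lemma prod_PhiHat n z : (0 < n)%N ->
  \prod_(d <- divisors n) PhiHat d z = 1 - z ^+ n.
Proof.
move=> n0; have := prod_cyclotomic (unity_root_prim n0).
rewrite (eq_big_seq (Phi R)) => [/(congr1 (fun p => p.[z]))|d]; last first.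
  rewrite -(dvdn_divisors d n0) => dn; rewrite /Phi; congr (cyclotomic _ d).
  exact: unity_root_div.
rewrite hornerD hornerN hornerC hornerXn horner_prod => E.
rewrite -opprB E (bigD1_seq 1%N) ?divisors_uniq ?divisor1 //=.
rewrite [in RHS](bigD1_seq 1%N) ?divisors_uniq ?divisor1 //=.
rewrite PhiHat1 mulNr; congr (- (_ * _)).
rewrite big_seq_cond [RHS]big_seq_cond; apply: eq_bigr => d /andP[dn d1].
apply: PhiHatE; rewrite ltn_neqAle eq_sym d1 /=.
by move: dn; rewrite -dvdn_divisors // => /(dvdn_gt0 n0).
Qed.

Lemma derivable_sum_seq (I : Type) (r : seq I) (P : pred I)
    (G : I -> R[i]^o -> R[i]^o) (z : R[i]^o) :
  (forall i, P i -> derivable (G i) z 1) ->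
  derivable (fun w : R[i]^o => \sum_(i <- r | P i) G i w : R[i]^o) z 1.
Proof.
move=> h; elim: r => [|i r IH].
  rewrite (_ : (fun _ => _) = cst (0 : R[i]^o)); first exact: derivable_cst.
  by apply/funext => w; rewrite big_nil.
case: (boolP (P i)) => Pi.
  rewrite (_ : (fun _ => _) = G i + (fun w : R[i]^o => \sum_(i <- r | P i) G i w : R[i]^o)).
    exact: (derivableD (h i Pi) IH).
  by apply/funext => w; rewrite big_cons Pi.
rewrite (_ : (fun _ => _) = (fun w : R[i]^o => \sum_(i <- r | P i) G i w : R[i]^o)) //.
by apply/funext => w; rewrite big_cons (negbTE Pi).
Qed.

Lemma normc_mul_unity_root z n k : normc (z * unity_root R n k) = normc z.
Proof. by rewrite normcM normc_unity_root mulr1. Qed.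

(** An explicit branch, available since roots of unity preserve [|z| < 1]. It shows that the choice
    made by [Log] is not the default value. *)
Lemma log_branch_PhiHat n : is_log_branch (@PhiHat R n)
  (fun z => \sum_(1 <= k < n.+1 | coprime k n) clog1m (z * unity_root R n k)).
Proof.
split=> [z|z|].
- rewrite normC_lt1 => z1; apply: derivable_sum_seq => k _.
  apply: (@cderiv_derivable R _ z (- (1 - z * unity_root R n k)^-1 * unity_root R n k)).
  move=> e e0; set c := unity_root R n k.
  have zc1 : normc (z * c) < 1 by rewrite normc_mul_unity_root.
  have [d d0 hd] := clog1m_deriv zc1 e0.
  have cn : c != 0 by rewrite -normc_gt0 normc_unity_root.
  exists d => // h h0 hlt.
  have hc0 : h * c != 0 by rewrite mulf_neq0.
  have hc : normc (h * c) < d by rewrite normc_mul_unity_root.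
  have := hd _ hc0 hc; rewrite -mulrDl => H.
  rewrite [X in normc X](_ : _ =
    ((clog1m ((z + h) * c) - clog1m (z * c)) / (h * c) - - (1 - z * c)^-1) * c).
    by rewrite (normcM _ c) normc_unity_root mulr1.
  move: (clog1m _) (clog1m _) ((1 - z * c)^-1) => a b l.
  by field; rewrite h0 cn.
- rewrite normC_lt1 => z1; rewrite cexp_sum /PhiHat; apply: eq_bigr => k _.
  by rewrite cexp_clog1m // normc_mul_unity_root.
- by rewrite big1 // => k _; rewrite mul0r clog1m0.
Qed.

Lemma Log_PhiHatP n : is_log_branch (@PhiHat R n) (Log (@PhiHat R n)).
Proof.
by apply: (@xgetPex _ (fun=> 0) [set g | is_log_branch _ g]); eexists; exact: log_branch_PhiHat.
Qed.

Lemma Log_PhiHat_cont n z : normc z < 1 -> ccont (Log (@PhiHat R n)) z.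
Proof.
rewrite -normC_lt1 => z1; have [h _ _] := Log_PhiHatP n.
apply/ccontP/differentiable_continuous/derivable1_diffP; exact: h.
Qed.

Lemma sum_Log_PhiHat n z : (0 < n)%N -> normc z < 1 ->
  \sum_(d <- divisors n) Log (@PhiHat R d) z = clog1m (z ^+ n).
Proof.
move=> n0 z1.
have zn1 w : normc w < 1 -> normc (w ^+ n) < 1.
  by move=> w1; rewrite normcX exprn_ilt1 ?normc_ge0 -?lt0n.
apply: (@log_branch_unique R (fun w => \sum_(d <- divisors n) Log (@PhiHat R d) w)
  (fun w => clog1m (w ^+ n))) => // [w w1|w w1|w w1|].
- by apply: ccont_sum => d _; apply: Log_PhiHat_cont.
- apply: (@ccont_comp R (fun w => w ^+ n) (@clog1m R)); first exact: ccont_exp.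
  exact/clog1m_cont/zn1.
- rewrite cexp_sum cexp_clog1m ?zn1 // -prod_PhiHat //; apply: eq_bigr => d _.
  by have [_ h _] := Log_PhiHatP d; apply: h; rewrite normC_lt1.
- rewrite expr0n (gtn_eqF n0) clog1m0 big1 // => d _.
  by have [] := Log_PhiHatP d.
Qed.

Lemma hyperbola_swap (V : nmodType) (g : nat -> nat -> V) N :
  \sum_(1 <= q < N.+1) \sum_(1 <= m < (N %/ q).+1) g q m =
  \sum_(1 <= m < N.+1) \sum_(1 <= q < (N %/ m).+1) g q m.
Proof.
have widen (F : nat -> V) q : (0 < q)%N -> \sum_(1 <= m < (N %/ q).+1) F m =
    \sum_(1 <= m < N.+1 | (m * q <= N)%N) F m.
  move=> q0; rewrite (@big_nat_widen _ _ _ 1 (N %/ q).+1 N.+1) ?ltnS ?leq_div //=.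
  by apply: eq_bigl => m; rewrite ltnS leq_divRL.
transitivity (\sum_(1 <= q < N.+1) \sum_(1 <= m < N.+1 | (m * q <= N)%N) g q m).
  by apply: eq_big_nat => q /andP[q0 _]; rewrite widen.
rewrite (exchange_big_dep_nat xpredT) //=; apply: eq_big_nat => m /andP[m0 _].
by rewrite widen //; apply: eq_bigl => q; rewrite mulnC.
Qed.

Lemma sum_mobius_sum_div N : (0 < N)%N ->
  \sum_(1 <= q < N.+1) mobius_sum R (N %/ q) / q%:R = 1.
Proof.
move=> N0; rewrite -[RHS](invr1 R) -(@sum_mobius_convolution _ (fun k => k%:R^-1 : R) N N0).
rewrite -hyperbola_swap; apply: eq_bigr => q _.
rewrite /mobius_sum mulr_suml; apply: eq_bigr => m _.
by rewrite natrM invfM mulrA.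
Qed.

(** Read from right to left: expand [L d] over the divisors [e] of [d = e q]. The coefficient of
    [l e / e] is then the sum of [A (N / e / q) / q] over [q], which is 1 by
    [sum_mobius_sum_div]. *)
Lemma sum_div_mobius_sum (l L : nat -> R[i]) N :
  (forall n, (0 < n)%N -> \sum_(d <- divisors n) l d = L n) ->
  \sum_(1 <= n < N.+1) l n / n%:R =
  \sum_(1 <= d < N.+1) (mobius_sum R (N %/ d))%:C * (L d / d%:R).
Proof.
move=> lL; symmetry.
pose f e q := (mobius_sum R (N %/ (e * q)))%:C * (l e / (e * q)%:R).
transitivity (\sum_(1 <= d < N.+1) \sum_(e <- divisors d) f e (d %/ e)%N).
  apply: eq_big_nat => d /andP[d0 _]; rewrite -lL // mulr_suml mulr_sumr.
  apply: eq_big_seq => e; rewrite -dvdn_divisors // => ed.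
  by rewrite /f (mulnC e) divnK.
rewrite sum_divisors_exchange; apply: eq_big_nat => e /andP[e0 eN].
have M0 : (0 < N %/ e)%N by rewrite divn_gt0.
rewrite -[RHS]mul1r -[X in X * _](rmorph1 (real_complex R)) -(sum_mobius_sum_div M0).
rewrite rmorph_sum mulr_suml; apply: eq_bigr => q _.
transitivity ((mobius_sum R (N %/ e %/ q))%:C / q%:R * (l e / e%:R)).
  by rewrite /f divnMA natrM invfM; ring.
by congr (_ * _); rewrite natC invC -[LHS]rmorphM.
Qed.

Lemma sum_expr_le (r : R) D N : 0 <= r -> r < 1 -> (D <= N)%N ->
  \sum_(D <= k < N) r ^+ k <= r ^+ D / (1 - r).
Proof.
move=> r0 r1 DN; have r10 : 0 < 1 - r by rewrite subr_gt0.
rewrite ler_pdivlMr //.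
suff -> : (\sum_(D <= k < N) r ^+ k) * (1 - r) = r ^+ D - r ^+ N.
  by rewrite gerBl exprn_ge0.
elim: N DN => [|N IH]; first by rewrite leqn0 => /eqP ->; rewrite big_geq // mul0r subrr.
rewrite leq_eqVlt => /predU1P[->|]; first by rewrite big_geq // mul0r subrr.
by rewrite ltnS => DN; rewrite big_nat_recr //= mulrDl IH // exprS; ring.
Qed.

(* Tannery: [|L d| <= 2 r^d] for large [d], while for each fixed [d] the
   coefficient [A (N / d)] tends to 0. *)
Lemma sum_Log_PhiHat_small z : normc z < 1 -> forall e : R, 0 < e ->
  exists N0, forall N, (N0 <= N)%N ->
  normc (\sum_(1 <= n < N.+1) Log (@PhiHat R n) z / n%:R) <= e.
Proof.
move=> z1 e e0; set r := normc z in z1; have r0 : 0 <= r by apply: normc_ge0.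
have r10 : 0 < 1 - r by rewrite subr_gt0.
pose L d := clog1m (z ^+ d).
have [c c0 hc] := clog1m_small R.
(* The first bound brings [z^d] into the range of [clog1m_small], the second makes the geometric
   tail at most [e / 2]. *)
pose b := Num.min (c / 2) (e / 4 * (1 - r)).
have b0 : 0 < b by rewrite lt_min divr_gt0 // mulr_gt0 // divr_gt0.
have [D hD] : exists D, r ^+ D <= b.
  have rn : `|r| < 1 by rewrite ger0_norm.
  have /cvgrPdist_le/(_ b b0)[D _ hD] := cvg_expr rn.
  exists D; have := hD D (leqnn D); rewrite sub0r normrN.
  exact: le_trans (ler_norm _).
have hDc : r ^+ D < c.
  apply: le_lt_trans hD _; rewrite gt_min; apply/orP; left.
  by rewrite ltr_pdivrMr // ltr_pMr // ltr1n.
have hDe : r ^+ D <= e / 4 * (1 - r).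
  by apply: le_trans hD _; rewrite ge_min lexx orbT.
pose S := \sum_(1 <= d < D.+1) normc (L d).
have S0 : 0 <= S by apply: sumr_ge0 => d _; apply: normc_ge0.
have S1 : 0 < S + 1 by rewrite ltr_wpDl.
have [M hM] := @mobius_sum_cvg0 R (e / 2 / (S + 1)) (divr_gt0 (divr_gt0 e0 (ltr0Sn _ 1)) S1).
(* [N >= M (D+1)] gives [N / d >= M] for every [d <= D], and the second summand gives [D < N]. *)
exists (M * D.+1 + D.+1)%N => N hN.
have DN : (D < N)%N by apply: leq_trans hN; apply: leq_addl.
rewrite (@sum_div_mobius_sum _ L) => [|n n0]; last exact: sum_Log_PhiHat.
have Ld d : (0 < d)%N -> normc (L d / d%:R) <= normc (L d).
  move=> d0; rewrite normcM normcV normc_nat ler_piMr ?normc_ge0 //.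
  by rewrite invf_le1 ?ltr0n // ler1n.
rewrite (@big_cat_nat _ _ _ D.+1) //=; last by rewrite ltnW.
apply: le_trans (le_normcD _ _) _; rewrite (splitr e); apply: lerD.
  apply: le_trans (normc_sum _ _ _) _.
  apply: le_trans (_ : \sum_(1 <= d < D.+1) e / 2 / (S + 1) * normc (L d) <= _).
    apply: ler_sum_nat => d /andP[d0 dD].
    rewrite (normcM _%:C) normc_real; apply: ler_pM; rewrite ?normc_ge0 ?Ld //.
    apply: hM; rewrite leq_divRL //; apply: leq_trans (_ : M * D.+1 <= N)%N.
      by rewrite leq_mul2l (ltnW dD) orbT.
    by apply: leq_trans hN; rewrite leq_addr.
  rewrite -mulr_sumr -/S -mulrA mulrC -[leRHS]mul1r; apply: ler_wpM2r.
    by rewrite divr_ge0 // ltW.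
  by rewrite mulrC ler_pdivrMr // mul1r lerDl.
apply: le_trans (normc_sum _ _ _) _.
apply: le_trans (_ : \sum_(D.+1 <= d < N.+1) 2 * r ^+ d <= _).
  apply: ler_sum_nat => d /andP[dD dN]; have d0 : (0 < d)%N by apply: leq_trans dD.
  rewrite (normcM _%:C) normc_real.
  apply: le_trans (ler_piMl (normc_ge0 _) (normr_mobius_sum _ _)) _.
  apply: le_trans (Ld d d0) _; rewrite /r -normcX; apply: hc.
  rewrite normcX; apply: le_lt_trans hDc; rewrite ler_wiXn2l //; last exact: ltnW.
  exact: ltW.
rewrite -mulr_sumr.
have hs := @sum_expr_le r D.+1 N.+1 r0 z1 (leqW DN).
have h2 : r ^+ D.+1 / (1 - r) <= e / 4.
  rewrite ler_pdivrMr //; apply: le_trans hDe.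
  by rewrite exprS ler_piMl ?exprn_ge0 // ltW.
by lra.
Qed.

(** The leading sign turns the factor [1 / (z - 1)] into [1 / (1 - z)], the exponential of [- Log]
    at [n = 1]. *)
Lemma prod_Phi_root_inv N z : (0 < N)%N -> normc z < 1 ->
  - \prod_(1 <= n < N.+1) Phi_root_inv n z =
  cexp (- \sum_(1 <= n < N.+1) Log (@PhiHat R n) z / n%:R).
Proof.
move=> N0 z1; rewrite -sumrN cexp_sum !(@big_ltn _ _ _ 1 N.+1) //.
rewrite -mulNr; congr (_ * _).
  have [_ h _] := Log_PhiHatP 1.
  by rewrite /Phi_root_inv /= divr1 cexpN h ?normC_lt1 // PhiHat1 invrN.
apply: eq_big_nat => n /andP[n1 _].
rewrite /Phi_root_inv gtn_eqF //; congr cexp; rewrite mul1r mulNr mulrC //.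
Qed.

End CyclotomicLog.

Theorem theorem1p1 (R : realType) (z : R[i]) (hz : `|z| < 1) :
  (fun N : nat => - \prod_(1 <= n < N.+1) Phi_root_inv n z : R[i]^o) @ \oo
    --> (1 : R[i]^o).
Proof.
have z1 : normc z < 1 by rewrite -normC_lt1.
apply/cvgrPdist_le => e /complex_gt0P[r r0 ->].
have K1 := @expK_ge1 R; have K0 : 0 < 1 + @expK R by lra.
(* For [|k| <= 1] one has [|exp k - 1| <= |k| + expK |k|^2 <= (1 + expK) |k|]. *)
pose d := Num.min 1 (r / (1 + @expK R)).
have d0 : 0 < d by rewrite lt_min ltr01 divr_gt0.
have [N0 hN0] := sum_Log_PhiHat_small z1 d0.
(* The successor makes [N] positive; at [N = 0] the empty product would give -1. *)
exists N0.+1 => // N /= hN; have Np : (0 < N)%N by apply: leq_trans hN.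
rewrite prod_Phi_root_inv //; have := hN0 N (ltnW hN); rewrite -normcN.
move: (- _) => k; rewrite le_min => /andP[k1 kr].
rewrite normcE_Re lecR normcB.
have h := cexp_sub1_lin_small k1; have k0 := normc_ge0 k.
have := le_normcD (cexp k - 1 - k) k; rewrite subrK => h2.
move: kr; rewrite ler_pdivlMr // => kr.
move: (normc k) (normc (cexp k - 1)) (normc (cexp k - 1 - k)) (@expK R) k0 k1 kr h h2 K1.
move=> q s t K q0 q1 qr h h2 K1.
have : 0 <= K * (q * (1 - q)) by rewrite !mulr_ge0 ?subr_ge0 //; lra.
by rewrite expr2 in h; lra.
Qed.
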